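(* Assume that $\eta$ is an even function. Let $\bar u=\mathbf{1}_{]-1,0[}$, i.e. $\bar u(x)=1$ for $-1<x<0$ and $\bar u(x)=0$ otherwise. Let $u$ be the (Kruzkov) entropy admissible solution of $$\partial_t u+\partial_x[u^2]=0,\qquad u(0,\cdot)=\bar u,$$ and for $0<\varepsilon\le1$ let $u_\varepsilon$ be the solution of $$\partial_t u_\varepsilon+\partial_x\big[u_\varepsilon\,(u_\varepsilon*\eta_\varepsilon)\big]=0,\qquad u_\varepsilon(0,\cdot)=\bar u.$$ Then for every $\delta>0$ the family $u_\varepsilon$ does not converge to $u$ strongly in $L^{1+\delta}$, not even up to subsequences. More precisely: for every $\delta>0$ and every $t>0$ there is no sequence $\varepsilon_k\to0^+$ such that $u_{\varepsilon_k}(t,\cdot)\to u(t,\cdot)$ strongly in $L^{1+\delta}(\mathbb{R})$.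
   Context: The space dimension is one. The kernel $\eta:\mathbb{R}\to\mathbb{R}$ satisfies $\eta\in C_c^\infty(\mathbb{R})$, $\eta(x)=0$ for $|x|\ge1$, $\eta\ge0$, $\int_{\mathbb{R}}\eta\,dx=1$, and $\eta_\varepsilon(x):=\varepsilon^{-1}\eta(x/\varepsilon)$ for $0<\varepsilon\le1$. Convolution is with respect to $x$ only. The solution $u_\varepsilon$ is the unique distributional solution in $L^\infty_{\mathrm{loc}}([0,+\infty[;L^\infty(\mathbb{R}))\cap C^0([0,+\infty[;L^1(\mathbb{R}))$; $u$ is identified with its representative in $C^0([0,+\infty[;L^1(\mathbb{R}))$. *)

(* Defs.v *)
From HB Require Import structures.
From mathcomp Require Import all_boot all_order all_algebra.
From mathcomp Require Import all_classical all_reals all_analysis.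

Set Implicit Arguments.
Unset Strict Implicit.
Unset Printing Implicit Defensive.

Import Order.TTheory GRing.Theory Num.Theory.
Import numFieldNormedType.Exports.

Local Open Scope classical_set_scope.
Local Open Scope ring_scope.

Section Defs.
Context {R : realType}.

Local Notation mu := (@lebesgue_measure R).

Definition smooth (f : R -> R) : Prop :=
  forall n x, derivable (derive1n n f) x 1.

(* Points of the time-space plane are pairs (t, x). *)
Definition dt (phi : R * R -> R) (z : R * R) : R :=
  derive1 (fun t => phi (t, z.2)) z.1.

Definition dx (phi : R * R -> R) (z : R * R) : R :=
  derive1 (fun x => phi (z.1, x)) z.2.

Fixpoint Cn (n : nat) (phi : R * R -> R) : Prop :=
  continuous phi /\
  if n is m.+1 then
    [/\ forall z, derivable (fun t => phi (t, z.2)) z.1 1,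
        forall z, derivable (fun x => phi (z.1, x)) z.2 1,
        Cn m (dt phi) & Cn m (dx phi)]
  else True.

Definition open_half_plane : set (R * R) := [set z | 0 < z.1].

Definition closed_support (phi : R * R -> R) : set (R * R) :=
  closure [set z | phi z != 0].

(* phi belongs to C_c^oo (]0, +oo[ x R), extended by zero to t <= 0. *)
Definition test_function (phi : R * R -> R) : Prop :=
  [/\ forall n, Cn n phi,
      compact (closed_support phi) &
      closed_support phi `<=` open_half_plane].

(* There is no separate compact support clause: a function vanishing outside
   ]-1, 1[ is supported in [-1, 1]. *)
Definition convolution_kernel (eta : R -> R) : Prop :=
  [/\ smooth eta,
      forall x, 1 <= `|x| -> eta x = 0,
      forall x, 0 <= eta x &
      (\int[mu]_x eta x)%R = 1].

Definition rescale (eta : R -> R) (e : R) (x : R) : R := e^-1 * eta (x / e).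

Definition convolution (f g : R -> R) (x : R) : R :=
  (\int[mu]_y (f y * g (x - y)))%R.

(* Integral over ]0, +oo[ x R. *)
Definition half_plane_integral (F : R * R -> R) : R :=
  (\int[(mu \x mu)%E]_(z in open_half_plane) F z)%R.

(* u belongs to L^oo_loc([0, +oo[; L^oo(R)) and to C^0([0, +oo[; L^1(R)).
   Here u t is the value at time t of the L^1-continuous representative, so
   that pointwise-in-time statements about u are meaningful.  The values of u
   at negative times are irrelevant. *)
Definition solution_space (u : R -> R -> R) : Prop :=
  [/\ measurable_fun [set z : R * R | 0 <= z.1] (fun z : R * R => u z.1 z.2),
      forall T : R, exists M : R,
        {ae (mu \x mu)%E, forall z : R * R, 0 <= z.1 <= T -> `|u z.1 z.2| <= M},
      forall t, 0 <= t -> mu.-integrable [set: R] (EFin \o u t) &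
      forall t, 0 <= t ->
        ('N[mu]_1%:E[EFin \o (u s \- u t)%R])%E
          @[s --> within [set s | 0 <= s] (nbhs t)] --> 0%E].

Definition initial_datum (u : R -> R -> R) (u0 : R -> R) : Prop :=
  {ae mu, forall x, u 0 x = u0 x}.

(* Distributional solutions of
   d_t u + d_x [u (u * eta)] = 0,  u(0, .) = u0. *)
Definition nonlocal_solution (eta u0 : R -> R) (u : R -> R -> R) : Prop :=
  [/\ solution_space u, initial_datum u u0 &
      forall phi, test_function phi ->
        half_plane_integral (fun z =>
          u z.1 z.2 * dt phi z
          + u z.1 z.2 * convolution (u z.1) eta z.2 * dx phi z) = 0].

(* Kruzkov entropy admissible solutions of d_t u + d_x [f u] = 0,
   u(0, .) = u0. *)
Definition entropy_solution (f : R -> R) (u0 : R -> R) (u : R -> R -> R) :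
    Prop :=
  [/\ solution_space u, initial_datum u u0 &
      forall (k : R) phi, test_function phi -> (forall z, 0 <= phi z) ->
        0 <= half_plane_integral (fun z =>
          `|u z.1 z.2 - k| * dt phi z
          + Num.sg (u z.1 z.2 - k) * (f (u z.1 z.2) - f k) * dx phi z)].

End Defs.

(* Main.v *)
(** With V = v * k, a nonlocal solution v is renormalised: the commutator argument of DiPerna and
    Lions gives d/dt int b(v) = - int V_x (v b'(v) - b(v)).  For b(v) = v ln v the right-hand side
    is - int (v * k') v = 0, because k' is odd.  Hence int v(t) ln v(t) >= int ubar ln ubar = 0,
    and ln y <= (y^delta - 1) / delta upgrades this to int v(t)^(1+delta) >= int v(t) = 1,
    uniformly in epsilon.  If v_epsilon(t) converged to u(t) in L^(1+delta), the same bound would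
    hold for u(t).  But 0 <= u <= 1 and int u <= 1, so u(t) would only take the values 0 and 1.
    The integral of the entropy |v - 1/2| - 1/2 is nonpositive and decreases in time, hence u(s)
    would only take the values 0 and 1 for all s <= t.  Then no entropy would be available on the
    left of x = -1/2 to feed the flux of entropy through that point, which is positive for small
    times since ubar = 1 there. *)

Require Import Defs.
From HB Require Import structures.
From mathcomp Require Import all_boot all_order all_algebra.
From mathcomp Require Import all_classical all_reals all_analysis.
From mathcomp Require Import measurable_realfun.
From mathcomp Require Import ring lra.

Import Order.TTheory GRing.Theory Num.Theory.
Import numFieldNormedType.Exports.

Local Open Scope classical_set_scope.
Local Open Scope ring_scope.
Set Implicit Arguments.
Unset Strict Implicit.
Unset Printing Implicit Defensive.

(** * Integrable functions *)

Section L1.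
Context d (T : measurableType d) (R : realType) (mu : {measure set T -> \bar R}).
Implicit Types f g h : T -> R.

(** Solutions are only continuous into L^1, so no time derivative is given. Plateaus in time turn
    the weak formulations into difference inequalities for spatial moments, and every later time
    derivative is derived from these. As the kernel is smooth, V is Lipschitz in space and the
    commutator with a mollifier of width d is pointwise O(d); the gradient of the mollified solution
    is o(1/d) in L^1, because the derivative of a mollifier has mass zero, so the product vanishes.
    Renormalisation is available for b of class C^2 with b(0) = b'(0) = 0, which excludes v ln v: it
    is replaced by b_a(v) = (v + a) ln((v + a)/a) - v, for which v b_a' - b_a = v - a ln((v + a)/a).
    Parity kills the part v, and the rest tends to zero with a, uniformly on compact time intervals.
    The logarithm needs v >= 0, which is proved beforehand by renormalising with the cube of the
    negative part and a Gronwall argument. For the local equation, 0 <= u <= 1 and int u <= 1 come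
    from the Kruzkov entropies with k = 0 and k = 1. *)

Definition L1 f := mu.-integrable [set: T] (EFin \o f).

Local Notation I f := (\int[mu]_x f x).

Lemma ae_imp (P Q : T -> Prop) : (forall x, P x -> Q x) ->
  {ae mu, forall x, P x} -> {ae mu, forall x, Q x}.
Proof. by move=> PQ; apply: filterS. Qed.

Lemma ae_imp2 (P P' Q : T -> Prop) : (forall x, P x -> P' x -> Q x) ->
  {ae mu, forall x, P x} -> {ae mu, forall x, P' x} -> {ae mu, forall x, Q x}.
Proof. by move=> PQ; apply: filterS2. Qed.

Lemma ae_all (P : T -> Prop) : (forall x, P x) -> {ae mu, forall x, P x}.
Proof. by move=> HP; apply: filterE. Qed.

Lemma L1_measurable f : L1 f -> measurable_fun setT f.
Proof. by move=> /integrableP[/measurable_EFinP]. Qed.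

Lemma L1_le g f : measurable_fun setT f -> (forall x, `|f x| <= g x) ->
  L1 g -> L1 f.
Proof.
move=> mf fg; apply: le_integrable => //; first exact/measurable_EFinP.
by move=> x _ /=; rewrite lee_fin (le_trans (fg x))// ler_norm.
Qed.

Lemma L1_ae_eq f g : measurable_fun setT f -> measurable_fun setT g ->
  {ae mu, forall x, f x = g x} -> L1 f -> L1 g.
Proof.
move=> mf mg fg /integrableP[_ If]; apply/integrableP; split.
  exact/measurable_EFinP.
rewrite (_ : (\int[mu]_x _ = \int[mu]_x `|(EFin \o f) x|)%E)//.
apply: ge0_ae_eq_integral => //.
- by apply/measurable_EFinP; exact: measurableT_comp.
- by apply/measurable_EFinP; exact: measurableT_comp.
- by apply: filterS fg => x /= ->.
Qed.

Lemma L1_ae_le g f : measurable_fun setT f ->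
  {ae mu, forall x, `|f x| <= g x} -> L1 g -> L1 f.
Proof.
move=> mf fg Lg; have mg := L1_measurable Lg.
have mm : measurable_fun setT (fun x => Num.min `|f x| (g x)).
  by apply: measurable_minr => //; exact: measurableT_comp.
have [N [mN N0 sN]] := fg.
(* Zeroing [f] on the null set turns the almost everywhere bound into one valid at every point, as
   [L1_le] expects; [g] may be negative on [N], hence the majorant [|g|]. *)
pose h x := f x * \1_(~` N) x.
have mh : measurable_fun setT h.
  by apply: measurable_funM => //; apply: measurable_indic; exact: measurableC.
apply: (@L1_ae_eq h) => //.
  exists N; split => // x /= hx; apply: contrapT => Nx; apply: hx.
  by rewrite /h indicE mem_set// mulr1.
apply: (@L1_le (fun x => `|g x|)) => //; last exact: integrable_norm.
move=> x; rewrite /h indicE; have [xN|xN] := boolP (x \in ~` N).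
  rewrite mulr1; move/set_mem: xN => xN.
  have : `|f x| <= g x by apply: contrapT => /sN.
  by move=> /le_trans; apply; rewrite ler_norm.
by rewrite mulr0 normr0.
Qed.

Lemma L1_cst0 : L1 (fun=> 0).
Proof. exact: integrable0. Qed.

Lemma L1_add f g : L1 f -> L1 g -> L1 (fun x => f x + g x).
Proof. by move=> Lf Lg; apply: eq_integrable (integrableD measurableT Lf Lg). Qed.

Lemma L1_scale r f : L1 f -> L1 (fun x => r * f x).
Proof. by move=> Lf; apply: eq_integrable (integrableZl measurableT r Lf). Qed.

Lemma L1_opp f : L1 f -> L1 (fun x => - f x).
Proof. by move=> Lf; apply: eq_integrable (integrableN Lf). Qed.

Lemma L1_sub f g : L1 f -> L1 g -> L1 (fun x => f x - g x).
Proof. by move=> Lf Lg; apply: L1_add => //; exact: L1_opp. Qed.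

Lemma L1_norm f : L1 f -> L1 (fun x => `|f x|).
Proof. exact: integrable_norm. Qed.

Lemma L1_mul_bnd C f g : L1 f -> measurable_fun setT g ->
  (forall x, `|g x| <= C) -> L1 (fun x => f x * g x).
Proof.
move=> Lf mg gC; apply: (@L1_le (fun x => C * `|f x|)).
- by apply: measurable_funM => //; exact: L1_measurable.
- by move=> x; rewrite normrM mulrC ler_wpM2r.
- by apply: L1_scale; exact: L1_norm.
Qed.

Lemma integral_add f g : L1 f -> L1 g ->
  I (fun x => f x + g x) = I f + I g.
Proof. by move=> Lf Lg; exact: RintegralD. Qed.

Lemma integral_sub f g : L1 f -> L1 g ->
  I (fun x => f x - g x) = I f - I g.
Proof. by move=> Lf Lg; exact: RintegralB. Qed.

Lemma integral_scale r f : L1 f -> I (fun x => r * f x) = r * I f.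
Proof. by move=> Lf; exact: RintegralZl. Qed.

Lemma integral_opp f : L1 f -> I (fun x => - f x) = - I f.
Proof.
move=> Lf; rewrite -mulN1r -integral_scale//.
by apply: eq_Rintegral => x _; rewrite mulN1r.
Qed.

Lemma integral_ae_le f g : L1 f -> L1 g -> {ae mu, forall x, f x <= g x} ->
  I f <= I g.
Proof.
move=> Lf Lg fg; rewrite -subr_ge0 -integral_sub//.
have Lgf := L1_sub Lg Lf.
rewrite (_ : \int[mu]_x (g x - f x) = \int[mu]_x `|g x - f x|).
  by apply: Rintegral_ge0.
rewrite /Rintegral; congr fine; apply: ae_eq_integral => //.
- exact: measurable_int Lgf.
- exact: measurable_int (L1_norm Lgf).
- by apply: filterS fg => x /= fg _; rewrite ger0_norm// subr_ge0.
Qed.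

Lemma integral_le f g : L1 f -> L1 g -> (forall x, f x <= g x) -> I f <= I g.
Proof. by move=> Lf Lg fg; apply: le_Rintegral. Qed.

Lemma integral_ae_eq0 f g : L1 f -> L1 g -> {ae mu, forall x, f x = g x} ->
  I f = I g.
Proof.
move=> Lf Lg fg; apply/eqP; rewrite eq_le !integral_ae_le//.
  by apply: filterS fg => x ->.
by apply: filterS fg => x ->.
Qed.

Lemma integral_norm_le f : L1 f -> `|I f| <= \int[mu]_x `|f x|.
Proof. exact: le_normr_Rintegral. Qed.

Lemma integral_norm_sub f g : L1 f -> L1 g ->
  `|I f - I g| <= \int[mu]_x `|f x - g x|.
Proof.
move=> Lf Lg; rewrite -integral_sub//; apply: integral_norm_le.
exact: L1_sub.
Qed.

Lemma integral_norm_eq0 f : L1 f -> \int[mu]_x `|f x| = 0 ->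
  {ae mu, forall x, f x = 0}.
Proof.
move=> Lf f0; have /= := ae_eq_integral_abs mu measurableT (measurable_int _ Lf).
case=> + _; have -> : (\int[mu]_x `|(EFin \o f) x| = 0)%E.
  transitivity ((\int[mu]_x `|f x|)%:E); last by rewrite f0.
  rewrite /Rintegral fineK//; apply: integrable_fin_num => //.
  exact: L1_norm.
by move=> /(_ erefl); apply: filterS => x /= /(_ Logic.I)[].
Qed.

Lemma integral_ge0_eq0 f : L1 f -> {ae mu, forall x, 0 <= f x} -> I f <= 0 ->
  {ae mu, forall x, f x = 0}.
Proof.
move=> Lf f0 If; apply: integral_norm_eq0 => //.
rewrite (_ : \int[mu]_x `|f x| = I f).
  apply/eqP; rewrite eq_le If/=; apply: le_trans (integral_ae_le L1_cst0 Lf f0).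
  by rewrite /Rintegral integral0.
apply: integral_ae_eq0 => //; first exact: L1_norm.
by apply: filterS f0 => x /ger0_norm.
Qed.

Lemma integral_dct (f_ : nat -> T -> R) f g :
  (forall n, measurable_fun setT (f_ n)) -> measurable_fun setT f -> L1 g ->
  (forall n, {ae mu, forall x, `|f_ n x| <= g x}) ->
  {ae mu, forall x, f_ n x @[n --> \oo] --> f x} ->
  L1 f /\ I (f_ n) @[n --> \oo] --> I f.
Proof.
move=> mf_ mf Lg fg ff.
have [|||||] := @dominated_convergence _ _ _ mu setT measurableT
  (fun n => EFin \o f_ n) (EFin \o f) (EFin \o g).
- by move=> n; exact/measurable_EFinP.
- exact/measurable_EFinP.
- by apply: filterS ff => x fx _; apply/cvg_EFin => //; apply: nearW.
- exact: Lg.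
- apply: filterS (ae_foralln fg) => x /= fgx n _.
  by rewrite lee_fin.
- move=> Lf _ h; split => //.
  by apply: fine_cvg; rewrite /Rintegral fineK//; exact: integrable_fin_num.
Qed.

End L1.

(** * Fubini and Tonelli on the time-space plane *)

Section Plane.
Context {R : realType}.
Local Notation mu := (@lebesgue_measure R).
Local Notation I f := (\int[mu]_x f x).
Implicit Types (f g : R -> R) (G : R * R -> R).

Lemma L1_plane (a : R -> R) G : measurable_fun setT G -> L1 mu a ->
  (forall t, L1 mu (fun x => G (t, x)) /\ \int[mu]_x `|G (t, x)| <= a t) ->
  L1 (mu \x mu)%E G.
Proof.
move=> mG La Gt; apply/integrable12ltyP; first exact/measurable_EFinP.
have mEG : measurable_fun setT (fun z : R * R => `|(EFin \o G) z|)%E.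
  by apply/measurable_EFinP; exact: measurableT_comp.
apply: le_lt_trans (integrable_lty measurableT La).
apply: ge0_le_integral => //.
- by move=> t _; exact: integral_ge0.
- exact: (measurable_fun_fubini_tonelli_F (m2 := mu) _ mEG (fun=> abse_ge0 _)).
- exact: measurable_int La.
- move=> t _; have [LG Ga] := Gt t.
  rewrite /= -lee_fin in Ga; apply: le_trans Ga.
  rewrite /Rintegral fineK//.
  exact: (integrable_fin_num measurableT (L1_norm LG)).
Qed.

(** The real inner integral is the [fine] of the extended one, so it agrees with [fubini_F] only at
    times where the latter is finite. These are almost all times, which is enough for the outer
    integral. *)
Lemma fubini1 G : L1 (mu \x mu)%E G ->
  L1 mu (fun t => \int[mu]_x G (t, x)) /\
  \int[(mu \x mu)%E]_z G z = \int[mu]_t \int[mu]_x G (t, x).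
Proof.
move=> LG; have mG := L1_measurable LG.
have LF := integrable_fubini_F (m1 := mu) (m2 := mu) LG.
have mF := measurable_int _ LF.
have ae1 := integrable_ae measurableT LF.
have E : ae_eq mu setT (fubini_F mu (EFin \o G)) (EFin \o (fun t => \int[mu]_x G (t, x))).
  apply: filterS ae1 => t /= h _; rewrite /Rintegral fineK//.
  exact: h.
have mF' : measurable_fun setT (fun t => \int[mu]_x G (t, x)).
  exact: (measurableT_comp (fine_measurable measurableT) mF).
split.
  apply/integrableP; split; first exact/measurable_EFinP.
  have /integrableP[_] := LF; congr (_ < _)%E.
  apply: ae_eq_integral => //.
  - exact: measurableT_comp.
  - by apply: measurableT_comp => //; exact/measurable_EFinP.
  - by apply: filterS E => t h ?; congr (`|_|)%E; exact: h.
rewrite {1 2}/Rintegral -(integral12_prod_meas1 LG); congr fine.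
by apply: ae_eq_integral => //; exact/measurable_EFinP.
Qed.

Lemma fubini2 G : L1 (mu \x mu)%E G ->
  L1 mu (fun x => \int[mu]_t G (t, x)) /\
  \int[(mu \x mu)%E]_z G z = \int[mu]_x \int[mu]_t G (t, x).
Proof.
move=> LG; have mG := L1_measurable LG.
have mF := measurable_fubini_G (m1 := mu) (m2 := mu) LG.
have mEG : measurable_fun setT (fun z : R * R => `|(EFin \o G) z|)%E.
  by apply/measurable_EFinP; exact: measurableT_comp.
have LF : mu.-integrable setT (fubini_G mu (EFin \o G)).
  apply/integrableP; split => //.
  have := (integrable21ltyP mu mu ((measurable_EFinP _ _).2 mG)).1 LG.
  apply: le_lt_trans.
  apply: ge0_le_integral => //.
  - exact: measurableT_comp.
  - exact: (measurable_fun_fubini_tonelli_G (m1 := mu) _ mEG (fun=> abse_ge0 _)).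
  - move=> x _; apply: le_abse_integral => //; apply/measurable_EFinP.
    exact: (measurableT_comp mG (pair2_measurable x)).
have ae1 := integrable_ae measurableT LF.
have E : ae_eq mu setT (fubini_G mu (EFin \o G)) (EFin \o (fun x => \int[mu]_t G (t, x))).
  apply: filterS ae1 => t /= h _; rewrite /Rintegral fineK//.
  exact: h.
have mF' : measurable_fun setT (fun x => \int[mu]_t G (t, x)).
  exact: (measurableT_comp (fine_measurable measurableT) mF).
split.
  apply/integrableP; split; first exact/measurable_EFinP.
  have /integrableP[_] := LF; congr (_ < _)%E.
  apply: ae_eq_integral => //.
  - exact: measurableT_comp.
  - by apply: measurableT_comp => //; exact/measurable_EFinP.
  - by apply: filterS E => t h ?; congr (`|_|)%E; exact: h.
rewrite {1 2}/Rintegral -(integral21_prod_meas1 LG); congr fine.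
by apply: ae_eq_integral => //; exact/measurable_EFinP.
Qed.

Lemma ae_plane (P : R * R -> Prop) : {ae (mu \x mu)%E, forall z, P z} ->
  {ae mu, forall t, {ae mu, forall x, P (t, x)}}.
Proof.
move=> [N [mN N0 sN]].
have h0 : (\int[mu]_t `|mu (xsection N t)| = 0)%E.
  rewrite -N0; apply: eq_integral => t _; rewrite gee0_abs//.
have := (ae_eq_integral_abs mu measurableT
  (measurable_fun_xsection mu mN)).1 h0.
apply: filterS => t /(_ Logic.I) /= Nt0.
exists (xsection N t); split => //; first exact: measurable_xsection.
move=> x /= nP; rewrite xsectionE /=; exact: sN.
Qed.

Lemma continuous_measurable f : continuous f -> measurable_fun setT f.
Proof. exact: continuous_measurable_fun. Qed.

Lemma L1_compact f C r : measurable_fun setT f -> (forall x, `|f x| <= C) ->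
  (forall x, r <= `|x| -> f x = 0) -> L1 mu f.
Proof.
move=> mf fC f0.
have LI : L1 mu (fun x => C * \1_(`[- r, r]) x).
  by apply: L1_scale; exact: integrable_indic_itv.
apply: L1_le LI => // x; rewrite indicE.
have [xr|xr] := leP r `|x|.
  rewrite f0// normr0 mulr_ge0//; exact: le_trans (fC x).
rewrite mem_set ?mulr1//= in_itv/= -ler_norml; exact: ltW.
Qed.

Lemma bounded_compact_support f r : continuous f ->
  (forall x, r <= `|x| -> f x = 0) -> exists C, forall x, `|f x| <= C.
Proof.
move=> cf f0.
(* The radius [r] may be negative, so the extreme value theorem is applied on [-|r|, |r|], which is
   never empty. *)
have rr : - `|r| <= `|r| by rewrite (le_trans _ (normr_ge0 r))// oppr_le0.
have cn : {within `[- `|r|, `|r|], continuous (fun x => `|f x|)}.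
  apply: continuous_subspaceT => x; apply: continuous_comp; first exact: cf.
  exact: norm_continuous.
have [c _ hc] := EVT_max rr cn.
exists `|f c| => x; have [rx|xr] := leP r `|x|; first by rewrite f0// normr0.
by apply: hc; rewrite in_itv/= -ler_norml (le_trans (ltW xr))// ler_norm.
Qed.

End Plane.

(** * Smooth functions and bumps *)

Section Smooth.
Context {R : realType}.
Local Notation mu := (@lebesgue_measure R).
Local Notation I f := (\int[mu]_x f x).
Local Notation isd f x df := (is_derive (x : R) (1 : R) (f : R -> R) (df : R)).
Implicit Types (f g h k df : R -> R).

Lemma is_derive_add f g (x a b : R) : isd f x a -> isd g x b ->
  isd (fun y => f y + g y) x (a + b).
Proof. exact: is_deriveD. Qed.

Lemma is_derive_sub f g (x a b : R) : isd f x a -> isd g x b ->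
  isd (fun y => f y - g y) x (a - b).
Proof. exact: is_deriveB. Qed.

Lemma is_derive_mul f g (x a b : R) : isd f x a -> isd g x b ->
  isd (fun y => f y * g y) x (f x * b + g x * a).
Proof. exact: is_deriveM. Qed.

Lemma is_derive_scale c f (x a : R) : isd f x a -> isd (fun y => c * f y) x (c * a).
Proof. exact: is_deriveZ. Qed.

Lemma is_derive_comp f g (x a b : R) : isd f (g x) a -> isd g x b ->
  isd (fun y => f (g y)) x (a * b).
Proof. exact: is_derive1_comp. Qed.

Lemma is_derive_affine f a b (x c : R) : isd f (a * x + b) c ->
  isd (fun y => f (a * y + b)) x (a * c).
Proof.
move=> Df; rewrite mulrC; apply: (@is_derive_comp f (fun y => a * y + b) x c a Df).
rewrite -[X in isd _ _ X]addr0; apply: is_derive_add.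
rewrite -[X in isd _ _ X]mulr1; apply: is_derive_scale; exact: is_derive_id.
Qed.

Lemma is_derive_derive1 f (x c : R) : isd f x c -> derive1 f x = c.
Proof. by move=> H; rewrite derive1E; exact: derive_val. Qed.

Lemma derivable_is_derive f (x : R) : derivable f x 1 -> isd f x (derive1 f x).
Proof. by move=> H; rewrite derive1E; exact: DeriveDef. Qed.

Lemma is_derive_continuous f (x c : R) : isd f x c -> {for x, continuous f}.
Proof.
by case=> H _; apply/differentiable_continuous/derivable1_diffP.
Qed.

Lemma is_derive_derivable f (x c : R) : isd f x c -> derivable f x 1.
Proof. by case. Qed.

Lemma smooth_derivable f : smooth f -> forall x, derivable f x 1.
Proof. by move=> sf x; exact: (sf 0%N x). Qed.

Lemma smooth_is_derive f (x : R) : smooth f -> isd f x (derive1 f x).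
Proof. by move=> sf; apply: derivable_is_derive; exact: smooth_derivable. Qed.

Lemma smooth_derive1 f : smooth f -> smooth (derive1 f).
Proof. by move=> sf n x; rewrite -derive1Sn; exact: sf. Qed.

(** A coinduction principle: a class closed under differentiation contains all iterated derivatives
    of its members. Exhibiting such a class replaces closed formulas for the n-th derivative of
    products, affine substitutions and convolutions. *)
Lemma smooth_coind (P : (R -> R) -> Prop) :
  (forall f, P f -> exists2 df : R -> R, (forall x, isd f x (df x)) & P df) ->
  forall f, P f -> smooth f.
Proof.
move=> HP f Pf n x.
have : P (derive1n n f).
  elim: n => [//|n IH]; rewrite derive1nS.
  have [df dfE] := HP _ IH; rewrite (_ : derive1 _ = df)//.
  by apply/funext => y; exact: is_derive_derive1.
by move=> /HP[df dfE _]; exact: is_derive_derivable (dfE x).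
Qed.

Lemma smooth_continuous f : smooth f -> continuous f.
Proof. by move=> sf x; apply: is_derive_continuous; exact: smooth_is_derive. Qed.

Lemma smooth_measurable f : smooth f -> measurable_fun setT f.
Proof. by move=> /smooth_continuous/continuous_measurable. Qed.

Lemma smooth_intro f df : (forall x, isd f x (df x)) -> smooth df -> smooth f.
Proof.
move=> H sdf [|n] x; first exact: is_derive_derivable (H x).
rewrite derive1Sn (_ : derive1 _ = df); first exact: sdf.
by apply/funext => y; exact: is_derive_derive1.
Qed.

Lemma smooth_cst (c : R) : smooth (fun=> c).
Proof.
apply: (@smooth_coind (fun f => exists c, f = fun=> c)); last by exists c.
move=> f [{}c ->]; exists (fun=> 0); last by exists 0.
by move=> x; exact: is_derive_cst.
Qed.

(* The derivative of a sum or of a product of smooth functions is again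
   a sum of products of smooth functions: this closure is the invariant. *)
Inductive smooth_closure : (R -> R) -> Prop :=
| smooth_closure_base f : smooth f -> smooth_closure f
| smooth_closure_add f g : smooth_closure f -> smooth_closure g ->
    smooth_closure (fun x => f x + g x)
| smooth_closure_mul f g : smooth_closure f -> smooth_closure g ->
    smooth_closure (fun x => f x * g x).

Lemma smooth_closureP f : smooth_closure f -> smooth f.
Proof.
apply: smooth_coind => {}f.
elim=> {f} [f sf|f g _ [df f' cf] _ [dg g' cg]|f g cf [df f' cf'] cg [dg g' cg']].
- exists (derive1 f); first by move=> x; exact: smooth_is_derive.
  exact/smooth_closure_base/smooth_derive1.
- exists (fun x => df x + dg x); last exact: smooth_closure_add.
  by move=> x; exact: is_derive_add.
- exists (fun x => f x * dg x + g x * df x).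
    by move=> x; exact: is_derive_mul.
  by apply: smooth_closure_add; exact: smooth_closure_mul.
Qed.

Lemma smooth_add f g : smooth f -> smooth g -> smooth (fun x => f x + g x).
Proof.
by move=> sf sg; apply: smooth_closureP; apply: smooth_closure_add;
  exact: smooth_closure_base.
Qed.

Lemma smooth_mul f g : smooth f -> smooth g -> smooth (fun x => f x * g x).
Proof.
by move=> sf sg; apply: smooth_closureP; apply: smooth_closure_mul;
  exact: smooth_closure_base.
Qed.

Lemma smooth_scale c f : smooth f -> smooth (fun x => c * f x).
Proof. by move=> sf; exact: (smooth_mul (@smooth_cst c) sf). Qed.

Lemma smooth_sub f g : smooth f -> smooth g -> smooth (fun x => f x - g x).
Proof.
move=> sf sg; rewrite (_ : (fun x => _) = fun x => f x + -1 * g x).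
  by apply: (smooth_add sf); exact: smooth_scale.
by apply/funext => x; rewrite mulN1r.
Qed.

Lemma smooth_affine f a b : smooth f -> smooth (fun x => f (a * x + b)).
Proof.
move=> sf; apply: (@smooth_coind (fun h => exists c f, smooth f /\
  h = fun x => c * f (a * x + b))); last first.
  by exists 1, f; split => //; apply/funext => x; rewrite mul1r.
move=> h [c [{}f [{}sf ->]]].
exists (fun x => c * a * derive1 f (a * x + b)); last first.
  exists (c * a), (derive1 f); split; [exact: smooth_derive1|reflexivity].
move=> x; rewrite -mulrA; apply: is_derive_scale.
by apply: is_derive_affine; exact: smooth_is_derive.
Qed.

Lemma derive1_affine f a b x : smooth f ->
  derive1 (fun x => f (a * x + b)) x = a * derive1 f (a * x + b).
Proof.
move=> sf; apply: is_derive_derive1.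
by apply: is_derive_affine; exact: smooth_is_derive.
Qed.

Lemma smooth_shift f c : smooth f -> smooth (fun x => f (x - c)).
Proof.
move=> sf; rewrite (_ : (fun x => _) = fun x => f (1 * x + - c)).
  exact: smooth_affine.
by apply/funext => x; rewrite mul1r.
Qed.

Lemma derive1_shift f c x : smooth f ->
  derive1 (fun x => f (x - c)) x = derive1 f (x - c).
Proof.
move=> sf; rewrite (_ : (fun x => _) = fun x => f (1 * x + - c)).
  by rewrite derive1_affine// !mul1r.
by apply/funext => y; rewrite mul1r.
Qed.

Lemma derive1_reflect f c x : smooth f ->
  derive1 (fun y => f (c - y)) x = - derive1 f (c - x).
Proof.
move=> sf; rewrite (_ : (fun x => _) = fun x => f (-1 * x + c)).
  by rewrite derive1_affine// !mulN1r [in RHS]addrC.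
by apply/funext => y; rewrite mulN1r addrC.
Qed.

Lemma derive1_mul f g x : smooth f -> smooth g ->
  derive1 (fun x => f x * g x) x = f x * derive1 g x + g x * derive1 f x.
Proof.
by move=> sf sg; apply: is_derive_derive1; apply: is_derive_mul; exact: smooth_is_derive.
Qed.

Lemma derive1_sub f g x : smooth f -> smooth g ->
  derive1 (fun x => f x - g x) x = derive1 f x - derive1 g x.
Proof.
by move=> sf sg; apply: is_derive_derive1; apply: is_derive_sub; exact: smooth_is_derive.
Qed.

Lemma smooth_one : smooth (fun _ : R => 1 : R).
Proof. exact: smooth_cst. Qed.

Lemma derive1_one x : derive1 (fun _ : R => 1 : R) x = 0.
Proof. by apply: is_derive_derive1; exact: is_derive_cst. Qed.

Lemma derive1_near0 f x : (\forall y \near x, f y = 0) -> derive1 f x = 0.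
Proof.
move=> f0; apply: is_derive_derive1.
apply: (@near_eq_is_derive R R R (cst 0)).
by apply: filterS f0 => y ->.
Qed.

Lemma lipschitz_derive f C : smooth f -> (forall x, `|derive1 f x| <= C) ->
  forall x y, `|f x - f y| <= C * `|x - y|.
Proof.
move=> sf fC.
suff H x y : x <= y -> `|f y - f x| <= C * `|y - x|.
  move=> x y; have [xy|yx] := leP x y; last by apply: H; exact: ltW.
  by rewrite distrC [`|x - y|]distrC; exact: H.
move=> xy; have [//|||c _ ->] := @MVT_segment _ f (derive1 f) x y.
- by move=> z _; exact: smooth_is_derive.
- exact/continuous_subspaceT/smooth_continuous.
- by rewrite normrM ler_wpM2r.
Qed.

(** Sign and mass are left free so that the class is stable under derivatives, reflections, affine
    substitutions and multiplication by smooth functions. *)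
Definition bump k := smooth k /\ exists r : R, forall x, r <= `|x| -> k x = 0.

Lemma bump_smooth k : bump k -> smooth k. Proof. by case. Qed.

Lemma bump_bounded k : bump k -> exists C : R, forall x, `|k x| <= C.
Proof. by move=> [/smooth_continuous sk [r kr]]; exact: bounded_compact_support kr. Qed.

Lemma bump_L1 k : bump k -> L1 mu k.
Proof.
move=> bk; have [C kC] := bump_bounded bk; case: bk => [sk [r kr]].
exact: (L1_compact (smooth_measurable sk) kC kr).
Qed.

Lemma derive1_support k r : (forall x, r <= `|x| -> k x = 0) ->
  forall x, r < `|x| -> derive1 k x = 0.
Proof.
move=> kr x rx; apply: derive1_near0; near=> y; apply: kr.
near: y; have : `|y| @[y --> x] --> `|x| by exact: norm_continuous.
by move=> /cvgr_ge; apply.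
Unshelve. all: by end_near. Qed.

Lemma bump_derive k : bump k -> bump (derive1 k).
Proof.
move=> [sk [r kr]]; split; first exact: smooth_derive1.
(* [derive1_support] argues in a neighbourhood and needs a strict inequality, hence the larger
   radius. *)
exists (r + 1) => x rx; apply: (derive1_support kr).
by apply: lt_le_trans rx; rewrite ltrDl.
Qed.

Lemma bump_support k : bump k ->
  exists2 r : R, 0 < r & forall x, r <= `|x| -> k x = 0.
Proof.
move=> [_ [r kr]]; exists (`|r| + 1); first by rewrite ltr_wpDl.
move=> x rx; apply: kr; apply: le_trans (ler_norm _) _.
by apply: le_trans rx; rewrite lerDl.
Qed.

Lemma bump_affine k a b : a != 0 -> bump k -> bump (fun x => k (a * x + b)).
Proof.
move=> a0 [sk [r kr]]; split; first exact: smooth_affine.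
exists ((r + `|b|) / `|a|) => x.
rewrite ler_pdivrMr ?normr_gt0// => rx; apply: kr.
rewrite -(lerD2r `|b|) (le_trans rx)// mulrC -normrM.
by rewrite (le_trans _ (ler_normB (a * x + b) b))// addrK.
Qed.

Lemma bump_reflect k c : bump k -> bump (fun y => k (c - y)).
Proof.
move=> bk; rewrite (_ : (fun x => _) = fun x => k (-1 * x + c)).
  by apply: bump_affine => //; rewrite oppr_eq0 oner_eq0.
by apply/funext => x; rewrite mulN1r addrC.
Qed.

Lemma bump_shift k c : bump k -> bump (fun y => k (y - c)).
Proof.
move=> bk; rewrite (_ : (fun x => _) = fun x => k (1 * x + - c)).
  by apply: bump_affine => //; rewrite oner_eq0.
by apply/funext => x; rewrite mul1r.
Qed.

Lemma bump_mul f k : smooth f -> bump k -> bump (fun x => f x * k x).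
Proof.
move=> sf [sk [r kr]]; split; first exact: smooth_mul.
by exists r => x rx; rewrite kr// mulr0.
Qed.

Lemma bump_scale c k : bump k -> bump (fun x => c * k x).
Proof. by apply: bump_mul; exact: smooth_cst. Qed.

Lemma bump_rescale k e : 0 < e -> bump k -> bump (rescale k e).
Proof.
move=> e0 bk; apply: bump_scale.
rewrite (_ : (fun x => _) = fun x => k (e^-1 * x + 0)).
  by apply: bump_affine => //; rewrite invr_eq0 gt_eqF.
by apply/funext => x; rewrite addr0 mulrC.
Qed.

Lemma integral_derive_compact f df r :
  (forall x, isd f x (df x)) -> continuous df ->
  (forall x, r <= `|x| -> f x = 0) -> I df = 0.
Proof.
move=> fdf cdf f0.
(* Whatever the sign of [r], the interval [-b, b] is nondegenerate and [f] vanishes at both ends. *)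
pose b := `|r| + 1.
have b0 : 0 < b by rewrite /b ltr_wpDl.
have ltb : - b < b by rewrite gtrN.
have fE x : derive1 f x = df x by exact: is_derive_derive1.
have d0 x : r < `|x| -> df x = 0.
  by move=> rx; rewrite -fE; exact: (derive1_support f0).
have -> : I df = \int[mu]_(x in `[- b, b]) df x.
  rewrite [RHS]Rintegral_mkcond; apply: eq_Rintegral => x _.
  rewrite patchE; case: ifPn => // xb; rewrite d0//.
  rewrite ltNge; apply: contra xb => xr; apply/mem_set; rewrite /= in_itv/= -ler_norml.
  by rewrite (le_trans xr)// (le_trans (ler_norm r))// /b lerDl.
have := @continuous_FTC2 R df f (- b) b ltb.
have rb : r <= `|b| by rewrite gtr0_norm// /b (le_trans (ler_norm r))// lerDl.
rewrite (f0 b)// (f0 (- b)) ?normrN// subee// => H.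
rewrite /Rintegral H//.
- exact: continuous_subspaceT.
- have cf : continuous f.
    by move=> x; exact: is_derive_continuous (fdf x).
  split; first by move=> x _; exact: is_derive_derivable (fdf x).
  + exact/cvg_at_right_filter/cf.
  + exact/cvg_at_left_filter/cf.
Qed.

End Smooth.

(** * Convolution and mollifiers *)

Section Convolution.
Context {R : realType}.
Local Notation mu := (@lebesgue_measure R).
Local Notation I f := (\int[mu]_x f x).
Local Notation isd f x df := (is_derive (x : R) (1 : R) (f : R -> R) (df : R)).
Implicit Types (f g h k p : R -> R).

Lemma L1_conv_integrand f k x : L1 mu f -> bump k ->
  L1 mu (fun y => f y * k (x - y)).
Proof.
move=> Lf bk; have bk' := bump_reflect x bk.
have [C kC] := bump_bounded bk'.
exact: (L1_mul_bnd Lf (smooth_measurable (bump_smooth bk')) kC).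
Qed.

Lemma norm_convolution_le C f k x : L1 mu f -> bump k ->
  (forall x, `|k x| <= C) ->
  `|convolution f k x| <= C * \int[mu]_y `|f y|.
Proof.
move=> Lf bk kC; have Lfk := L1_conv_integrand x Lf bk.
apply: le_trans (integral_norm_le Lfk) _.
rewrite -integral_scale; last exact: L1_norm.
apply: integral_le.
- exact: L1_norm.
- exact/L1_scale/L1_norm.
- by move=> y; rewrite normrM mulrC ler_wpM2r.
Qed.

Lemma is_derive_convolution f k (x : R) : L1 mu f -> bump k ->
  isd (convolution f k) x (convolution f (derive1 k) x).
Proof.
move=> Lf bk; have [C kC] := bump_bounded (bump_derive bk).
pose F (x y : R) := f y * k (x - y).
have sk := bump_smooth bk.
have dF y z : isd (F ^~ y) z (f y * derive1 k (z - y)).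
  apply: is_derive_scale.
  have -> : derive1 k (z - y) = derive1 (fun z => k (z - y)) z.
    by rewrite derive1_shift.
  by apply: smooth_is_derive; exact: smooth_shift.
have pF y z : partial1of2 F z y = f y * derive1 k (z - y).
  by rewrite /partial1of2; exact: is_derive_derive1.
have xin : `]x - 1, x + 1[%classic x.
  by rewrite /= in_itv/= ltrBlDr ltrDl ltr01.
have C0 : 0 <= C by exact: le_trans (kC 0).
have LG : L1 mu (fun y => C * `|f y|) by apply: L1_scale; exact: L1_norm.
have h1 (z : R) : `]x - 1, x + 1[%classic z -> L1 mu (F z).
  by move=> _; exact: L1_conv_integrand.
have h2 (z y : R) : `]x - 1, x + 1[%classic z -> setT y -> derivable (F ^~ y) z 1.
  by move=> _ _; exact: is_derive_derivable (dF y z).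
have h3 y : 0 <= C * `|f y| by rewrite mulr_ge0.
have h4 (z y : R) : `]x - 1, x + 1[%classic z -> setT y ->
    `|partial1of2 F z y| <= C * `|f y|.
  by move=> _ _; rewrite pF normrM mulrC ler_wpM2r.
have D := derivable_under_integral measurableT xin h1 h2 h3 LG h4.
have E := differentiation_under_integral measurableT xin h1 h2 h3 LG h4.
have -> : convolution f (derive1 k) x = derive1 (fun z => \int[mu]_y F z y) x.
  by rewrite E; apply: eq_Rintegral => y _; rewrite pF.
exact: derivable_is_derive.
Qed.

Lemma smooth_convolution f k : L1 mu f -> bump k -> smooth (convolution f k).
Proof.
move=> Lf bk; apply: (@smooth_coind _ (fun h => exists2 k, bump k & h = convolution f k)).
  move=> h [{}k {}bk ->]; exists (convolution f (derive1 k)).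
    by move=> x; exact: is_derive_convolution.
  by exists (derive1 k) => //; exact: bump_derive.
by exists k.
Qed.

Lemma derive1_convolution f k : L1 mu f -> bump k ->
  derive1 (convolution f k) = convolution f (derive1 k).
Proof.
move=> Lf bk; apply/funext => x; apply: is_derive_derive1.
exact: is_derive_convolution.
Qed.

Lemma L1_plane_mul C f g (K : R * R -> R) : L1 mu f -> L1 mu g ->
  measurable_fun setT K -> (forall z, `|K z| <= C) ->
  L1 (mu \x mu)%E (fun z => f z.1 * g z.2 * K z).
Proof.
move=> Lf Lg mK KC.
have mf : measurable_fun setT (fun z : R * R => f z.1).
  exact: (measurableT_comp (L1_measurable Lf) measurable_fst).
have mg : measurable_fun setT (fun z : R * R => g z.2).
  exact: (measurableT_comp (L1_measurable Lg) measurable_snd).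
have H t : L1 mu (fun x => f t * g x * K (t, x)).
  apply: (L1_mul_bnd (C := C)).
  - exact: L1_scale.
  - exact: (measurableT_comp mK (pair1_measurable t)).
  - by move=> x; exact: KC.
apply: (@L1_plane _ (fun t => `|f t| * (C * \int[mu]_x `|g x|))).
- by apply: measurable_funM => //; exact: measurable_funM.
- by under eq_fun do rewrite mulrC; apply: L1_scale; exact: L1_norm.
- move=> t; split => //=.
  have Lg' : L1 mu (fun x => C * `|g x|) by apply: L1_scale; exact: L1_norm.
  rewrite -integral_scale; last exact: L1_norm.
  rewrite -integral_scale//; apply: integral_le; first exact/L1_norm/H.
    exact: L1_scale.
  move=> x; rewrite !normrM -mulrA ler_wpM2l// mulrC ler_wpM2r//.
Qed.

Lemma measurable_diff k : measurable_fun setT k ->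
  measurable_fun setT (fun z : R * R => k (z.1 - z.2)).
Proof.
move=> mk; apply: (measurableT_comp mk).
by apply: measurable_funB; [exact: measurable_fst|exact: measurable_snd].
Qed.

(** Fubini for f(x) g(y) k(x - y). For an even mollifier it moves the smoothing onto the test
    function; for the odd derivative of an even kernel it is the source of the cancellation in
    [integral_velocity_gradient]. *)
Lemma convolution_dual f g k : L1 mu f -> L1 mu g -> bump k ->
  \int[mu]_x (f x * convolution g k x) =
  \int[mu]_y (g y * convolution f (fun z => k (- z)) y).
Proof.
move=> Lf Lg bk; have [C kC] := bump_bounded bk.
have mk := measurable_diff (smooth_measurable (bump_smooth bk)).
have LG := L1_plane_mul Lf Lg mk (fun z => kC (z.1 - z.2)).
have [_ E1] := fubini1 LG; have [_ E2] := fubini2 LG.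
transitivity (\int[(mu \x mu)%E]_z (f z.1 * g z.2 * k (z.1 - z.2))).
  rewrite E1; apply: eq_Rintegral => x _ /=.
  rewrite -integral_scale; last exact: L1_conv_integrand.
  by apply: eq_Rintegral => y _; rewrite mulrA.
rewrite E2; apply: eq_Rintegral => y _ /=.
rewrite -integral_scale.
  by apply: eq_Rintegral => x _; rewrite opprB mulrA [f x * _]mulrC.
apply: (@L1_conv_integrand f (fun z => k (- z))) => //.
rewrite (_ : (fun z => _) = fun z => k (0 - z)); first exact: bump_reflect.
by apply/funext => z; rewrite sub0r.
Qed.

Lemma integral_affine k a b : continuous k -> (forall x, 0 <= k x) -> 0 < a ->
  \int[mu]_x (k (a * x + b) * a) = I k.
Proof.
move=> ck k0 a0; rewrite /Rintegral; congr fine.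
pose F (x : R) := a * x + b.
have dF : derive1 F = cst a.
  apply/funext => x; rewrite (derive1_affine (f := id)).
    by rewrite derive1_id mulr1.
  apply: (@smooth_intro _ _ (fun=> 1)); last exact: (@smooth_cst _ 1).
rewrite (@increasing_ge0_integration_by_substitutionT _ F k)//.
- by apply: eq_integral => x _; rewrite dF.
- by move=> x y xy; rewrite /F ltrD2r ltr_pM2l.
- by rewrite dF; exact: cst_continuous.
- by rewrite dF; exact: is_cvg_cst.
- by rewrite dF; exact: is_cvg_cst.
- apply/cvgrNyPle => A; near=> x; rewrite /F -lerBrDr -ler_pdivlMl//.
- apply/cvgryPge => A; near=> x; rewrite /F -lerBlDr -ler_pdivrMl//.
Unshelve. all: by end_near. Qed.

Lemma integral_shift k c : continuous k -> (forall x, 0 <= k x) ->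
  \int[mu]_x k (x - c) = I k.
Proof.
move=> ck k0; rewrite -[RHS](integral_affine (- c) ck k0 ltr01).
by apply: eq_Rintegral => x _; rewrite mul1r mulr1.
Qed.

Lemma integral_rescale k e : continuous k -> (forall x, 0 <= k x) -> 0 < e ->
  I (rescale k e) = I k.
Proof.
move=> ck k0 e0; rewrite -[RHS](integral_affine 0 ck k0 (a := e^-1)) ?invr_gt0//.
by apply: eq_Rintegral => x _; rewrite /rescale addr0 mulrC [x / e]mulrC.
Qed.

(** Tonelli for f(t) k(x - t): each slice in x has norm |f(t)| times the norm of [k], by translation
    invariance. *)
Lemma young f k : L1 mu f -> bump k -> L1 mu (convolution f k) /\
  \int[mu]_x `|convolution f k x| <= (\int[mu]_x `|f x|) * \int[mu]_x `|k x|.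
Proof.
move=> Lf bk; have sk := bump_smooth bk.
have ck : continuous (fun x => `|k x|).
  move=> x; apply: continuous_comp; last exact: norm_continuous.
  exact: smooth_continuous.
pose G (z : R * R) := f z.1 * k (z.2 - z.1).
have mG : measurable_fun setT G.
  apply: measurable_funM.
    exact: (measurableT_comp (L1_measurable Lf) measurable_fst).
  apply: (measurableT_comp (smooth_measurable sk)).
  by apply: measurable_funB; [exact: measurable_snd|exact: measurable_fst].
pose a t := `|f t| * \int[mu]_x `|k x|.
have La : L1 mu a.
  rewrite /a; under eq_fun do rewrite mulrC.
  by apply: L1_scale; exact: L1_norm.
have Gt t : L1 mu (fun x => G (t, x)) /\ \int[mu]_x `|G (t, x)| = a t.
  have Lk := bump_L1 (bump_shift t bk).
  split; first exact: (L1_scale (f t) Lk).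
  rewrite /a -(@integral_shift (fun x => `|k x|) t)//.
  rewrite -integral_scale; last exact: L1_norm.
  by apply: eq_Rintegral => x _; rewrite normrM.
have LG : L1 (mu \x mu)%E G.
  by apply: (L1_plane mG La) => t; have [? ->] := Gt t; split.
have [LC _] := fubini2 LG; split; first exact: LC.
have [_ EN1] := fubini1 (L1_norm LG); have [LN EN2] := fubini2 (L1_norm LG).
have -> : (\int[mu]_x `|f x|) * (\int[mu]_x `|k x|) = \int[(mu \x mu)%E]_z `|G z|.
  rewrite EN1 mulrC -integral_scale; last exact: L1_norm.
  by apply: eq_Rintegral => t _; rewrite (Gt t).2 mulrC.
rewrite EN2; apply: integral_le => //; first exact: L1_norm.
by move=> x; apply: integral_norm_le; exact: L1_conv_integrand.
Qed.

(** Evenness makes the convolution self-adjoint in [convolution_dual]. The kernel of the theorem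
    belongs to this class, so it can serve both as interaction kernel and as smoothing device. *)
Definition mollifier k :=
  [/\ bump k, forall x, 0 <= k x, forall x, k (- x) = k x & I k = 1].

Lemma mollifier_rescale k e : 0 < e -> mollifier k -> mollifier (rescale k e).
Proof.
move=> e0 [bk k0 ke kI]; split.
- exact: bump_rescale.
- by move=> x; rewrite /rescale mulr_ge0// invr_ge0 ltW.
- by move=> x; rewrite /rescale mulNr ke.
- by rewrite integral_rescale//; exact/smooth_continuous/bump_smooth.
Qed.

Lemma integral_mollifier_reflect k x : mollifier k -> \int[mu]_y k (x - y) = 1.
Proof.
move=> [bk k0 ke kI]; transitivity (\int[mu]_y k (y - x)).
  by apply: eq_Rintegral => y _; rewrite -opprB ke.
by rewrite integral_shift//; exact/smooth_continuous/bump_smooth.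
Qed.

Lemma convolution_ge lo f k x : L1 mu f -> mollifier k ->
  {ae mu, forall y, lo <= f y} -> lo <= convolution f k x.
Proof.
move=> Lf mk flo; have [bk k0 _ _] := mk.
rewrite -[lo]mulr1 -(integral_mollifier_reflect x mk).
have Lk := bump_L1 (bump_reflect x bk).
rewrite -integral_scale//; apply: integral_ae_le.
- exact: L1_scale.
- exact: L1_conv_integrand.
- by apply: ae_imp flo => y ?; rewrite ler_wpM2r.
Qed.

Lemma convolution_le hi f k x : L1 mu f -> mollifier k ->
  {ae mu, forall y, f y <= hi} -> convolution f k x <= hi.
Proof.
move=> Lf mk fhi; have [bk k0 _ _] := mk.
rewrite -[hi]mulr1 -(integral_mollifier_reflect x mk).
have Lk := bump_L1 (bump_reflect x bk).
rewrite -integral_scale//; apply: integral_ae_le.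
- exact: L1_conv_integrand.
- exact: L1_scale.
- by apply: ae_imp fhi => y ?; rewrite ler_wpM2r.
Qed.

Lemma convolution_sub f g k x : L1 mu f -> L1 mu g -> bump k ->
  convolution (fun y => f y - g y) k x = convolution f k x - convolution g k x.
Proof.
move=> Lf Lg bk; rewrite -integral_sub; try exact: L1_conv_integrand.
by apply: eq_Rintegral => y _; rewrite mulrBl.
Qed.

End Convolution.

(** * Primitives of bumps, plateaus and cutoffs *)

Section Cutoff.
Context {R : realType}.
Local Notation mu := (@lebesgue_measure R).
Local Notation I f := (\int[mu]_x f x).
Local Notation isd f x df := (is_derive (x : R) (1 : R) (f : R -> R) (df : R)).
Implicit Types (f g h k p : R -> R).

Definition primitive k (x : R) := \int[mu]_(t in `]-oo, x]) k t.

Lemma is_derive_primitive k (x : R) : bump k -> isd (primitive k) x (k x).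
Proof.
move=> bk; have Lk := bump_L1 bk.
have [//||||D <-] := @continuous_FTC1 R k -oo%O x (x + 1).
- by rewrite ltrDl.
- exact: (integrableS measurableT).
- by rewrite ltNyr.
- exact/smooth_continuous/bump_smooth.
- exact: derivable_is_derive.
Qed.

Lemma smooth_primitive k : bump k -> smooth (primitive k).
Proof.
move=> bk; apply: (@smooth_intro _ _ k); last exact: bump_smooth.
by move=> x; exact: is_derive_primitive.
Qed.

Lemma derive1_primitive k x : bump k -> derive1 (primitive k) x = k x.
Proof. by move=> bk; apply: is_derive_derive1; exact: is_derive_primitive. Qed.

Lemma primitive_left k r x : (forall x, r <= `|x| -> k x = 0) -> x <= - r ->
  primitive k x = 0.
Proof.
move=> kr xr; transitivity (\int[mu]_x (cst 0 x : R)); last first.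
  by rewrite /Rintegral integral0.
rewrite /primitive Rintegral_mkcond; apply: eq_Rintegral => y _.
rewrite patchE; case: ifPn => // /set_mem; rewrite /= in_itv/= => yx.
by apply: kr; rewrite ler_normr lerNr (le_trans yx xr) orbT.
Qed.

Lemma primitive_right k r x : (forall x, r <= `|x| -> k x = 0) -> r <= x ->
  primitive k x = I k.
Proof.
move=> kr xr; rewrite /primitive Rintegral_mkcond; apply: eq_Rintegral => y _.
rewrite patchE; case: ifPn => // /negP yx.
rewrite kr// ler_normr (le_trans xr)//.
by rewrite leNgt; apply/negP => xy; apply: yx; apply/mem_set; rewrite /= in_itv/= ltW.
Qed.

Lemma primitive_homo k x y : bump k -> (forall x, 0 <= k x) -> x <= y ->
  primitive k x <= primitive k y.
Proof.
move=> bk k0 xy; rewrite -subr_ge0.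
have [//|||c _ ->] := @MVT_segment _ (primitive k) k x y.
- by move=> z _; exact: is_derive_primitive.
- exact/continuous_subspaceT/smooth_continuous/smooth_primitive.
- by rewrite mulr_ge0// subr_ge0.
Qed.

Lemma primitive_ge0 k x : bump k -> (forall x, 0 <= k x) -> 0 <= primitive k x.
Proof.
move=> bk k0; case: (bk) => _ [r kr].
rewrite -(@primitive_left k r (Num.min x (- r)))//; last by rewrite ge_min lexx orbT.
by apply: primitive_homo => //; rewrite ge_min lexx.
Qed.

Lemma primitive_le k x : bump k -> (forall x, 0 <= k x) -> primitive k x <= I k.
Proof.
move=> bk k0; case: (bk) => _ [r kr].
rewrite -(@primitive_right k r (Num.max x r))//; last by rewrite le_max lexx orbT.
by apply: primitive_homo => //; rewrite le_max lexx.
Qed.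

(* Equal to 1 on [s1 + r, s2 - r] and to 0 outside [s1 - r, s2 + r] when the
   mollifier k is supported in [-r, r]. *)
Definition plateau k (s1 s2 x : R) := primitive k (x - s1) - primitive k (x - s2).

Lemma smooth_plateau k s1 s2 : bump k -> smooth (plateau k s1 s2).
Proof. by move=> bk; apply: smooth_sub; apply: smooth_shift; exact: smooth_primitive. Qed.

Lemma derive1_plateau k s1 s2 x : bump k ->
  derive1 (plateau k s1 s2) x = k (x - s1) - k (x - s2).
Proof.
move=> bk; have sp := smooth_primitive bk.
rewrite derive1_sub; try exact: smooth_shift.
by rewrite !derive1_shift// !derive1_primitive.
Qed.

Lemma plateau_ge0 k s1 s2 x : mollifier k -> s1 <= s2 -> 0 <= plateau k s1 s2 x.
Proof.
by move=> [bk k0 _ _] ss; rewrite subr_ge0 primitive_homo// lerD2l lerN2.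
Qed.

Lemma plateau_le1 k s1 s2 x : mollifier k -> plateau k s1 s2 x <= 1.
Proof.
move=> [bk k0 _ <-]; rewrite lerBlDr (le_trans (primitive_le _ bk k0))//.
by rewrite lerDl primitive_ge0.
Qed.

Lemma plateau_out k r s1 s2 x : mollifier k -> (forall x, r <= `|x| -> k x = 0) ->
  s1 <= s2 -> x <= s1 - r \/ s2 + r <= x -> plateau k s1 s2 x = 0.
Proof.
move=> [bk k0 _ kI] kr ss [xs|xs]; rewrite /plateau.
  by rewrite !(primitive_left kr) ?subrr// lerBlDl// (le_trans xs)// lerD2r.
by rewrite !(primitive_right kr) ?subrr// lerBrDl// (le_trans _ xs)// lerD2r.
Qed.

Lemma plateau_in k r s1 s2 x : mollifier k -> (forall x, r <= `|x| -> k x = 0) ->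
  s1 + r <= x -> x <= s2 - r -> plateau k s1 s2 x = 1.
Proof.
move=> [bk k0 _ kI] kr h1 h2; rewrite /plateau (primitive_right kr) ?lerBrDl//.
by rewrite (primitive_left kr) ?subr0// lerBlDl.
Qed.

(** The transition layers keep a fixed width and run off to infinity. The derivative is therefore
    bounded uniformly in [n] and tends to zero at each point, which suits dominated convergence. *)
Definition cutoff k (n : nat) := plateau k (- n%:R) n%:R.

Lemma bump_cutoff k n : mollifier k -> bump (cutoff k n).
Proof.
move=> mk; case: (mk) => bk _ _ _; split; first exact: smooth_plateau.
case: (bk) => _ [r kr]; exists (n%:R + r) => x.
have n0 : (0 : R) <= n%:R by exact: ler0n.
have nn : - n%:R <= n%:R :> R by lra.
rewrite ler_normr => /orP[h|h]; apply: (plateau_out mk kr nn).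
  by right.
by left; lra.
Qed.

Lemma norm_cutoff_le1 k n x : mollifier k -> `|cutoff k n x| <= 1.
Proof.
move=> mk; rewrite ger0_norm; first exact: plateau_le1.
apply: plateau_ge0 => //; have : (0 : R) <= n%:R by exact: ler0n.
lra.
Qed.

Lemma cutoff_ge0 k n x : mollifier k -> 0 <= cutoff k n x.
Proof.
move=> mk; apply: plateau_ge0 => //; have : (0 : R) <= n%:R by exact: ler0n.
lra.
Qed.

Lemma cvg_cutoff k x : mollifier k -> cutoff k n x @[n --> \oo] --> (1 : R).
Proof.
move=> mk; case: (mk) => [[_ [r kr]] _ _ _].
apply: cvg_near_cst; near=> n.
have : `|x| + r <= n%:R by near: n; exact: nbhs_infty_ger.
have := ler_norm x; have := ler_norm (- x); rewrite normrN => h1 h2 h3.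
by apply: (plateau_in mk kr); lra.
Unshelve. all: by end_near. Qed.

Lemma norm_derive1_cutoff_le k n C x : mollifier k -> (forall x, `|k x| <= C) ->
  `|derive1 (cutoff k n) x| <= C + C.
Proof.
move=> [bk _ _ _] kC; rewrite derive1_plateau//.
by apply: le_trans (ler_normB _ _) _; exact: lerD.
Qed.

Lemma cvg_derive1_cutoff k x : mollifier k ->
  derive1 (cutoff k n) x @[n --> \oo] --> (0 : R).
Proof.
move=> mk; case: (mk) => [bk _ _ _]; case: (bk) => [_ [r kr]].
apply: cvg_near_cst; near=> n.
have : `|x| + r <= n%:R by near: n; exact: nbhs_infty_ger.
have := ler_norm x; have := ler_norm (- x); rewrite normrN => h1 h2 h3.
rewrite derive1_plateau// !kr ?subrr// ler_normr; apply/orP; [right|left]; lra.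
Unshelve. all: by end_near. Qed.

Lemma cvg_sum_eq0 (u v : nat -> R) (a b : R) :
  u n @[n --> \oo] --> a -> v n @[n --> \oo] --> b ->
  (forall n, u n + v n = 0) -> a + b = 0.
Proof.
move=> ua vb uv0.
have c : (fun n => u n + v n) n @[n --> \oo] --> a + b by exact: cvgD.
have := cvg_lim (@Rhausdorff R) c.
rewrite (_ : (fun n => _) = cst 0); last by apply/funext => n; rewrite uv0.
by move=> /(_ _) <-; rewrite lim_cst.
Qed.

(** [f] need not have compact support: the product with [cutoff k n] does, and as [n] grows the term
    carrying the derivative of the cutoff disappears by dominated convergence. *)
Lemma integral_derive_eq0 k f (df : R -> R) : mollifier k ->
  (forall x, isd f x (df x)) -> continuous df -> L1 mu f -> L1 mu df ->
  I df = 0.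
Proof.
move=> mk fdf cdf Lf Ldf; case: (mk) => bk _ _ _.
have [C kC] := bump_bounded bk.
have mc n : measurable_fun setT (cutoff k n).
  by apply: smooth_measurable; apply: bump_smooth; exact: bump_cutoff.
have mc' n : measurable_fun setT (derive1 (cutoff k n)).
  apply: smooth_measurable; apply: bump_smooth; apply: bump_derive.
  exact: bump_cutoff.
have L1n n : L1 mu (fun x => df x * cutoff k n x).
  exact: (L1_mul_bnd (C := 1) Ldf (mc n) (fun x => norm_cutoff_le1 n x mk)).
have L2n n : L1 mu (fun x => f x * derive1 (cutoff k n) x).
  exact: (L1_mul_bnd Lf (mc' n) (fun x => norm_derive1_cutoff_le n x mk kC)).
have E n : \int[mu]_x (df x * cutoff k n x) + \int[mu]_x (f x * derive1 (cutoff k n) x) = 0.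
  have [sc [r cr]] := bump_cutoff n mk.
  rewrite -integral_add//; apply: (@integral_derive_compact _
    (fun x => f x * cutoff k n x) _ r).
  - move=> x; rewrite addrC [df x * _]mulrC.
    exact: (is_derive_mul (fdf x) (smooth_is_derive x sc)).
  - move=> x; apply: cvgD; apply: cvgM.
    + exact: cdf.
    + exact: (smooth_continuous sc).
    + exact: is_derive_continuous (fdf x).
    + exact: (smooth_continuous (smooth_derive1 sc)).
  - by move=> x rx; rewrite cr// mulr0.
have [|||||_ c1] := @integral_dct _ _ _ mu (fun n x => df x * cutoff k n x) df
  (fun x => `|df x|).
  - by move=> n; exact: L1_measurable (L1n n).
  - exact: L1_measurable Ldf.
  - exact: L1_norm.
  - move=> n; apply: ae_all => x; rewrite normrM ler_piMr//.
    exact: norm_cutoff_le1.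
  - apply: ae_all => x; rewrite -[X in _ --> X]mulr1; apply: cvgM.
      exact: cvg_cst.
    exact: cvg_cutoff.
have [|||||_ c2] := @integral_dct _ _ _ mu
  (fun n x => f x * derive1 (cutoff k n) x) (fun=> 0) (fun x => (C + C) * `|f x|).
  - by move=> n; exact: L1_measurable (L2n n).
  - exact: measurable_cst.
  - by apply: L1_scale; exact: L1_norm.
  - move=> n; apply: ae_all => x; rewrite normrM mulrC ler_wpM2r//.
    exact: norm_derive1_cutoff_le.
  - apply: ae_all => x; rewrite -[X in _ --> X](mulr0 (f x)); apply: cvgM.
      exact: cvg_cst.
    exact: cvg_derive1_cutoff.
have I0 : I (fun=> 0 : R) = 0 by rewrite /Rintegral integral0.
by have := cvg_sum_eq0 c1 c2 E; rewrite I0 addr0.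
Qed.

(** Integration by parts in y, as p(y) k(x - y) has a derivative of zero integral. Here [k'] is not
    the derivative of [k] but a mollifier from which the cutoffs are built. *)
Lemma convolution_derive_swap k k' p (dp : R -> R) : mollifier k' -> bump k ->
  (forall x, isd p x (dp x)) -> continuous dp -> L1 mu p -> L1 mu dp ->
  convolution p (derive1 k) = convolution dp k.
Proof.
move=> mk' bk pdp cdp Lp Ldp; apply/funext => x; apply/eqP.
have bx := bump_reflect x bk; have sx := bump_smooth bx.
have cdk : continuous (fun y => derive1 k (x - y)).
  apply: smooth_continuous; apply: bump_smooth; apply: bump_reflect.
  exact: bump_derive.
have L1a : L1 mu (fun y => dp y * k (x - y)) by exact: L1_conv_integrand.
have L1b : L1 mu (fun y => p y * derive1 k (x - y)).
  exact: (L1_conv_integrand x Lp (bump_derive bk)).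
rewrite eq_sym -subr_eq0 -integral_sub//.
  apply/eqP; apply: (@integral_derive_eq0 _ (fun y => p y * k (x - y)) _ mk').
  - move=> y; rewrite addrC -mulrN [dp y * _]mulrC.
    rewrite -derive1_reflect; last exact: bump_smooth.
    exact: (is_derive_mul (pdp y) (smooth_is_derive y sx)).
  - move=> y; apply: cvgB; apply: cvgM; [exact: cdp|exact: smooth_continuous| |].
      exact: is_derive_continuous (pdp y).
    exact: cdk.
  - exact: L1_conv_integrand.
  - exact: L1_sub.
Qed.

End Cutoff.

(** * Approximation of the identity *)

Section Mollification.
Context {R : realType}.
Local Notation mu := (@lebesgue_measure R).
Implicit Types (f g h k p : R -> R).

(* Kernels of signed mass m; m = 1 for a mollifier, m = 0 for its derivative. *)
Definition kernel_of_mass m k := [/\ bump k, forall x, `|k (- x)| = `|k x| &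
  forall e x, 0 < e -> \int[mu]_y rescale k e (x - y) = m].

Lemma continuous_norm_bump k : bump k -> continuous (fun x => `|k x|).
Proof.
move=> bk x; apply: continuous_comp; last exact: norm_continuous.
exact/smooth_continuous/bump_smooth.
Qed.

Lemma norm_rescale k e x : 0 < e -> `|rescale k e x| = rescale (fun x => `|k x|) e x.
Proof. by move=> e0; rewrite /rescale normrM gtr0_norm// invr_gt0. Qed.

Lemma integral_norm_rescale k e : 0 < e -> bump k ->
  \int[mu]_x `|rescale k e x| = \int[mu]_x `|k x|.
Proof.
move=> e0 bk; rewrite -(@integral_rescale _ (fun x => `|k x|) e)//.
  by apply: eq_Rintegral => x _; rewrite norm_rescale.
exact: continuous_norm_bump.
Qed.

Lemma integral_norm_reflect k m e x : kernel_of_mass m k -> 0 < e ->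
  \int[mu]_y `|rescale k e (x - y)| = \int[mu]_y `|k y|.
Proof.
move=> [bk kN _] e0; rewrite -(integral_norm_rescale e0 bk).
rewrite -(@integral_shift _ (fun y => `|rescale k e y|) x)//; last first.
  exact/continuous_norm_bump/bump_rescale.
apply: eq_Rintegral => y _; rewrite -opprB !norm_rescale// /rescale.
by rewrite mulNr kN.
Qed.

Lemma L1_locally_integrable f : L1 mu f -> locally_integrable setT f.
Proof. by move=> Lf; apply: open_integrable_locally => //; exact: openT. Qed.

(** Since the rescaled kernel has integral [m], the left-hand side is the integral of (f(y) - f(x))
    k_e(x - y). The kernel is at most C/e and lives in the ball of radius r e, of measure 2 r e; the
    product of both is the constant C * 2 * r in front of the mean oscillation [davg]. *)
Lemma convolution_center_le k m r C f x e : kernel_of_mass m k -> L1 mu f ->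
  (forall x, r <= `|x| -> k x = 0) -> (forall x, `|k x| <= C) -> 0 < r -> 0 < e ->
  (`|convolution f (rescale k e) x - m * f x|%:E <=
   (C * 2 * r)%:E * davg f x (r * e))%E.
Proof.
move=> [bk _ km] Lf kr kC r0 e0.
have C0 : 0 <= C by exact: le_trans (kC 0).
have bke := bump_rescale e0 bk.
have L1k := L1_conv_integrand x Lf bke.
have L2k : L1 mu (fun y => f x * rescale k e (x - y)).
  by apply: L1_scale; exact/bump_L1/bump_reflect.
have L3k := L1_sub L1k L2k.
have -> : convolution f (rescale k e) x - m * f x =
    \int[mu]_y (f y * rescale k e (x - y) - f x * rescale k e (x - y)).
  rewrite integral_sub// integral_scale ?km 1?mulrC//.
  exact/bump_L1/bump_reflect.
have mf := L1_measurable Lf.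
set B := ball x (r * e).
have mB : measurable B by exact: measurable_ball.
apply: (@le_trans _ _ (\int[mu]_(y in B) ((C / e)%:E * `|(center (f x) \o f) y|%:E))%E).
  apply: (@le_trans _ _ (\int[mu]_y `|f y * rescale k e (x - y) -
      f x * rescale k e (x - y)|)%:E).
    by rewrite lee_fin; exact: integral_norm_le.
  rewrite /Rintegral fineK; last first.
    exact: (integrable_fin_num measurableT (L1_norm L3k)).
  rewrite [leRHS]integral_mkcond; apply: ge0_le_integral => //.
  - exact: measurable_int (L1_norm L3k).
  - apply/(measurable_restrictT _ mB); apply: measurable_funTS.
    apply/measurable_EFinP; apply: measurable_funM => //.
    apply: measurableT_comp => //; apply: measurable_funB => //.
  - move=> y _; rewrite -mulrBl patchE; case: ifPn => [_|/negP yB].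
      rewrite -EFinM lee_fin normrM mulrC ler_wpM2r//.
      by rewrite norm_rescale// /rescale mulrC ler_wpM2r// invr_ge0 ltW.
    rewrite /rescale kr ?mulr0 ?normr0//.
    rewrite normrM normfV (gtr0_norm e0) ler_pdivlMr// leNgt.
    by apply/negP => h; apply: yB; apply/mem_set.
rewrite ge0_integralZl//; last 2 first.
- apply/measurable_EFinP; apply: measurable_funTS.
  by apply: measurableT_comp => //; exact: measurable_funB.
- by rewrite lee_fin divr_ge0// ltW.
rewrite /davg /iavg -/B lebesgue_measure_ball; last by rewrite mulr_ge0// ltW.
rewrite muleA inver mulrn_eq0/= mulf_eq0 !gt_eqF//= -EFinM.
rewrite lee_pmul// ?lee_fin//.
- by rewrite divr_ge0// ltW.
- exact: integral_ge0.
- rewrite le_eqVlt; apply/orP; left; apply/eqP.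
  by rewrite -mulr_natr; field; rewrite !gt_eqF.
Qed.

Lemma cvg0_norm_lt (u : nat -> R) (e : R) : u n @[n --> \oo] --> 0 -> 0 < e ->
  \forall n \near \oo, `|u n| < e.
Proof. by move=> /cvgr0Pnorm_lt u0 /u0. Qed.

Lemma cvg_dist_le0 (u v : nat -> R) (l : R) :
  (\forall n \near \oo, `|u n - l| <= v n) -> v n @[n --> \oo] --> 0 ->
  u n @[n --> \oo] --> l.
Proof.
move=> uv v0; apply/cvgrPdist_lt => e e0.
have ve := cvg0_norm_lt v0 e0.
move: uv ve; apply: filterS2 => n uvn vn.
by rewrite distrC (le_lt_trans uvn)// (le_lt_trans (ler_norm _)).
Qed.

Lemma convolution_lebesgue_pt k m f x : kernel_of_mass m k -> L1 mu f ->
  lebesgue_pt f x ->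
  convolution f (rescale k n.+1%:R^-1) x @[n --> \oo] --> m * f x.
Proof.
move=> mk Lf fx; case: (mk) => [bk _ km]; have [C kC] := bump_bounded bk.
have [r r_gt0 kr] := bump_support bk.
have e0 n : 0 < n.+1%:R^-1 :> R by rewrite invr_gt0.
have dn : (r * n.+1%:R^-1) @[n --> \oo] --> 0^'+.
  have c0 : (r * n.+1%:R^-1) @[n --> \oo] --> (0 : R).
    rewrite -[X in _ --> X](mulr0 r); apply: cvgM; first exact: cvg_cst.
    exact: cvg_harmonic.
  move=> A hA.
  have : \forall n \near \oo, 0 < r * n.+1%:R^-1 -> A (r * n.+1%:R^-1).
    exact: c0 _ hA.
  apply: filterS => n /=; apply.
  by rewrite mulr_gt0.
have c := cvg_comp _ _ dn fx.
have {}c := cvgeZl (y := (C * 2 * r)%:E) isT c.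
rewrite mule0 in c; have [fX {}c] := (fine_cvgP _ _).1 c.
apply: (cvg_dist_le0 _ c).
apply: filterS fX => n /= fX; rewrite -lee_fin fineK//.
exact: convolution_center_le.
Qed.

Lemma integral_mollify_compact k m f M N : kernel_of_mass m k -> L1 mu f ->
  (forall x, `|f x| <= M) -> (forall x, N <= `|x| -> f x = 0) ->
  \int[mu]_x `|convolution f (rescale k n.+1%:R^-1) x - m * f x|
    @[n --> \oo] --> (0 : R).
Proof.
move=> mk Lf fM fN; case: (mk) => [bk _ km].
have [r r_gt0 kr] := bump_support bk.
have e0 n : 0 < n.+1%:R^-1 :> R by rewrite invr_gt0.
pose u n x := convolution f (rescale k n.+1%:R^-1) x - m * f x.
have bkn n := bump_rescale (e0 n) bk.
have Lu n : L1 mu (u n).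
  by apply: L1_sub; [exact: (young Lf (bkn n)).1|exact: L1_scale].
(* The convolution is at most M times the norm of [k] at every scale, and the subtracted term at
   most |m| M; this yields a majorant independent of [n]. *)
pose D := M * \int[mu]_y `|k y| + `|m| * M.
have uD n x : `|u n x| <= D * \1_(`[- (N + r), N + r]) x.
  rewrite indicE; have [xN|xN] := leP (N + r) `|x|; last first.
    rewrite mem_set ?mulr1; last by rewrite /= in_itv/= -ler_norml ltW.
    apply: le_trans (ler_normB _ _) _; apply: lerD; last first.
      by rewrite normrM ler_wpM2l.
    rewrite -(integral_norm_reflect x mk (e0 n)) -integral_scale; last first.
      exact/L1_norm/bump_L1/bump_reflect.
    apply: le_trans (integral_norm_le (L1_conv_integrand x Lf (bkn n))) _.
    apply: integral_le.
    - exact/L1_norm/L1_conv_integrand.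
    - exact/L1_scale/L1_norm/bump_L1/bump_reflect.
    - by move=> y; rewrite normrM ler_wpM2r.
  suff -> : u n x = 0.
    rewrite normr0 mulr_ge0// addr_ge0// mulr_ge0//.
    - exact: le_trans (fM 0).
    - by apply: Rintegral_ge0.
    - exact: le_trans (fM 0).
  rewrite /u fN ?mulr0 ?subr0; last by rewrite (le_trans _ xN)// lerDl ltW.
  transitivity (\int[mu]_y (cst 0 y : R)); last by rewrite /Rintegral integral0.
  apply: eq_Rintegral => y _; have [yN|yN] := leP N `|y|; first by rewrite fN// mul0r.
  have h : r <= `|x - y| by have := lerB_dist x y; lra.
  rewrite /rescale kr ?mulr0//= invrK normrM normr_nat (le_trans h)//.
  by rewrite ler_peMr// ler1n.
have [|||||_ c] := @integral_dct _ _ _ mu (fun n x => `|u n x|) (fun=> 0)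
  (fun x => D * \1_(`[- (N + r), N + r]) x).
- by move=> n; exact/L1_measurable/L1_norm/Lu.
- exact: measurable_cst.
- by apply: L1_scale; exact: integrable_indic_itv.
- by move=> n; apply: ae_all => x; rewrite normr_id.
- apply: ae_imp (lebesgue_differentiation (L1_locally_integrable Lf)) => x fx.
  have cx := convolution_lebesgue_pt mk Lf fx.
  apply: (cvg_dist_le0 (v := fun n => `|u n x|)).
    by apply: nearW => n; rewrite subr0 normr_id.
  have : (convolution f (rescale k n.+1%:R^-1) x - m * f x) @[n --> \oo] --> m * f x - m * f x.
    by apply: cvgB => //; exact: cvg_cst.
  by rewrite subrr => /cvg_norm; rewrite normr0.
by move: c; rewrite /= [X in _ --> X]/Rintegral integral0.
Qed.

Definition truncation f (n : nat) x :=
  Num.max (- n%:R) (Num.min n%:R (f x)) * \1_(`[- n%:R, n%:R]) x.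

Lemma norm_truncation_le f n x : `|truncation f n x| <= `|f x|.
Proof.
have n0 : (0 : R) <= n%:R by [].
rewrite /truncation indicE; case: (_ \in _); last by rewrite mulr0 normr0.
rewrite mulr1 ler_norml; have := ler_norm (f x); have := ler_norm (- f x).
rewrite normrN; rewrite maxEle minEle; do 2 case: ifP => //; lra.
Qed.

Lemma norm_truncation_le_nat f n x : `|truncation f n x| <= n%:R.
Proof.
have n0 : (0 : R) <= n%:R by [].
rewrite /truncation indicE; case: (_ \in _); last by rewrite mulr0 normr0.
rewrite mulr1 ler_norml le_max lexx/= ge_max ge_min lexx/= andbT; lra.
Qed.

Lemma L1_truncation f n : L1 mu f -> L1 mu (truncation f n).
Proof.
move=> Lf; apply: L1_le (L1_norm Lf) => //.
  apply: measurable_funM; last exact: measurable_indic.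
  apply: measurable_maxr => //; apply: measurable_minr => //.
  exact: L1_measurable Lf.
exact: norm_truncation_le.
Qed.

Lemma cvg_truncation f x : truncation f n x @[n --> \oo] --> f x.
Proof.
apply: cvg_near_cst; near=> n.
have h1 : `|f x| <= n%:R by near: n; exact: nbhs_infty_ger.
have h2 : `|x| <= n%:R by near: n; exact: nbhs_infty_ger.
rewrite /truncation indicE mem_set ?mulr1; last by rewrite /= in_itv/= -ler_norml.
by move: h1; rewrite ler_norml => /andP[h3 h4]; rewrite min_r// max_r.
Unshelve. all: by end_near. Qed.

Lemma integral_truncation f : L1 mu f ->
  \int[mu]_x `|f x - truncation f n x| @[n --> \oo] --> (0 : R).
Proof.
move=> Lf.
have Ld n : L1 mu (fun x => f x - truncation f n x).
  by apply: L1_sub => //; exact: L1_truncation.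
have [|||||_ c] := @integral_dct _ _ _ mu (fun n x => `|f x - truncation f n x|)
  (fun=> 0) (fun x => 2 * `|f x|).
- by move=> n; exact/L1_measurable/L1_norm/Ld.
- exact: measurable_cst.
- by apply: L1_scale; exact: L1_norm.
- move=> n; apply: ae_all => x; rewrite normr_id.
  apply: le_trans (ler_normB _ _) _.
  have := norm_truncation_le f n x; lra.
- apply: ae_all => x.
  have : (f x - truncation f n x) @[n --> \oo] --> f x - f x.
    by apply: cvgB; [exact: cvg_cst|exact: cvg_truncation].
  by rewrite subrr => /cvg_norm; rewrite normr0.
by move: c; rewrite /= [X in _ --> X]/Rintegral integral0.
Qed.

(** By Young's inequality the smoothing error is Lipschitz in [f] for the L^1 distance, with a
    constant invariant under rescaling. This serves the density argument below and, later, makes the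
    error small uniformly over nearby times. *)
Lemma mollify_dist k m f g : bump k -> L1 mu f -> L1 mu g ->
  \int[mu]_x `|convolution f k x - m * f x| <=
  \int[mu]_x `|convolution g k x - m * g x| +
  (\int[mu]_x `|k x| + `|m|) * \int[mu]_x `|f x - g x|.
Proof.
move=> bk Lf Lg; have LD := L1_sub Lf Lg; have [Ly Ny] := young LD bk.
have La h : L1 mu h -> L1 mu (fun x => convolution h k x - m * h x).
  by move=> Lh; apply: L1_sub; [exact: (young Lh bk).1|exact: L1_scale].
have Ln := L1_norm LD; have Laf := La _ Lf; have Lag := La _ Lg.
apply: (@le_trans _ _ (\int[mu]_x (`|convolution g k x - m * g x| +
   (`|convolution (fun y => f y - g y) k x| + `|m| * `|f x - g x|)))).
  apply: integral_le; first exact: L1_norm.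
    apply: L1_add; first exact: L1_norm.
    by apply: L1_add; [exact: L1_norm|exact: L1_scale].
  move=> x; rewrite (convolution_sub x Lf Lg bk) -normrM.
  set a := convolution f _ x; set b := convolution g _ x.
  rewrite (_ : a - m * f x = (b - m * g x) + ((a - b) - m * (f x - g x))); last by ring.
  by apply: le_trans (ler_normD _ _) _; rewrite lerD2l; exact: ler_normB.
rewrite integral_add; [|exact: L1_norm|]; last first.
  by apply: L1_add; [exact: L1_norm|exact: L1_scale].
rewrite lerD2l integral_add; [|exact: L1_norm|exact: L1_scale].
by rewrite integral_scale// mulrDl lerD2r mulrC.
Qed.

(** Density of bounded functions with compact support. For the derivative of a mollifier, where m =
    0, it says that the gradient of the function mollified at scale e is o(1/e) in L^1: the gain
    that defeats the commutator. *)
Lemma integral_mollify k m f : kernel_of_mass m k -> L1 mu f ->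
  \int[mu]_x `|convolution f (rescale k n.+1%:R^-1) x - m * f x|
    @[n --> \oo] --> (0 : R).
Proof.
move=> mk Lf; case: (mk) => [bk _ _].
have e0 n : 0 < n.+1%:R^-1 :> R by rewrite invr_gt0.
have bkn n := bump_rescale (e0 n) bk.
pose K := \int[mu]_x `|k x|.
have K0 : 0 <= K by apply: Rintegral_ge0.
have K1 : 0 < K + `|m| + 1 by rewrite ltr_wpDl// addr_ge0.
apply/cvgr0Pnorm_lt => e e_gt0.
have e2 : 0 < e / 2 / (K + `|m| + 1) by rewrite !divr_gt0.
have [N _ /(_ N (leqnn N)) /= fN] := cvg0_norm_lt (integral_truncation Lf) e2.
pose g := truncation f N.
have Lg : L1 mu g by exact: L1_truncation.
have gN x : N%:R + 1 <= `|x| -> g x = 0.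
  move=> Nx; rewrite /g /truncation indicE memNset ?mulr0//= in_itv/= -ler_norml.
  by apply/negP; rewrite -ltNge (lt_le_trans _ Nx)// ltrDl.
have cg := integral_mollify_compact mk Lg (norm_truncation_le_nat f N) gN.
have e3 : 0 < e / 2 by rewrite divr_gt0.
have cge := cvg0_norm_lt cg e3; apply: filterS cge => n hn.
rewrite ger0_norm; last by apply: Rintegral_ge0.
rewrite ger0_norm in hn; last by apply: Rintegral_ge0.
rewrite ger0_norm in fN; last by apply: Rintegral_ge0.
have := mollify_dist m (bkn n) Lf Lg; rewrite integral_norm_rescale// -/K.
have hF : 0 <= \int[mu]_x `|f x - g x| by apply: Rintegral_ge0.
move: fN hn hF; rewrite -/g ltr_pdivlMr//.
move=> fN hn hF YC; apply: le_lt_trans YC _; rewrite [ltRHS]splitr; apply: ltr_leD => //.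
by apply: le_trans (ltW fN); rewrite mulrDr mulr1 mulrC lerDl.
Qed.

End Mollification.

(** * Weak inequalities and curves in L^1 *)

Section Weak.
Context {R : realType}.
Local Notation mu := (@lebesgue_measure R).
Implicit Types (f g h k p a : R -> R) (F Q : R -> R -> R).

Definition L1_bounded_on F (T0 T N : R) :=
  measurable_fun setT (fun z : R * R => F z.1 z.2) /\
  forall t, T0 <= t <= T -> L1 mu (F t) /\ \int[mu]_x `|F t x| <= N.

Definition supported_in a (T0 T : R) := forall t, ~~ (T0 <= t <= T) -> a t = 0.

Lemma L1_tensor F T0 T N a p C : L1_bounded_on F T0 T N -> bump a ->
  supported_in a T0 T -> measurable_fun setT p -> (forall x, `|p x| <= C) ->
  L1 (mu \x mu)%E (fun z => F z.1 z.2 * (a z.1 * p z.2)).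
Proof.
move=> [mF FN] ba aT mp pC; have sa := bump_smooth ba.
have C0 : 0 <= C by exact: le_trans (pC 0).
have ma : measurable_fun setT (fun z : R * R => a z.1).
  exact: (measurableT_comp (smooth_measurable sa) measurable_fst).
have mp2 : measurable_fun setT (fun z : R * R => p z.2).
  exact: (measurableT_comp mp measurable_snd).
apply: (@L1_plane _ (fun t => (C * N) * `|a t|)).
- by apply: measurable_funM => //; exact: measurable_funM.
- by apply: L1_scale; apply: L1_norm; exact: bump_L1.
- move=> t /=; have [tT|tT] := boolP (T0 <= t <= T); last first.
    rewrite (aT _ tT) normr0 mulr0.
    rewrite (_ : (fun x => _) = fun=> 0); last by apply/funext => x; rewrite mul0r mulr0.
    split; first exact: L1_cst0.
    by under eq_Rintegral do rewrite mul0r mulr0 normr0; rewrite /Rintegral integral0.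
  have [LF IF] := FN _ tT.
  have E x : F t x * (a t * p x) = a t * (F t x * p x) by rewrite mulrCA.
  have LFp : L1 mu (fun x => F t x * p x) by exact: (L1_mul_bnd LF mp pC).
  split; first by under eq_fun do rewrite E; exact: L1_scale.
  under eq_Rintegral do rewrite E normrM.
  rewrite integral_scale; last exact: L1_norm.
  rewrite mulrC ler_wpM2r// (le_trans (y := C * \int[mu]_x `|F t x|))//; last first.
    by rewrite ler_wpM2l.
  rewrite -integral_scale; last exact: L1_norm.
  apply: integral_le; [exact: L1_norm|by apply: L1_scale; exact: L1_norm|].
  by move=> x; rewrite normrM mulrC ler_wpM2r.
Qed.

Lemma integral_tensor F T0 T N a p C : L1_bounded_on F T0 T N -> bump a ->
  supported_in a T0 T -> measurable_fun setT p -> (forall x, `|p x| <= C) ->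
  L1 mu (fun t => a t * \int[mu]_x (F t x * p x)) /\
  \int[(mu \x mu)%E]_z (F z.1 z.2 * (a z.1 * p z.2)) =
  \int[mu]_t (a t * \int[mu]_x (F t x * p x)).
Proof.
move=> HF ba aT mp pC; have LG := L1_tensor HF ba aT mp pC.
have E : (fun t => \int[mu]_x (F t x * (a t * p x))) =
    (fun t => a t * \int[mu]_x (F t x * p x)).
  apply/funext => t; have [tT|tT] := boolP (T0 <= t <= T); last first.
    rewrite (aT _ tT) mul0r; under eq_Rintegral do rewrite mul0r mulr0.
    by rewrite /Rintegral integral0.
  have [LF _] := HF.2 _ tT.
  rewrite -integral_scale; last exact: (L1_mul_bnd LF mp pC).
  by apply: eq_Rintegral => x _; rewrite mulrCA.
by have [L ->] := fubini1 LG; rewrite /= E in L *.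
Qed.

(* Tensor test functions suffice; P is the class of admissible space factors. *)
Definition weak_ineq (P : set (R -> R)) F Q (T0 T : R) := forall theta zeta : R -> R,
  smooth theta -> (forall t, 0 <= theta t) ->
  (exists a b : R, [/\ T0 < a, b < T & supported_in theta a b]) ->
  bump zeta -> P zeta ->
  0 <= \int[(mu \x mu)%E]_z (F z.1 z.2 * (derive1 theta z.1 * zeta z.2) +
                             Q z.1 z.2 * (theta z.1 * derive1 zeta z.2)).

Lemma bump_supported a (T0 T : R) : smooth a -> supported_in a T0 T -> bump a.
Proof.
move=> sa aT; split => //; exists (`|T0| + `|T| + 1) => t tT.
apply: aT; apply/negP => /andP[h1 h2]; move: tT; rewrite leNgt => /negP; apply.
have := ler_norm T; have := ler_norm (- T0); rewrite normrN => h3 h4.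
have h5 := normr_ge0 T; have h6 := normr_ge0 T0.
rewrite ltr_norml; apply/andP; split; lra.
Qed.

Lemma supported_derive a (T0 T s1 s2 : R) : supported_in a s1 s2 -> T0 < s1 -> s2 < T ->
  supported_in (derive1 a) T0 T.
Proof.
move=> aT h1 h2 t tT; apply: derive1_near0.
have [tT0|tT0] := ltP t T0.
  near=> y; apply: aT; rewrite negb_and -ltNge; apply/orP; left.
  by near: y; apply: lt_nbhsl; exact: lt_trans h1.
near=> y; apply: aT; rewrite negb_and -!ltNge; apply/orP; right.
near: y; apply: lt_nbhsr; apply: lt_trans h2 _.
by rewrite ltNge; apply: contra tT => tT; rewrite tT0.
Unshelve. all: by end_near. Qed.

Lemma supported_le a (T0 T s1 s2 : R) : supported_in a s1 s2 -> T0 <= s1 -> s2 <= T ->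
  supported_in a T0 T.
Proof.
move=> aT h1 h2 t tT; apply: aT; apply: contra tT => /andP[h3 h4].
by apply/andP; split; lra.
Qed.

(** Bounded space factors become admissible by inserting [psi * cutoff k n] and passing to the limit
    by dominated convergence on the plane; the constant [psi = 1], needed for mass and total
    entropy, is the main instance. *)
Lemma weak_ineq_bounded P k F Q T0 T N theta psi C : mollifier k ->
  L1_bounded_on F T0 T N -> L1_bounded_on Q T0 T N -> weak_ineq P F Q T0 T ->
  smooth theta -> (forall t, 0 <= theta t) ->
  (exists a b : R, [/\ T0 < a, b < T & supported_in theta a b]) ->
  smooth psi -> (forall n, P (fun x => psi x * cutoff k n x)) -> (forall x, `|psi x| <= C) ->
  (forall x, `|derive1 psi x| <= C) ->
  0 <= \int[mu]_t (derive1 theta t * \int[mu]_x (F t x * psi x)) +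
       \int[mu]_t (theta t * \int[mu]_x (Q t x * derive1 psi x)).
Proof.
move=> mk HF HQ FQ st t0 tab sp p0 pC dpC.
case: (tab) => [a [b [T0a bT thab]]].
have sth : supported_in theta T0 T by exact: supported_le (ltW T0a) (ltW bT).
have sdth := supported_derive thab T0a bT.
have bth := bump_supported st sth.
have bdth := bump_derive bth.
have bk : bump k by case: mk.
have [D kD] := bump_bounded bk.
pose z_ n x := psi x * cutoff k n x.
have bz n : bump (z_ n) by exact: (bump_mul sp (bump_cutoff n mk)).
have C0 : 0 <= C by exact: le_trans (pC 0).
have D0 : 0 <= D by exact: le_trans (kD 0).
pose K := C * (D + D) + C.
have zK n x : `|z_ n x| <= K.
  rewrite /z_ normrM (le_trans (y := C * 1))//.
    by apply: ler_pM => //; exact: norm_cutoff_le1.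
  by rewrite mulr1 lerDr mulr_ge0// addr_ge0.
have dz n x : derive1 (z_ n) x = psi x * derive1 (cutoff k n) x + cutoff k n x * derive1 psi x.
  exact: (derive1_mul x sp (bump_smooth (bump_cutoff n mk))).
have cdz x : derive1 (z_ n) x @[n --> \oo] --> derive1 psi x.
  rewrite (_ : (fun n => derive1 (z_ n) x) = (fun n => psi x * derive1 (cutoff k n) x +
    cutoff k n x * derive1 psi x)); last by apply/funext => n; exact: dz.
  rewrite -[X in _ --> X]add0r; apply: cvgD.
    rewrite -[X in _ --> X](mulr0 (psi x)); apply: cvgM; first exact: cvg_cst.
    exact: cvg_derive1_cutoff.
  rewrite -[X in _ --> X]mul1r; apply: cvgM; last exact: cvg_cst.
  exact: cvg_cutoff.
have dzK n x : `|derive1 (z_ n) x| <= K.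
  rewrite dz; apply: le_trans (ler_normD _ _) _; apply: lerD; rewrite normrM.
    by apply: ler_pM => //; exact: norm_derive1_cutoff_le.
  rewrite (le_trans (y := 1 * C))//; last by rewrite mul1r.
  by apply: ler_pM => //; exact: norm_cutoff_le1.
have mz n : measurable_fun setT (z_ n) by exact: (smooth_measurable (bump_smooth (bz n))).
have mdz n : measurable_fun setT (derive1 (z_ n)).
  exact: (smooth_measurable (bump_smooth (bump_derive (bz n)))).
have mp := smooth_measurable sp.
have mdp := smooth_measurable (smooth_derive1 sp).
have L1n n := L1_tensor HF bdth sdth (mz n) (zK n).
have L2n n := L1_tensor HQ bth sth (mdz n) (dzK n).
have L1p := L1_tensor HF bdth sdth mp pC.
have L2p := L1_tensor HQ bth sth mdp dpC.
have m1 : measurable_fun setT (fun _ : R => 1 : R) by exact: measurable_cst.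
have n1 (x : R) : `|1 : R| <= 1 by rewrite normr1.
have L1g := L1_norm (L1_tensor HF bdth sdth m1 n1).
have L2g := L1_norm (L1_tensor HQ bth sth m1 n1).
have [_ E1] := integral_tensor HF bdth sdth mp pC.
have [_ E2] := integral_tensor HQ bth sth mdp dpC.
rewrite -E1 -E2 -integral_add//.
have [|||||_ c] := @integral_dct _ _ _ (mu \x mu)%E
  (fun n z => F z.1 z.2 * (derive1 theta z.1 * z_ n z.2) +
     Q z.1 z.2 * (theta z.1 * derive1 (z_ n) z.2))
  (fun z => F z.1 z.2 * (derive1 theta z.1 * psi z.2) +
     Q z.1 z.2 * (theta z.1 * derive1 psi z.2))
  (fun z => K * `|F z.1 z.2 * (derive1 theta z.1 * 1)| +
     K * `|Q z.1 z.2 * (theta z.1 * 1)|).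
- by move=> n; exact: L1_measurable (L1_add (L1n n) (L2n n)).
- exact: L1_measurable (L1_add L1p L2p).
- by apply: L1_add; exact: L1_scale.
- move=> n; apply: ae_all => z; apply: le_trans (ler_normD _ _) _.
  have hK (x y w : R) : `|w| <= K -> `|x * (y * w)| <= K * `|x * (y * 1)|.
    by move=> wK; rewrite mulr1 mulrA normrM mulrC ler_wpM2r.
  by apply: lerD; [exact: (hK _ _ _ (zK n z.2))|exact: (hK _ _ _ (dzK n z.2))].
- apply: ae_all => z; apply: cvgD; (apply: cvgM; first exact: cvg_cst);
    (apply: cvgM; first exact: cvg_cst).
    rewrite -[X in _ --> X]mulr1; apply: cvgM; first exact: cvg_cst.
    exact: cvg_cutoff.
  exact: cdz.
rewrite -(cvg_lim _ c)//; apply: limr_ge; first by apply/cvg_ex; eexists; exact: c.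
by apply: nearW => n; exact: (FQ _ _ st t0 tab (bz n) (p0 n)).
Qed.

Lemma mollifier_average_le k D s e : mollifier k ->
  L1 mu (fun t => k (t - s) * D t) -> (forall t, k (t - s) != 0 -> D t <= e) ->
  \int[mu]_t (k (t - s) * D t) <= e.
Proof.
move=> [bk k0 _ kI] LD De.
have Lk := bump_L1 (bump_shift s bk).
have E : \int[mu]_t k (t - s) = 1.
  by rewrite integral_shift//; exact/smooth_continuous/bump_smooth.
rewrite -[e]mulr1 -E -integral_scale//; apply: integral_le => //.
  exact: L1_scale.
move=> t; have [->|kt] := eqVneq (k (t - s)) 0; first by rewrite mul0r mulr0.
by rewrite mulrC ler_wpM2r// De.
Qed.

Lemma mollifier_average_ge k D s e : mollifier k ->
  L1 mu (fun t => k (t - s) * D t) -> (forall t, k (t - s) != 0 -> e <= D t) ->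
  e <= \int[mu]_t (k (t - s) * D t).
Proof.
move=> mk LD De; rewrite -lerN2 -integral_opp//.
under eq_Rintegral do rewrite -mulrN.
apply: (mollifier_average_le (D := fun t => - D t)) => //.
  by under eq_fun do rewrite mulrN; exact: L1_opp.
by move=> t kt; rewrite lerN2 De.
Qed.

Lemma rescale_support k r e x : (forall x, r <= `|x| -> k x = 0) -> 0 < e ->
  e * r <= `|x| -> rescale k e x = 0.
Proof.
move=> kr e0 ex; rewrite /rescale kr ?mulr0//.
by rewrite normrM normfV (gtr0_norm e0) ler_pdivlMr// mulrC.
Qed.

Lemma continuous_dist f (s e : R) : {for s, continuous f} -> 0 < e ->
  exists2 d, 0 < d & forall t, `|s - t| < d -> `|f s - f t| < e.
Proof.
move=> cf e0; have /cvgrPdist_lt /(_ e e0) [d /= d0 fd] := cf.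
by exists d.
Qed.

Lemma exists_below (d t : R) : 0 < d -> 0 < t -> exists s, [/\ 0 < s, s < d & s < t].
Proof.
move=> d0 t0; exists (Num.min d t / 2).
have m0 : 0 < Num.min d t by rewrite lt_min d0.
have hd : Num.min d t <= d by rewrite ge_min lexx.
have ht : Num.min d t <= t by rewrite ge_min lexx orbT.
by split; lra.
Qed.

Lemma plateau_margin (T0 T s1 s2 d : R) : 0 < d -> d <= (s1 - T0) / 2 ->
  d <= (T - s2) / 2 -> s1 <= s2 -> [/\ T0 < s1 - d, s2 + d < T,
  T0 + d <= s1 <= T - d & T0 + d <= s2 <= T - d].
Proof. by move=> h1 h2 h3 h4; split; try (apply/andP; split); lra. Qed.

(** The integrated form of d/dt int F psi <= int Q psi' <= c. The time factor is a plateau, whose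
    derivative is a bump at [s1] minus a bump at [s2]; narrowing the bumps recovers the values at
    these two times, where continuity of the moment is assumed. *)
Lemma weak_ineq_le P k F Q T0 T N psi C c s1 s2 : mollifier k ->
  L1_bounded_on F T0 T N -> L1_bounded_on Q T0 T N -> weak_ineq P F Q T0 T ->
  smooth psi -> (forall n, P (fun x => psi x * cutoff k n x)) -> (forall x, `|psi x| <= C) ->
  (forall x, `|derive1 psi x| <= C) ->
  T0 < s1 -> s1 <= s2 -> s2 < T ->
  {for s1, continuous (fun t => \int[mu]_x (F t x * psi x))} ->
  {for s2, continuous (fun t => \int[mu]_x (F t x * psi x))} ->
  (forall t, T0 <= t <= T -> \int[mu]_x (Q t x * derive1 psi x) <= c) ->
  \int[mu]_x (F s2 x * psi x) - \int[mu]_x (F s1 x * psi x) <= c * (s2 - s1).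
Proof.
move=> mk HF HQ FQ sp p0 pC dpC h1 h12 h2 c1 c2 Bc.
pose A t := \int[mu]_x (F t x * psi x).
pose B t := \int[mu]_x (Q t x * derive1 psi x).
(* Removing the linear growth [c * t] reduces the claim to [D s2 <= D s1]. *)
pose D t := A t - c * t.
have mp := smooth_measurable sp.
have mdp := smooth_measurable (smooth_derive1 sp).
have cD s : {for s, continuous A} -> {for s, continuous D}.
  move=> cA; apply: cvgB; first exact: cA.
  by apply: cvgM; [exact: cvg_cst|exact: cvg_id].
suff hD : D s2 <= D s1.
  by move: hD; rewrite /D -/(A s1) -/(A s2); move: (A s1) (A s2) => x y; nra.
apply/ler_addgt0Pr => e e0.
have e2 : 0 < e / 2 by rewrite divr_gt0.
have bk : bump k by case: mk.
have [r r_gt0 kr] := bump_support bk.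
have [d1 d1_gt0 D1] := continuous_dist (cD _ c1) e2.
have [d2 d2_gt0 D2] := continuous_dist (cD _ c2) e2.
pose d := Num.min (Num.min d1 d2) (Num.min ((s1 - T0) / 2) ((T - s2) / 2)).
have d_gt0 : 0 < d.
  by rewrite !lt_min d1_gt0 d2_gt0/= !divr_gt0// subr_gt0.
have dd1 : d <= d1 by rewrite !ge_min lexx.
have dd2 : d <= d2 by rewrite !ge_min lexx orbT.
have dT0 : d <= (s1 - T0) / 2 by rewrite !ge_min lexx !orbT.
have dT : d <= (T - s2) / 2 by rewrite !ge_min lexx !orbT.
have [m1 m2 /andP[m3 m4] /andP[m5 m6]] := plateau_margin d_gt0 dT0 dT h12.
(* The scale d / r shrinks the support radius [r] of [k] to [d], within which [D] varies by less
   than e / 2 around both end times. *)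
pose q := rescale k (d / r).
have mq : mollifier q by apply: mollifier_rescale => //; rewrite divr_gt0.
have bq : bump q by case: mq.
have qd y : d <= `|y| -> q y = 0.
  by move=> dy; apply: (rescale_support kr); rewrite ?divr_gt0// divfK// gt_eqF.
pose th := plateau q s1 s2.
have sth : smooth th by exact: smooth_plateau.
have thab : supported_in th (s1 - d) (s2 + d).
  move=> t; rewrite negb_and -!ltNge => tt; apply: (plateau_out mq qd h12).
  by case/orP : tt => /ltW tt; [left|right].
have hW := weak_ineq_bounded mk HF HQ FQ sth (fun t => plateau_ge0 t mq h12)
  (ex_intro _ _ (ex_intro _ _ (And3 _ _ thab))) sp p0 pC dpC.
have {hW} : 0 <= \int[mu]_t (derive1 th t * A t) + \int[mu]_t (th t * B t).
  exact: hW.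
have thT : supported_in th T0 T by apply: supported_le thab _ _; exact: ltW.
have dthT : supported_in (derive1 th) T0 T by exact: (supported_derive thab).
have bth := bump_supported sth thT.
have bdth := bump_derive bth.
have [LA _] := integral_tensor HF bdth dthT mp pC.
have [LB _] := integral_tensor HQ bth thT mdp dpC.
have Lct : L1 mu (fun t => c * th t) by apply: L1_scale; exact: bump_L1.
have hB : \int[mu]_t (th t * B t) <= \int[mu]_t (c * th t).
  apply: integral_le => // t; have [tT|tT] := boolP (T0 <= t <= T); last first.
    by rewrite thT// mul0r mulr0.
  by rewrite mulrC ler_wpM2r ?Bc// plateau_ge0.
have sid : smooth (fun t : R => t).
  apply: (@smooth_intro _ _ (fun=> 1)); last exact: (@smooth_cst _ 1).
have bid : bump (fun t => t * th t) := bump_mul sid bth.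
have Ltd : L1 mu (fun t => t * derive1 th t) := bump_L1 (bump_mul sid bdth).
have Lth := bump_L1 bth.
have Lth1 : L1 mu (fun t => th t * 1) by under eq_fun do rewrite mulr1.
(* Integration by parts in time: it converts the term [c * t] of [D], averaged against the
   derivative of the plateau, into the integral of [c * th] that dominates the flux term. *)
have E0 : \int[mu]_t (t * derive1 th t) = - \int[mu]_t th t.
  apply/eqP; rewrite -subr_eq0 opprK; apply/eqP.
  rewrite (_ : \int[mu]_t th t = \int[mu]_t (th t * 1)); last first.
    by apply: eq_Rintegral => t _; rewrite mulr1.
  rewrite -integral_add//; case: (bid) => _ [r1 br1].
  apply: (@integral_derive_compact _ (fun t => t * th t) _ r1) => //.
    by move=> x; exact: (is_derive_mul (is_derive_id x 1) (smooth_is_derive x sth)).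
  move=> x; apply: cvgD; apply: cvgM.
  - exact: cvg_id.
  - exact: (smooth_continuous (smooth_derive1 sth)).
  - exact: (smooth_continuous sth).
  - exact: cvg_cst.
have qT s : T0 + d <= s -> s <= T - d -> supported_in (fun t => q (t - s)) T0 T.
  move=> hs1 hs2 t; rewrite negb_and -!ltNge => tT; apply: qd; rewrite ler_normr.
  case/orP: tT => tT; apply/orP; [right|left].
    by rewrite opprB lerBrDr -lerBrDl (le_trans (ltW tT))// lerBrDr.
  by rewrite lerBrDl -lerBrDr (le_trans hs2)// lerD2r ltW.
have Lq s : T0 + d <= s -> s <= T - d -> L1 mu (fun t => q (t - s) * D t).
  move=> hs1 hs2.
  have [L _] := integral_tensor HF (bump_shift s bq) (qT _ hs1 hs2) mp pC.
  have L' : L1 mu (fun t => c * (t * q (t - s))).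
    exact: (bump_L1 (bump_scale c (bump_mul sid (bump_shift s bq)))).
  have -> : (fun t => q (t - s) * D t) =
      (fun t => q (t - s) * A t - c * (t * q (t - s))).
    by apply/funext => t; rewrite /D; ring.
  exact: L1_sub.
have Lq1 : L1 mu (fun t => q (t - s1) * D t) by exact: Lq.
have Lq2 : L1 mu (fun t => q (t - s2) * D t) by exact: Lq.
have Lct' : L1 mu (fun t => c * (t * derive1 th t)) by exact: L1_scale.
have EJ : \int[mu]_t (q (t - s1) * D t) - \int[mu]_t (q (t - s2) * D t) =
    \int[mu]_t (derive1 th t * A t) + \int[mu]_t (c * th t).
  rewrite (integral_scale c Lth) -[\int[mu]_t th t]opprK -E0 mulrN.
  rewrite -(integral_scale c Ltd) -integral_sub// -integral_sub//.
  apply: eq_Rintegral => t _; rewrite /th derive1_plateau// /D; ring.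
move=> hpos.
have J1 : \int[mu]_t (q (t - s1) * D t) <= D s1 + e / 2.
  apply: mollifier_average_le => // t qt.
  have td : `|s1 - t| < d.
    by rewrite distrC ltNge; apply: contra qt => qt; rewrite qd.
  have := D1 t (lt_le_trans td dd1); rewrite ltr_norml => /andP[+ _].
  by move: (D s1) (D t) => y z; clear -e0; lra.
have J2 : D s2 - e / 2 <= \int[mu]_t (q (t - s2) * D t).
  apply: mollifier_average_ge => // t qt.
  have td : `|s2 - t| < d.
    by rewrite distrC ltNge; apply: contra qt => qt; rewrite qd.
  have := D2 t (lt_le_trans td dd2); rewrite ltr_norml => /andP[_ +].
  by move: (D s2) (D t) => y z; clear -e0; lra.
move: EJ hB hpos J1 J2.
move: (\int[mu]_t _) (\int[mu]_t _) (\int[mu]_t _) (\int[mu]_t _) (\int[mu]_t _) => x1 x2 x3 x4 x5.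
lra.
Qed.

End Weak.

(** * Continuous curves in L^1 and tensor test functions *)

Section Curves.
Context {R : realType}.
Local Notation mu := (@lebesgue_measure R).
Implicit Types (f g h k p a : R -> R) (u w F Q : R -> R -> R).

Definition L1_curve w := [/\ measurable_fun setT (fun z : R * R => w z.1 z.2),
  forall t, L1 mu (w t),
  forall t e : R, 0 < e -> exists2 d : R, 0 < d &
    forall s, `|t - s| < d -> \int[mu]_x `|w s x - w t x| < e &
  forall T : R, exists M : R, forall t : R, t <= T -> {ae mu, forall x, `|w t x| <= M}].

(** Freezing the initial value at negative times yields a curve continuous on the whole line, so
    that two-sided limits can be used even at time 0. *)
Definition extend u (t : R) := u (Num.max t 0).

Lemma extendE u t : 0 <= t -> extend u t = u t.
Proof. by move=> t0; rewrite /extend max_l. Qed.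

Lemma measurable_extend u :
  measurable_fun [set z : R * R | 0 <= z.1] (fun z : R * R => u z.1 z.2) ->
  measurable_fun setT (fun z : R * R => extend u z.1 z.2).
Proof.
move=> mu_; pose S := [set z : R * R | 0 <= z.1].
have mS : measurable S.
  rewrite (_ : S = setT `&` (fst @^-1` `[0, +oo[%classic)).
    exact: measurable_fst.
  by apply/seteqP; split => z /=; rewrite in_itv/= andbT; [split|case].
have mg : measurable_fun setT (fun z : R * R => (Num.max z.1 0, z.2)).
  apply: measurable_fun_pair; last exact: measurable_snd.
  by apply: measurable_maxr; [exact: measurable_fst|exact: measurable_cst].
apply: (measurable_comp mS _ mu_ mg).
by move=> _ [z _ <-]; rewrite /S /= le_max lexx orbT.
Qed.

Lemma continuous_extend u : solution_space u -> forall t e : R, 0 < e ->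
  exists2 d : R, 0 < d &
    forall s, `|t - s| < d -> \int[mu]_x `|extend u s x - extend u t x| < e.
Proof.
move=> [_ _ Lu cu] t e e0; pose t' := Num.max t 0.
have t'0 : 0 <= t' by rewrite le_max lexx orbT.
have [_ c] := (fine_cvgP _ _).1 (cu t' t'0).
have /cvgr0_norm_lt /(_ e e0) := c.
rewrite /within /= => -[d /= d0 hd]; exists d => // s sd.
have s'0 : 0 <= Num.max s 0 by rewrite le_max lexx orbT.
have sd' : `|t' - Num.max s 0| < d.
  apply: le_lt_trans sd; rewrite /t'.
  have h3 := ler_norm (t - s); have h4 := ler_norm (s - t).
  rewrite distrC in h4; move: (`|t - s|) h3 h4 => y h3 h4.
  by case: (leP t 0) => h1; case: (leP s 0) => h2; rewrite ler_norml; lra.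
have := hd _ sd' s'0.
rewrite /= Lnorm1 ger0_norm; last by apply: Rintegral_ge0.
by [].
Qed.

Lemma ae_exists_itv (P : R -> Prop) (a b : R) : a < b ->
  {ae mu, forall t, P t} -> exists2 t, a < t < b & P t.
Proof.
move=> ab [N [mN N0 sN]]; apply: contrapT => H.
have : (mu `]a, b[ <= mu N)%E.
  apply: le_measure; rewrite ?inE//.
  move=> t /=; rewrite in_itv/= => tab; apply: sN => /= Pt.
  by apply: H; exists t.
rewrite N0 lebesgue_measure_itv/= lte_fin ab -EFinB lee_fin subr_le0.
by rewrite leNgt ab.
Qed.

(** The solution space bounds u only almost everywhere in (t, x), whereas every time slice is
    needed. Good times are dense, and at a good time s the excess (|u(t)| - M)^+ is at most |u(s) -
    u(t)|; letting s tend to t in L^1 shows that the excess has integral zero. *)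
Lemma bounded_extend u : solution_space u -> forall T : R, exists M : R,
  forall t, t <= T -> {ae mu, forall x, `|extend u t x| <= M}.
Proof.
move=> su T; have cu := continuous_extend su.
case: (su) => mu_ bu Lu _; pose T' := Num.max T 0.
(* One unit beyond [T'] leaves room for good times strictly above [t'], even when [t' = T']. *)
have [M uM] := bu (T' + 1); exists M => t tT; pose t' := Num.max t 0.
have t'0 : 0 <= t' by rewrite le_max lexx orbT.
have tT' : t' <= T' by rewrite /t' ge_max !le_max tT lexx orbT.
have aeM := ae_plane uM.
have Lt : L1 mu (u t') by exact: Lu.
have mt := L1_measurable Lt.
have pick d : 0 < d -> exists s, [/\ 0 <= s, `|t' - s| < d &
    {ae mu, forall x, Num.max (`|u t' x| - M) 0 <= `|u s x - u t' x|}].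
  move=> d0; have td : t' < t' + Num.min d 1 by rewrite ltrDl lt_min d0 ltr01.
  have [s /andP[s1 s2] sM] := ae_exists_itv td aeM.
  have s0 : 0 <= s by exact: le_trans (ltW s1).
  exists s; split => //.
    rewrite distrC gtr0_norm ?subr_gt0// ltrBlDl (lt_le_trans s2)// lerD2l.
    by rewrite ge_min lexx.
  have sT : s <= T' + 1.
    by rewrite (le_trans (ltW s2))// lerD// ge_min lexx orbT.
  apply: ae_imp sM => x /=; rewrite s0 sT => /(_ isT) usM.
  rewrite ge_max normr_ge0 andbT lerBlDr.
  rewrite distrC (le_trans _ (lerD (lexx _) usM))//.
  by rewrite -[leLHS](_ : `|(u t' x - u s x) + u s x| = _) ?ler_normD// subrK.
have Lm : L1 mu (fun x => Num.max (`|u t' x| - M) 0).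
  have [s [s0 _ sM]] := pick _ ltr01.
  apply: L1_ae_le (L1_norm (L1_sub (Lu s s0) Lt)).
    apply: measurable_maxr; last exact: measurable_cst.
    apply: measurable_funB; last exact: measurable_cst.
    exact: measurableT_comp.
  by apply: ae_imp sM => x; rewrite (ger0_norm (x := Num.max _ _))// le_max lexx orbT.
have h0 : \int[mu]_x (Num.max (`|u t' x| - M) 0) <= 0.
  apply/ler_addgt0Pr => e e0; rewrite add0r.
  have [d d0 hd] := cu t' e e0; have [s [s0 sd sM]] := pick _ d0.
  have := hd s sd; rewrite (extendE _ s0) (extendE _ t'0) => /ltW; apply: le_trans.
  by apply: integral_ae_le => //; apply/L1_norm/L1_sub => //; exact: Lu.
have := integral_ge0_eq0 Lm _ h0; rewrite /extend -/t' => H.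
have {}H : {ae mu, forall x, Num.max (`|u t' x| - M) 0 = 0}.
  by apply: H; apply: ae_all => x; rewrite le_max lexx orbT.
apply: ae_imp H => x /eqP.
rewrite maxEle; case: ifP => [h _|/negbT]; first by rewrite -subr_le0.
by rewrite -ltNge => h /eqP h'; rewrite h' ltxx in h.
Qed.

Lemma solution_curve u : solution_space u -> L1_curve (extend u).
Proof.
move=> su; case: (su) => m _ Lu _; split.
- exact: measurable_extend.
- by move=> t; apply: Lu; rewrite le_max lexx orbT.
- exact: continuous_extend.
- exact: bounded_extend.
Qed.

Lemma continuous_curve_norm w : L1_curve w ->
  continuous (fun t => \int[mu]_x `|w t x|).
Proof.
move=> [_ Lw cw _] t; apply/cvgrPdist_lt => e e0.
have [d d0 hd] := cw t e e0; exists d => //= s sd.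
apply: le_lt_trans (hd s sd); rewrite distrC.
have Ls := L1_norm (Lw s); have Lt := L1_norm (Lw t).
apply: le_trans (integral_norm_sub Ls Lt) _.
apply: integral_le; first exact/L1_norm/L1_sub.
  exact/L1_norm/L1_sub.
by move=> x; exact: ler_dist_dist.
Qed.

Lemma curve_norm_bounded w (T0 T : R) : L1_curve w -> exists2 N : R, 0 <= N &
  forall t, T0 <= t <= T -> \int[mu]_x `|w t x| <= N.
Proof.
move=> cw; have cn := continuous_curve_norm cw.
have [TT|TT] := leP T0 T; last first.
  by exists 0 => // t /andP[h1 h2]; have := le_trans h1 h2; rewrite leNgt TT.
have [c _ hc] := EVT_max TT (continuous_subspaceT cn).
exists (\int[mu]_x `|w c x|); first by apply: Rintegral_ge0.
by move=> t tT; apply: hc; rewrite in_itv.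
Qed.

Lemma continuous_tensor f g : smooth f -> smooth g ->
  continuous (fun z : R * R => f z.1 * g z.2).
Proof.
move=> sf sg z; apply: cvgM.
  by apply: continuous_comp; [exact: cvg_fst|exact: smooth_continuous].
by apply: continuous_comp; [exact: cvg_snd|exact: smooth_continuous].
Qed.

Lemma Cn_tensor n f g : smooth f -> smooth g -> Cn n (fun z => f z.1 * g z.2).
Proof.
elim: n f g => [|n IH] f g sf sg; split.
- exact: continuous_tensor.
- by [].
- exact: continuous_tensor.
have D1 (z : R * R) : is_derive (z.1 : R) (1 : R) (fun t => f t * g z.2) (derive1 f z.1 * g z.2).
  rewrite mulrC; under eq_fun do rewrite mulrC.
  by apply: is_derive_scale; exact: smooth_is_derive.
have D2 (z : R * R) : is_derive (z.2 : R) (1 : R) (fun t => f z.1 * g t) (f z.1 * derive1 g z.2).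
  by apply: is_derive_scale; exact: smooth_is_derive.
split.
- by move=> z; exact: is_derive_derivable (D1 z).
- by move=> z; exact: is_derive_derivable (D2 z).
- rewrite (_ : dt _ = fun z => derive1 f z.1 * g z.2).
    exact: (IH _ _ (smooth_derive1 sf) sg).
  by apply/funext => z; exact: is_derive_derive1 (D1 z).
- rewrite (_ : dx _ = fun z => f z.1 * derive1 g z.2).
    exact: (IH _ _ sf (smooth_derive1 sg)).
  by apply/funext => z; exact: is_derive_derive1 (D2 z).
Qed.

Lemma dt_tensor f g z : smooth f ->
  dt (fun z => f z.1 * g z.2) z = derive1 f z.1 * g z.2.
Proof.
move=> sf; apply: is_derive_derive1; rewrite mulrC /=.
under eq_fun do rewrite mulrC.
by apply: is_derive_scale; exact: smooth_is_derive.
Qed.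

Lemma dx_tensor f g z : smooth g ->
  dx (fun z => f z.1 * g z.2) z = f z.1 * derive1 g z.2.
Proof.
move=> sg; apply: is_derive_derive1 => /=.
by apply: is_derive_scale; exact: smooth_is_derive.
Qed.

Lemma test_function_tensor f g (a b : R) : 0 < a -> smooth f ->
  supported_in f a b -> bump g -> test_function (fun z => f z.1 * g z.2).
Proof.
move=> a0 sf fab bg; case: (bg) => sg [r gr].
pose K := `[a, b]%classic `*` `[- r, r]%classic : set (R * R).
have cK : compact K by apply: compact_setX; exact: segment_compact.
have sK : closed_support (fun z => f z.1 * g z.2) `<=` K.
  have clK : closed K.
    apply: closedI; apply: preimage_closed; try exact: itv_closed.
      by move=> z _; exact: cvg_fst.
    by move=> z _; exact: cvg_snd.
  rewrite /closed_support [X in _ `<=` X](closure_id K).1//.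
  apply: closure_subset => z /=; rewrite mulf_eq0 negb_or => /andP[fz gz]; split => /=.
    by rewrite in_itv/=; apply: contraR fz => /fab ->.
  rewrite in_itv/= -ler_norml leNgt; apply: contra gz => /ltW /gr ->//.
split.
- by move=> n; exact: Cn_tensor.
- by apply: subclosed_compact cK sK; exact: closed_closure.
- by move=> z /sK[/=]; rewrite in_itv/= => /andP[az _] _; exact: lt_le_trans az.
Qed.

Lemma supported_nonpos f (a b t : R) : 0 < a -> supported_in f a b -> t <= 0 ->
  f t = 0 /\ derive1 f t = 0.
Proof.
move=> a0 fab t0; have ta := le_lt_trans t0 a0; split.
  by apply: fab; rewrite negb_and -ltNge ta.
apply: derive1_near0; near=> y; apply: fab; rewrite negb_and -ltNge.
by apply/orP; left; near: y; exact: lt_nbhsl.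
Unshelve. all: by end_near. Qed.

Lemma half_plane_integralE (G : R * R -> R) :
  (forall z, z.1 <= 0 -> G z = 0) ->
  half_plane_integral G = \int[(mu \x mu)%E]_z G z.
Proof.
move=> G0; rewrite /half_plane_integral Rintegral_mkcond.
apply: eq_Rintegral => z _; rewrite patchE; case: ifPn => // /negP zh.
rewrite G0// leNgt; apply/negP => z0; apply: zh; exact/mem_set.
Qed.

End Curves.

(** * The entropy solution *)

Section EntropySide.
Context {R : realType}.
Local Notation mu := (@lebesgue_measure R).
Local Notation I f := (\int[mu]_x f x).
Implicit Types (f g phi psi : R -> R) (k v : R) (u w : R -> R -> R).

Lemma integral_tensor_bump f g : bump f -> bump g ->
  L1 (mu \x mu)%E (fun z => f z.1 * g z.2) /\
  \int[(mu \x mu)%E]_z (f z.1 * g z.2) = I f * I g.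
Proof.
move=> bf bg; have Lf := bump_L1 bf; have Lg := bump_L1 bg.
have m1 : measurable_fun setT (fun _ : R * R => 1 : R) by exact: measurable_cst.
have n1 (z : R * R) : `|1 : R| <= 1 by rewrite normr1.
have := L1_plane_mul Lf Lg m1 n1; under eq_fun do rewrite mulr1.
move=> L; split => //; have [_ ->] := fubini1 L.
rewrite mulrC -integral_scale//; apply: eq_Rintegral => t _ /=.
by rewrite integral_scale// mulrC.
Qed.

Lemma integral_bump_derive f : bump f -> I (derive1 f) = 0.
Proof.
move=> bf; case: (bf) => sf [r fr].
have df x := smooth_is_derive x sf.
exact: (integral_derive_compact df (smooth_continuous (smooth_derive1 sf)) fr).
Qed.

Lemma curve_comp_bounded w (T0 T M C : R) phi : L1_curve w ->
  measurable_fun setT phi ->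
  (forall t, T0 <= t <= T -> {ae mu, forall x, `|w t x| <= M}) ->
  (forall v, `|v| <= M -> `|phi v| <= C * `|v|) -> 0 <= C ->
  exists N, L1_bounded_on (fun t x => phi (w t x)) T0 T N.
Proof.
move=> cw mphi wM phiC C0; have [N _ wN] := curve_norm_bounded T0 T cw.
case: cw => mw Lw _ _; exists (C * N); split.
  exact: (measurableT_comp mphi mw).
move=> t tT; have mt := L1_measurable (Lw t).
have LC : L1 mu (fun x => C * `|w t x|) by apply: L1_scale; exact: L1_norm.
have aeC : {ae mu, forall x, `|phi (w t x)| <= C * `|w t x|}.
  by apply: ae_imp (wM t tT) => x; exact: phiC.
have L : L1 mu (fun x => phi (w t x)).
  by apply: L1_ae_le LC => //; exact: measurableT_comp.
split => //; apply: le_trans (_ : C * \int[mu]_x `|w t x| <= _); last first.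
  by rewrite ler_wpM2l// wN.
rewrite -integral_scale; last exact: L1_norm.
by apply: integral_ae_le => //; exact: L1_norm.
Qed.

Lemma continuous_curve_lipschitz w phi psi C : L1_curve w -> measurable_fun setT phi ->
  phi 0 = 0 -> (forall v v', `|phi v - phi v'| <= `|v - v'|) ->
  measurable_fun setT psi -> (forall x, `|psi x| <= C) ->
  (forall t, L1 mu (fun x => phi (w t x))) /\
  continuous (fun t => \int[mu]_x (phi (w t x) * psi x)).
Proof.
move=> [mw Lw cw _] mphi phi0 lphi mpsi psiC.
have C0 : 0 <= C by exact: le_trans (psiC 0).
have L t : L1 mu (fun x => phi (w t x)).
  apply: L1_le (L1_norm (Lw t)).
    by apply: (measurableT_comp mphi); exact: L1_measurable (Lw t).
  by move=> x; have := lphi (w t x) 0; rewrite phi0 !subr0.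
split => // t; apply/cvgrPdist_lt => e e0.
have C1 : 0 < C + 1 by rewrite ltr_wpDl.
have e1 : 0 < e / (C + 1) by rewrite divr_gt0.
have [d d0 hd] := cw t _ e1; exists d => //= s sd.
have Lp r : L1 mu (fun x => phi (w r x) * psi x) by exact: (L1_mul_bnd (L r) mpsi psiC).
have Lst := L1_sub (Lw s) (Lw t).
apply: le_lt_trans (integral_norm_sub (Lp t) (Lp s)) _.
apply: (@le_lt_trans _ _ (C * \int[mu]_x `|w s x - w t x|)).
  rewrite -integral_scale; last exact: L1_norm.
  apply: integral_le; first exact/L1_norm/L1_sub.
    by apply: L1_scale; exact: L1_norm.
  move=> x; rewrite -mulrBl normrM mulrC; apply: ler_pM => //.
  by rewrite distrC; exact: lphi.
have := hd s sd; rewrite ltr_pdivlMr// => h.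
apply: le_lt_trans h; rewrite mulrC ler_wpM2l//; first by apply: Rintegral_ge0.
by rewrite lerDl.
Qed.

(* Kruzkov entropy pairs for the flux v^2, normalised to vanish at v = 0
   so that they are integrable along an L^1 curve. *)
Definition entropy k (v : R) := `|v - k| - k.
Definition entropy_flux k (v : R) := Num.sg (v - k) * (v ^+ 2 - k ^+ 2) - k ^+ 2.

Lemma entropy_fluxE k v : entropy_flux k v = `|v - k| * (v + k) - k ^+ 2.
Proof. by rewrite /entropy_flux subr_sqr mulrA normrEsg. Qed.

(** The normalised flux is -v^2 for v <= k and v^2 - 2 k^2 for v > k. Being quadratic at 0, it is
    integrable along a bounded L^1 curve. *)
Lemma norm_entropy_flux_le k v : 0 <= k -> `|entropy_flux k v| <= v ^+ 2.
Proof.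
move=> k0; rewrite entropy_fluxE ler_norml !expr2.
by have [h|h] := leP v k; [rewrite ler0_norm ?subr_le0//|
  rewrite gtr0_norm ?subr_gt0//]; apply/andP; split; nra.
Qed.

Lemma entropy_lipschitz k v v' : `|entropy k v - entropy k v'| <= `|v - v'|.
Proof.
rewrite /entropy (_ : _ - _ = `|v - k| - `|v' - k|); last by ring.
apply: le_trans (ler_dist_dist _ _) _.
by rewrite (_ : v - k - (v' - k) = v - v'); last by ring.
Qed.

Lemma entropy0 k : 0 <= k -> entropy k 0 = 0.
Proof. by move=> k0; rewrite /entropy sub0r normrN ger0_norm// subrr. Qed.

Lemma norm_entropy_le k v : 0 <= k -> `|entropy k v| <= `|v|.
Proof. by move=> k0; have := entropy_lipschitz k v 0; rewrite entropy0// !subr0. Qed.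

Lemma measurable_entropy k : measurable_fun setT (entropy k).
Proof.
apply: measurable_funB; last exact: measurable_cst.
by apply: measurableT_comp => //; apply: measurable_funB.
Qed.

Lemma measurable_entropy_flux k : measurable_fun setT (entropy_flux k).
Proof.
rewrite (_ : entropy_flux k = fun v => `|v - k| * (v + k) - k ^+ 2).
  apply: measurable_funB; last exact: measurable_cst.
  apply: measurable_funM; last exact: measurable_funD.
  by apply: measurableT_comp => //; apply: measurable_funB.
by apply/funext => v; rewrite entropy_fluxE.
Qed.

Lemma entropy_bounded u k (T : R) : solution_space u -> 0 <= k ->
  exists N, L1_bounded_on (fun t x => entropy k (extend u t x)) 0 T N /\
            L1_bounded_on (fun t x => entropy_flux k (extend u t x)) 0 T N.
Proof.
move=> su k0; have cu := solution_curve su; case: (cu) => _ _ _ /(_ T)[M uM].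
have uM' t : 0 <= t <= T -> {ae mu, forall x, `|extend u t x| <= M}.
  by move=> /andP[_ tT]; exact: uM.
have b1 v : `|v| <= M -> `|entropy k v| <= 1 * `|v|.
  by move=> _; rewrite mul1r; exact: norm_entropy_le.
have b2 v : `|v| <= M -> `|entropy_flux k v| <= `|M| * `|v|.
  move=> vM; apply: le_trans (norm_entropy_flux_le v k0) _.
  by rewrite -real_normK ?num_real// expr2 ler_wpM2r// (le_trans vM)// ler_norm.
have [N1 [m1 H1]] := curve_comp_bounded cu (measurable_entropy k) uM' b1 ler01.
have [N2 [m2 H2]] := curve_comp_bounded cu (measurable_entropy_flux k) uM' b2
  (normr_ge0 M).
exists (Num.max N1 N2); split; split => // t tT.
  by have [? h] := H1 t tT; split => //; rewrite le_max h.
by have [? h] := H2 t tT; split => //; rewrite le_max h orbT.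
Qed.

Lemma entropy_weak_ineq u (u0 : R -> R) k (T : R) :
  entropy_solution (fun v => v ^+ 2) u0 u -> 0 <= k ->
  weak_ineq [set f | forall x, 0 <= f x] (fun t x => entropy k (extend u t x))
            (fun t x => entropy_flux k (extend u t x)) 0 T.
Proof.
move=> [su _ eu] k0 th ze sth th0 [a [b [a0 bT thab]]] bze ze0.
have sze := bump_smooth bze.
have [N [HF HQ]] := entropy_bounded T su k0.
have thT : supported_in th 0 T by apply: supported_le thab _ _; exact: ltW.
have dthT := supported_derive thab a0 bT.
have bth := bump_supported sth thT; have bdth := bump_derive bth.
have [C1 zeC] := bump_bounded bze.
have [C2 dzeC] := bump_bounded (bump_derive bze).
have L1F := L1_tensor HF bdth dthT (smooth_measurable sze) zeC.
have L1Q := L1_tensor HQ bth thT (smooth_measurable (smooth_derive1 sze)) dzeC.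
have [L3 E3] := integral_tensor_bump bdth bze.
have [L4 E4] := integral_tensor_bump bth (bump_derive bze).
have tt := test_function_tensor a0 sth thab bze.
have := eu k _ tt (fun z => mulr_ge0 (th0 z.1) (ze0 z.2)).
rewrite half_plane_integralE; last first.
  move=> z z0; rewrite dt_tensor// dx_tensor//.
  by have [-> ->] := supported_nonpos a0 thab z0; rewrite !mul0r !mulr0 addr0.
congr (0 <= _).
(* [G] restores the constants removed by the normalisation of the entropy pair. They contribute
   nothing, because the derivatives of both test factors have zero integral. *)
pose G z := (entropy k (extend u z.1 z.2) * (derive1 th z.1 * ze z.2) +
   entropy_flux k (extend u z.1 z.2) * (th z.1 * derive1 ze z.2)) +
   (k * (derive1 th z.1 * ze z.2) + k ^+ 2 * (th z.1 * derive1 ze z.2)).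
transitivity (\int[(mu \x mu)%E]_z G z).
  apply: eq_Rintegral => z _; rewrite dt_tensor// dx_tensor// /G.
  have [z0|z0] := leP z.1 0.
    by have [-> ->] := supported_nonpos a0 thab z0; rewrite !mul0r !mulr0 !addr0.
  rewrite extendE ?(ltW z0)// /entropy /entropy_flux; ring.
have L5 := L1_scale k L3; have L6 := L1_scale (k ^+ 2) L4.
rewrite integral_add; [|exact: L1_add|exact: L1_add].
rewrite [X in _ + X]integral_add// integral_scale// integral_scale//.
by rewrite E3 E4 !integral_bump_derive// mul0r !mulr0 !addr0.
Qed.

(** Test functions vanish near t = 0, so the weak formulation only compares positive times; this
    passage to the limit reaches the initial datum. *)
Lemma continuous_right0 f (c t : R) : continuous f -> 0 < t ->
  (forall s, 0 < s -> s < t -> c <= f s) -> c <= f 0.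
Proof.
move=> cf t0 H; apply/ler_addgt0Pr => e e0.
have [d d0 hd] := continuous_dist (cf 0) e0.
have [s [s0 sd st]] := exists_below d0 t0.
have := hd s; rewrite sub0r normrN gtr0_norm// => /(_ sd).
by rewrite ltr_norml => /andP[h1 h2]; have := H s s0 st; lra.
Qed.

Lemma continuous_entropy u k psi C : solution_space u -> 0 <= k ->
  measurable_fun setT psi -> (forall x, `|psi x| <= C) ->
  continuous (fun t => \int[mu]_x (entropy k (extend u t x) * psi x)).
Proof.
move=> su k0 mpsi psiC; have cu := solution_curve su.
exact: (continuous_curve_lipschitz cu (measurable_entropy k) (entropy0 k0)
  (entropy_lipschitz k) mpsi psiC).2.
Qed.

Lemma L1_entropy u k t : solution_space u -> 0 <= k ->
  L1 mu (fun x => entropy k (extend u t x)).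
Proof.
move=> su k0; have cu := solution_curve su.
have m1 : measurable_fun setT (fun _ : R => 1 : R) by exact: measurable_cst.
have n1 (z : R) : `|1 : R| <= 1 by rewrite normr1.
exact: (continuous_curve_lipschitz cu (measurable_entropy k) (entropy0 k0)
  (entropy_lipschitz k) m1 n1).1.
Qed.

(** With the constant [psi = 1] as space factor the flux drops out. Positive [s] is treated first,
    then [s = 0] by continuity. *)
Lemma entropy_decreasing (rho : R -> R) u (u0 : R -> R) k (t s : R) : mollifier rho ->
  entropy_solution (fun v => v ^+ 2) u0 u -> 0 <= k -> 0 <= s -> s <= t ->
  \int[mu]_x entropy k (extend u t x) <= \int[mu]_x entropy k (extend u s x).
Proof.
move=> mrho eu k0 s0 st; have su : solution_space u by case: eu.
have n1 (x : R) : `|1 : R| <= 1 by rewrite normr1.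
have dn1 (x : R) : `|derive1 (fun _ : R => 1 : R) x| <= 1 by rewrite derive1_one normr0.
have ce := continuous_entropy su k0 (smooth_measurable (@smooth_one R)) n1.
have E r : \int[mu]_x (entropy k (extend u r x) * 1) = \int[mu]_x entropy k (extend u r x).
  by apply: eq_Rintegral => x _; rewrite mulr1.
have H r : 0 < r -> r <= t ->
    \int[mu]_x entropy k (extend u t x) <= \int[mu]_x entropy k (extend u r x).
  move=> r0 rt; have [N [HF HQ]] := entropy_bounded (t + 1) su k0.
  have tt1 : t < t + 1 by rewrite ltrDl.
  have := weak_ineq_le (c := 0) mrho HF HQ (entropy_weak_ineq eu k0) (@smooth_one R)
    (fun n x => mulr_ge0 ler01 (cutoff_ge0 n x mrho)) n1 dn1
    r0 rt tt1 (ce _) (ce _).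
  rewrite !E mul0r subr_le0; apply => q _; under eq_Rintegral do rewrite derive1_one mulr0.
  by rewrite /Rintegral integral0.
have := s0; rewrite le_eqVlt => /orP[/eqP s00|s_gt0]; last exact: H.
rewrite -s00 -E -[leRHS]E; have := st; rewrite -s00 le_eqVlt => /orP[/eqP ->//|t0].
apply: (continuous_right0 (f := fun t => \int[mu]_x (entropy k (extend u t x) * 1)) ce t0).
by move=> r r0 rt; rewrite !E; apply: H => //; exact: ltW.
Qed.

Local Notation box := (\1_(`]-1, 0[) : R -> R).

Lemma box_L1 : L1 mu box.
Proof. exact: integrable_indic_itv. Qed.

Lemma integral_box : I box = 1.
Proof.
rewrite /Rintegral integral_indic//= setIT lebesgue_measure_itv/= lte_fin.
by rewrite ltrN10 -EFinB opprK add0r.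
Qed.

Lemma entropy_initial_le (rho : R -> R) u k t : mollifier rho ->
  entropy_solution (fun v => v ^+ 2) box u -> 0 <= k -> 0 <= t ->
  \int[mu]_x entropy k (extend u t x) <= \int[mu]_x entropy k (box x).
Proof.
move=> mrho eu k0 t0; have [su iu _] := eu.
have -> : \int[mu]_x entropy k (box x) = \int[mu]_x entropy k (extend u 0 x).
  have LE := L1_entropy 0 su k0.
  have ae0 : {ae mu, forall x, entropy k (extend u 0 x) = entropy k (box x)}.
    by apply: ae_imp iu => x; rewrite extendE// => ->.
  apply/esym; apply: integral_ae_eq0 => //.
  apply: (L1_ae_eq _ _ ae0 LE); first exact: L1_measurable LE.
  by apply: (measurableT_comp (measurable_entropy k)); exact: measurable_indic.
exact: entropy_decreasing mrho eu k0 _ t0.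
Qed.

(** The sum of the entropies for k = 0 and k = 1 is |v| + |v - 1| - 1, which is nonnegative and
    vanishes exactly on [0, 1]. Its integral is at most 1 - 1 = 0, the value at the initial datum,
    so it vanishes almost everywhere. The entropy for k = 0 also bounds the mass. *)
Lemma entropy_solution_range (rho : R -> R) u t : mollifier rho ->
  entropy_solution (fun v => v ^+ 2) box u -> 0 <= t ->
  {ae mu, forall x, 0 <= extend u t x <= 1} /\ \int[mu]_x extend u t x <= 1.
Proof.
move=> mrho eu t0; have [su _ _] := eu.
have h0 := entropy_initial_le mrho eu (lexx 0) t0.
have h1 := entropy_initial_le mrho eu ler01 t0.
have L0 := L1_entropy t su (lexx 0); have LE1 := L1_entropy t su ler01.
have box01 x : box x = 0 \/ box x = 1.
  by rewrite indicE; case: (_ \in _); [right|left].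
have E0 : \int[mu]_x entropy 0 (box x) = 1.
  transitivity (I box); last exact: integral_box.
  apply: eq_Rintegral => x _.
  by rewrite /entropy !subr0; case: (box01 x) => ->; rewrite ?normr0 ?normr1.
have E1 : \int[mu]_x entropy 1 (box x) = - 1.
  transitivity (- I box); last by rewrite integral_box.
  rewrite -integral_opp; last exact: box_L1.
  apply: eq_Rintegral => x _; rewrite /entropy.
  by case: (box01 x) => ->; rewrite ?sub0r ?normrN ?normr1 ?subrr ?normr0 ?sub0r ?oppr0.
rewrite E0 in h0; rewrite E1 in h1.
have hs : {ae mu, forall x, entropy 0 (extend u t x) + entropy 1 (extend u t x) = 0}.
  apply: integral_ge0_eq0; first exact: L1_add.
    apply: ae_all => x; rewrite /entropy !subr0.
    have := ler_norm (extend u t x); have := ler_norm (1 - extend u t x).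
    rewrite distrC; lra.
  by rewrite integral_add//; lra.
have h01 : {ae mu, forall x, 0 <= extend u t x <= 1}.
  apply: ae_imp hs => x; rewrite /entropy !subr0.
  have := ler_norm (extend u t x); have := ler_norm (1 - extend u t x).
  have := ler_norm (- extend u t x); have := ler_norm (extend u t x - 1).
  rewrite normrN distrC => h2 h3 h4 h5 h6; apply/andP; split; lra.
split => //; apply: le_trans h0.
have Lu : L1 mu (extend u t) by have [_ + _ _] := solution_curve su; exact.
apply: integral_le => // x.
by rewrite /entropy !subr0 ler_norm.
Qed.

Lemma entropy_solution_not_binary (rho : R -> R) u t : mollifier rho ->
  (forall x, 1 <= `|x| -> rho x = 0) ->
  entropy_solution (fun v => v ^+ 2) box u -> 0 < t ->
  ~ {ae mu, forall x, extend u t x = 0 \/ extend u t x = 1}.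
Proof.
move=> mrho rho1 eu t0 bin; have [su iu _] := eu.
pose k : R := 1 / 2; have k0 : 0 <= k by rewrite divr_ge0.
have cu := solution_curve su; have [_ Lu _ _] := cu.
have e01 v : v = 0 \/ v = 1 -> entropy k v = 0.
  move=> [->|->]; first exact: entropy0.
  by rewrite /entropy /k ger0_norm; lra.
have nonpos v : 0 <= v <= 1 -> entropy k v <= 0.
  by move=> /andP[v0 v1]; rewrite /entropy subr_le0 ler_norml /k; apply/andP; split; lra.
have bins s : 0 <= s -> s <= t ->
    {ae mu, forall x, extend u s x = 0 \/ extend u s x = 1}.
  move=> s0 st; have LE := L1_entropy s su k0.
  have LEt := L1_entropy t su k0.
  have Et : \int[mu]_x entropy k (extend u t x) = 0.
    have L0 := @L1_cst0 _ _ _ mu.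
    rewrite (integral_ae_eq0 LEt L0); first by rewrite /Rintegral integral0.
    by apply: ae_imp bin => x; exact: e01.
  have Es := entropy_decreasing mrho eu k0 s0 st; rewrite Et in Es.
  have hE : {ae mu, forall x, - entropy k (extend u s x) = 0}.
    apply: integral_ge0_eq0; first exact: L1_opp.
      have [r _] := entropy_solution_range mrho eu s0.
      by apply: ae_imp r => x /nonpos; rewrite oppr_ge0.
    by rewrite integral_opp// oppr_le0.
  have [r _] := entropy_solution_range mrho eu s0.
  apply: ae_imp2 r hE => x /andP[x0 x1] /eqP; rewrite oppr_eq0 /entropy subr_eq0.
  have [xk|xk] := leP (extend u s x) k.
    by rewrite ler0_norm ?subr_le0// => /eqP h; left; lra.
  by rewrite gtr0_norm ?subr_gt0// => /eqP h; right; rewrite /k in h; lra.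
(* Width 1/2 and centre -1/2 make [q] vanish outside ]-1, 0[, where the initial datum equals 1; this
   gives [beta 0 = 1] below. *)
pose q x := rescale rho (1 / 2) (x + 1 / 2).
have h2 : 0 < 1 / 2 :> R by rewrite divr_gt0.
have mr : mollifier (rescale rho (1 / 2)) by exact: mollifier_rescale.
have [br r0 _ _] := mr.
have bq : bump q.
  by have := bump_shift (- (1 / 2)) br; under eq_fun do rewrite opprK.
have q0 x : 0 <= q x by exact: r0.
have sq := bump_smooth bq.
have Lq := bump_L1 bq.
have Iq : I q = 1.
  have [_ _ _ <-] := mr.
  transitivity (\int[mu]_x rescale rho (1 / 2) (x - - (1 / 2))).
    by apply: eq_Rintegral => x _; rewrite opprK.
  apply: integral_shift => //.
  exact/smooth_continuous/bump_smooth.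
(* A smooth step, equal to 1 left of -1 and to 0 right of 0, that observes the half-line left of
   -1/2. It is bounded without compact support, which [weak_ineq_le] permits. *)
pose psi x := 1 - primitive q x.
have spsi : smooth psi.
  by apply: (@smooth_sub _ (fun=> 1)); [exact: (@smooth_cst R 1)|exact: smooth_primitive].
have psi0 x : 0 <= psi x by rewrite subr_ge0 -Iq primitive_le.
have dpsi x : derive1 psi x = - q x.
  rewrite (@derive1_sub _ (fun=> 1)); [|exact: (@smooth_cst R 1)|exact: smooth_primitive].
  rewrite derive1_primitive// [X in X - _](_ : _ = 0) ?sub0r//.
  by apply: is_derive_derive1; exact: is_derive_cst.
have [C qC] := bump_bounded bq.
pose C' := Num.max C 1.
have psiC x : `|psi x| <= C'.
  rewrite ger0_norm// le_max; apply/orP; right.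
  by rewrite lerBlDr lerDl primitive_ge0.
have dpsiC x : `|derive1 psi x| <= C' by rewrite dpsi normrN le_max qC.
pose beta s := \int[mu]_x (extend u s x * q x).
have cbeta : continuous beta.
  have mid : measurable_fun setT (fun v : R => v) by exact: measurable_id.
  have lid (v v' : R) : `|v - v'| <= `|v - v'| by [].
  exact: (continuous_curve_lipschitz cu mid erefl lid (smooth_measurable sq) qC).2.
have beta0 : beta 0 = 1.
  rewrite -Iq; apply: integral_ae_eq0 => //.
    exact: (L1_mul_bnd (Lu 0) (smooth_measurable sq) qC).
  apply: ae_imp iu => x; rewrite extendE// => ->; rewrite indicE.
  have [xb|xb] := boolP (x \in _); first by rewrite mul1r.
  rewrite mul0r /q /rescale rho1 ?mulr0// normrM normfV (gtr0_norm h2).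
  rewrite ler_pdivlMr// mul1r ler_normr; move/negP : xb => xb.
  rewrite leNgt [X in _ || X]leNgt -negb_and; apply/negP => /andP[h3 h4]; apply: xb.
  by apply/mem_set; rewrite /= in_itv/=; apply/andP; split; lra.
have [d d0 hd] := continuous_dist (cbeta 0) h2.
have [d' [d'0 d'd /ltW d't]] := exists_below d0 t0.
have [N [HF HQ]] := entropy_bounded d' su k0.
have ce := continuous_entropy su k0 (smooth_measurable spsi) psiC.
have A0 s : 0 <= s -> s <= t -> \int[mu]_x (entropy k (extend u s x) * psi x) = 0.
  move=> s0 st; have L0 := @L1_cst0 _ _ _ mu.
  have LA := L1_mul_bnd (L1_entropy s su k0) (smooth_measurable spsi) psiC.
  rewrite (integral_ae_eq0 LA L0); first by rewrite /Rintegral integral0.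
  by apply: ae_imp (bins s s0 st) => x /e01 ->; rewrite mul0r.
(* The entropy flux for k = 1/2 is 0 at v = 0 and 1/2 at v = 1, so on binary values it equals v / 2.
   The integral is then -beta(s) / 2, and beta(s) > 1/2 up to time [d']. *)
have B0 s : 0 <= s <= d' ->
    \int[mu]_x (entropy_flux k (extend u s x) * derive1 psi x) <= - (1 / 4).
  move=> /andP[s0 sd]; have st := le_trans sd d't.
  have sin : 0 <= s <= d' by rewrite s0 sd.
  have [LQ _] := HQ.2 s sin.
  have LB := L1_mul_bnd LQ (smooth_measurable (smooth_derive1 spsi)) dpsiC.
  have Lb := L1_mul_bnd (Lu s) (smooth_measurable sq) qC.
  have -> : \int[mu]_x (entropy_flux k (extend u s x) * derive1 psi x) =
      - (1 / 2) * beta s.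
    rewrite -integral_scale//; apply: integral_ae_eq0 => //; first exact: L1_scale.
    apply: ae_imp (bins s s0 st) => x hx; rewrite dpsi entropy_fluxE.
    case: hx => ->; first by rewrite sub0r normrN ger0_norm// add0r -expr2 subrr !mul0r mulr0.
    by rewrite /k ger0_norm; lra.
  have := hd s; rewrite sub0r normrN ger0_norm// => /(_ (le_lt_trans sd d'd)).
  by rewrite beta0 ltr_norml => /andP[_ h3]; lra.
(* [weak_ineq_le] wants end times strictly inside ]0, d'[. Between the two thirds the entropy seen
   by [psi] would drop by at least d' / 12, although it is zero at both. *)
have d13 : 0 < d' / 3 by rewrite divr_gt0.
have lt12 : d' / 3 <= 2 * (d' / 3) by clear -d13; lra.
have lt23 : 2 * (d' / 3) < d' by clear -d'0; lra.
have d13t : d' / 3 <= t by clear -d'0 d't; lra.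
have d23t : 2 * (d' / 3) <= t by clear -d'0 d't; lra.
have := weak_ineq_le mrho HF HQ (entropy_weak_ineq eu k0) spsi
  (fun n x => mulr_ge0 (psi0 x) (cutoff_ge0 n x mrho)) psiC dpsiC
  d13 lt12 lt23 (ce _) (ce _) B0.
rewrite (A0 _ (ltW d13) d13t) (A0 _ (le_trans (ltW d13) lt12) d23t).
by clear -d13; lra.
Qed.

End EntropySide.

(** * The nonlocal equation *)

Section NonlocalSide.
Context {R : realType}.
Local Notation mu := (@lebesgue_measure R).
Local Notation I f := (\int[mu]_x f x).
Local Notation isd f x df := (is_derive (x : R) (1 : R) (f : R -> R) (df : R)).
Implicit Types (f g phi psi k : R -> R) (u w : R -> R -> R).

(** The extended integral is the difference of the integrals of the positive and negative parts,
    each measurable by Tonelli; no integrability of the slices has to be known. *)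
Lemma measurable_convolution w k : measurable_fun setT (fun z : R * R => w z.1 z.2) ->
  measurable_fun setT k ->
  measurable_fun setT (fun z : R * R => convolution (w z.1) k z.2).
Proof.
move=> mw mk.
pose F (p : (R * R) * R) := w p.1.1 p.2 * k (p.1.2 - p.2).
have m11 : measurable_fun setT (fun p : (R * R) * R => p.1.1).
  exact: (measurableT_comp measurable_fst measurable_fst).
have m12 : measurable_fun setT (fun p : (R * R) * R => p.1.2).
  exact: (measurableT_comp measurable_snd measurable_fst).
have m2 : measurable_fun setT (fun p : (R * R) * R => p.2) by exact: measurable_snd.
have mF : measurable_fun setT F.
  apply: measurable_funM.
    exact: (measurableT_comp mw (measurable_fun_pair m11 m2)).
  by apply: (measurableT_comp mk); exact: measurable_funB.
have mEF : measurable_fun setT (EFin \o F) by exact/measurable_EFinP.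
have mP := measurable_fun_fubini_tonelli_F (m2 := mu) _ (measurable_funepos mEF)
  (fun=> funepos_ge0 _ _).
have mN := measurable_fun_fubini_tonelli_F (m2 := mu) _ (measurable_funeneg mEF)
  (fun=> funeneg_ge0 _ _).
have mS := measurableT_comp (fine_measurable measurableT) (emeasurable_funB mP mN).
rewrite (_ : (fun z => _) = fine \o (fubini_F mu (EFin \o F)^\+%E \- fubini_F mu (EFin \o F)^\-%E)%E)//.
apply/funext => z; rewrite /convolution /Rintegral /=; congr fine.
by rewrite [LHS]integralE; congr (_ - _)%E; apply: eq_integral => x _;
  rewrite ?funeposE ?funenegE.
Qed.

Lemma curve_convolution_bounded w k T0 T : L1_curve w -> bump k -> exists2 C : R,
  0 <= C & forall t, T0 <= t <= T -> forall x, `|convolution (w t) k x| <= C.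
Proof.
move=> cw bk; have [N N0 wN] := curve_norm_bounded T0 T cw.
have [C kC] := bump_bounded bk; have C0 : 0 <= C by exact: le_trans (kC 0).
case: (cw) => _ Lw _ _.
exists (C * N); first by rewrite mulr_ge0.
move=> t tT x; apply: le_trans (norm_convolution_le x (Lw t) bk kC) _.
by rewrite ler_wpM2l// wN.
Qed.

Lemma convolution_curve_dist w k C s t x : L1_curve w -> bump k ->
  (forall x, `|k x| <= C) ->
  `|convolution (w s) k x - convolution (w t) k x| <= C * \int[mu]_y `|w s y - w t y|.
Proof.
move=> [_ Lw _ _] bk kC; rewrite -convolution_sub//.
by apply: norm_convolution_le => //; exact: L1_sub.
Qed.

Lemma nonlocal_bounded w k (T0 T : R) : L1_curve w -> bump k -> exists N,
  L1_bounded_on w T0 T N /\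
  L1_bounded_on (fun t x => w t x * convolution (w t) k x) T0 T N.
Proof.
move=> cw bk; have [N N0 wN] := curve_norm_bounded T0 T cw.
have [C C0 VC] := curve_convolution_bounded T0 T cw bk.
case: (cw) => mw Lw _ _.
have mV := measurable_convolution mw (smooth_measurable (bump_smooth bk)).
exists (Num.max N (C * N)); split; split => //.
- move=> t tT; split; first exact: Lw.
  by rewrite le_max wN.
- exact: measurable_funM.
- move=> t tT.
  have mVt : measurable_fun setT (convolution (w t) k).
    exact: (smooth_measurable (smooth_convolution (Lw t) bk)).
  split; first exact: (L1_mul_bnd (Lw t) mVt (VC t tT)).
  rewrite le_max; apply/orP; right.
  apply: (@le_trans _ _ (C * \int[mu]_x `|w t x|)); last by rewrite ler_wpM2l// wN.
  rewrite -integral_scale; last exact: L1_norm.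
  apply: integral_le.
  + exact: L1_norm (L1_mul_bnd (Lw t) mVt (VC t tT)).
  + by apply: L1_scale; exact: L1_norm.
  + by move=> x; rewrite normrM mulrC ler_wpM2r// VC.
Qed.

Lemma nonlocal_weak_eq k (u0 : R -> R) u (T : R) th ze : bump k -> nonlocal_solution k u0 u ->
  smooth th -> (exists a b : R, [/\ 0 < a, b < T & supported_in th a b]) -> bump ze ->
  \int[(mu \x mu)%E]_z (extend u z.1 z.2 * (derive1 th z.1 * ze z.2) +
     extend u z.1 z.2 * convolution (extend u z.1) k z.2 * (th z.1 * derive1 ze z.2)) = 0.
Proof.
move=> bk [su _ eu] sth [a [b [a0 bT thab]]] bze.
have sze := bump_smooth bze.
rewrite -(eu _ (test_function_tensor a0 sth thab bze)).
rewrite half_plane_integralE; last first.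
  move=> z z0; rewrite dt_tensor// dx_tensor//.
  by have [-> ->] := supported_nonpos a0 thab z0; rewrite !mul0r !mulr0 addr0.
apply: eq_Rintegral => z _; rewrite dt_tensor// dx_tensor//.
have [z0|z0] := leP z.1 0.
  by have [-> ->] := supported_nonpos a0 thab z0; rewrite !mul0r !mulr0.
by rewrite extendE ?(ltW z0).
Qed.

(** The equation is tested without sign condition, hence the class [setT]: the inequality can later
    be used for [psi] and for [-psi]. The condition [0 <= T0] keeps the time factors inside positive
    times. *)
Lemma nonlocal_weak_ineq k (u0 : R -> R) u (T0 T : R) : 0 <= T0 -> bump k ->
  nonlocal_solution k u0 u ->
  weak_ineq setT (extend u) (fun t x => extend u t x * convolution (extend u t) k x) T0 T.
Proof.
move=> T00 bk nu th ze sth th0 [a [b [a0 bT thab]]] bze _.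
rewrite (nonlocal_weak_eq bk nu sth (T := T))//; exists a, b; split => //.
exact: le_lt_trans a0.
Qed.

Lemma continuous_curve_integral w psi C : L1_curve w -> measurable_fun setT psi ->
  (forall x, `|psi x| <= C) -> continuous (fun t => \int[mu]_x (w t x * psi x)).
Proof.
move=> cw mpsi psiC.
have mid : measurable_fun setT (fun v : R => v) by exact: measurable_id.
have lid (v v' : R) : `|v - v'| <= `|v - v'| by [].
exact: (continuous_curve_lipschitz cw mid erefl lid mpsi psiC).2.
Qed.

(** The Landau form of the derivative. Its closed inequality survives a limit in an auxiliary index,
    which difference quotients of mollified quantities will undergo. *)
Lemma is_derive_dist f (t L : R) :
  (forall e : R, 0 < e -> exists2 d : R, 0 < d &
    forall s, `|t - s| < d -> `|f s - f t - L * (s - t)| <= e * `|s - t|) ->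
  isd f t L.
Proof.
move=> H.
have c : h^-1 *: (f (h + t) - f t) @[h --> 0^'] --> L.
  apply/cvgrPdist_le => e e0; have [d d0 hd] := H e e0.
  near=> h.
  have h0 : h != 0 by near: h; exact: nbhs_dnbhs_neq.
  have hd0 : `|h| < d by near: h; exact: dnbhs0_lt.
  have := hd (h + t); rewrite opprD addrCA subrr addr0 normrN => /(_ hd0).
  rewrite addrK => hh; rewrite distrC.
  have -> : h^-1 *: (f (h + t) - f t) - L = h^-1 * (f (h + t) - f t - L * h).
    by rewrite mulrBr [X in _ = _ - X]mulrCA mulVf// mulr1.
  by rewrite normrM normfV mulrC ler_pdivrMr// normr_gt0.
apply: DeriveDef.
  apply/cvg_ex; exists L; move: c; apply: cvg_trans.
  by apply: near_eq_cvg; apply: nearW => h /=; rewrite scaler1.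
by rewrite -derive1E /derive1; exact: cvg_lim c.
Unshelve. all: by end_near. Qed.

Lemma dist_itv (a b e : R) : `|a - b| < e -> a - e <= b <= a + e.
Proof. by rewrite ltr_norml => /andP[h1 h2]; apply/andP; split; lra. Qed.

Lemma rate_norm_le (x y e L s t : R) : t <= s ->
  (L - e) * (s - t) <= x - y <= (L + e) * (s - t) ->
  `|x - y - L * (s - t)| <= e * (s - t).
Proof.
move=> ts /andP[h1 h2]; rewrite ler_norml.
by move: h1 h2; rewrite !mulrDl mulNr; set p := L * _; set q := e * _ => h1 h2;
  apply/andP; split; lra.
Qed.

(** * Moments of a nonlocal solution and their time derivatives *)

Section Rate.
Context (k u0 : R -> R) (u : R -> R -> R) (rho : R -> R).
Context (bk : bump k) (nu : nonlocal_solution k u0 u) (mrho : mollifier rho).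
Local Notation w := (extend u).
Local Notation V := (fun t => convolution (w t) k).

Lemma nonlocal_curve : L1_curve w.
Proof. by case: nu => su _ _; exact: solution_curve. Qed.

Lemma nonlocal_L1 t : L1 mu (w t).
Proof. by case: nonlocal_curve. Qed.

Definition moment psi (t : R) := \int[mu]_x (w t x * psi x).
Definition moment_rate psi (t : R) := \int[mu]_x (w t x * V t x * derive1 psi x).

Lemma L1_flux t : L1 mu (fun x => w t x * V t x).
Proof.
have [N [_ [_ HQ]]] := nonlocal_bounded t t nonlocal_curve bk.
by have [] := HQ t; rewrite ?lexx.
Qed.

Lemma moment_le psi C c (T0 T s1 s2 : R) : 0 <= T0 -> smooth psi ->
  (forall x, `|psi x| <= C) -> (forall x, `|derive1 psi x| <= C) ->
  T0 < s1 -> s1 <= s2 -> s2 < T ->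
  (forall t, T0 <= t <= T -> moment_rate psi t <= c) ->
  moment psi s2 - moment psi s1 <= c * (s2 - s1).
Proof.
move=> T00 sp pC dpC h1 h12 h2 bc.
have [N [HF HQ]] := nonlocal_bounded T0 T nonlocal_curve bk.
have W := nonlocal_weak_ineq (T := T) T00 bk nu.
have ca := continuous_curve_integral nonlocal_curve (smooth_measurable sp) pC.
exact: (weak_ineq_le mrho HF HQ W sp (fun=> Logic.I) pC dpC h1 h12 h2 (ca _) (ca _) bc).
Qed.

Lemma moment_rate_dist psi C c1 c2 (T0 T s1 s2 : R) : 0 <= T0 -> smooth psi ->
  (forall x, `|psi x| <= C) -> (forall x, `|derive1 psi x| <= C) ->
  T0 < s1 -> s1 <= s2 -> s2 < T ->
  (forall t, T0 <= t <= T -> c1 <= moment_rate psi t <= c2) ->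
  c1 * (s2 - s1) <= moment psi s2 - moment psi s1 <= c2 * (s2 - s1).
Proof.
move=> T00 sp pC dpC h1 h12 h2 bc.
have mp := smooth_measurable sp; have mdp := smooth_measurable (smooth_derive1 sp).
(* The one-sided estimate [moment_le] applied to [-psi] supplies the lower bound. *)
pose q x := -1 * psi x; have sq : smooth q by exact: smooth_scale.
have dq x : derive1 q x = -1 * derive1 psi x.
  by apply: is_derive_derive1; apply: is_derive_scale; exact: smooth_is_derive.
have nq x : `|q x| <= C by rewrite normrM normrN1 mul1r.
have ndq x : `|derive1 q x| <= C by rewrite dq normrM normrN1 mul1r.
have Eq t : moment q t = -1 * moment psi t.
  rewrite -integral_scale; last exact: (L1_mul_bnd (nonlocal_L1 t) mp pC).
  by apply: eq_Rintegral => x _; rewrite mulrCA.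
have Er t : moment_rate q t = -1 * moment_rate psi t.
  rewrite -integral_scale; last exact: (L1_mul_bnd (L1_flux t) mdp dpC).
  by apply: eq_Rintegral => x _; rewrite dq mulrCA.
have bc2 t : T0 <= t <= T -> moment_rate psi t <= c2 by move=> /bc/andP[].
have bc1 t : T0 <= t <= T -> moment_rate q t <= -1 * c1.
  by move=> /bc/andP[h _]; rewrite Er !mulN1r lerN2.
have := moment_le T00 sq nq ndq h1 h12 h2 bc1.
rewrite !Eq -mulrBr -mulrA !mulN1r lerN2 => ->.
exact: moment_le T00 sp pC dpC h1 h12 h2 bc2.
Qed.

Lemma mass_conserved s1 s2 : 0 < s1 -> s1 <= s2 -> \int[mu]_x w s2 x = \int[mu]_x w s1 x.
Proof.
move=> s10 s12; have n1 (x : R) : `|1 : R| <= 1 by rewrite normr1.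
have d1 x : `|derive1 (fun _ : R => 1 : R) x| <= 1 by rewrite derive1_one normr0.
have b0 t : 0 <= t <= s2 + 1 -> 0 <= moment_rate (fun=> 1) t <= 0.
  rewrite /moment_rate; under eq_Rintegral do rewrite derive1_one mulr0.
  by rewrite /Rintegral integral0 lexx.
have E t : moment (fun=> 1) t = \int[mu]_x w t x.
  by apply: eq_Rintegral => x _; rewrite mulr1.
have s2T : s2 < s2 + 1 by rewrite ltrDl.
have := moment_rate_dist (lexx 0) (@smooth_one R) n1 d1 s10 s12 s2T b0.
by rewrite !E mul0r -eq_le eq_sym subr_eq0 => /eqP.
Qed.

Lemma mass_initial t : 0 <= t -> I (w t) = I (w 0).
Proof.
rewrite le_eqVlt => /orP[/eqP <-//|t0].
have n1 (x : R) : `|1 : R| <= 1 by rewrite normr1.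
have ca := continuous_curve_integral nonlocal_curve (smooth_measurable (@smooth_one R)) n1.
have E r : \int[mu]_x (w r x * 1) = I (w r).
  by apply: eq_Rintegral => x _; rewrite mulr1.
have E' : (fun t => \int[mu]_x (w t x * 1)) = fun t => I (w t) by apply/funext.
rewrite E' in ca; apply/eqP; rewrite eq_le; apply/andP; split.
  apply: (continuous_right0 ca t0) => s s0 st.
  by rewrite (mass_conserved s0 (ltW st)).
rewrite -lerN2; apply: (continuous_right0 (f := fun t => - I (w t)) _ t0).
  by move=> s; apply: cvgN; exact: ca.
by move=> s s0 st; rewrite (mass_conserved s0 (ltW st)).
Qed.

Lemma continuous_moment_rate psi C : smooth psi ->
  (forall x, `|derive1 psi x| <= C) -> continuous (moment_rate psi).
Proof.
move=> sp dpC t; have cw := nonlocal_curve.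
have C0 : 0 <= C by exact: le_trans (dpC 0).
have mdp := smooth_measurable (smooth_derive1 sp).
have [N N0 wN] := curve_norm_bounded (t - 1) (t + 1) cw.
have [K kK] := bump_bounded bk; have K0 : 0 <= K by exact: le_trans (kK 0).
have tt : t - 1 <= t <= t + 1 by apply/andP; split; lra.
have LB s := L1_mul_bnd (L1_flux s) mdp dpC.
apply/cvgrPdist_lt => e e0.
have D0 : 0 < C * (K * N + K * N) + 1.
  by rewrite ltr_wpDl// mulr_ge0// addr_ge0// mulr_ge0.
have e1 : 0 < e / (C * (K * N + K * N) + 1) by rewrite divr_gt0.
have [_ Lw cc _] := cw; have [d d0 hd] := cc t _ e1.
exists (Num.min d 1); first by rewrite /= lt_min d0 ltr01.
move=> s /=; rewrite /ball_ /= lt_min => /andP[sd s1].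
have st : t - 1 <= s <= t + 1.
  by move: s1; rewrite ltr_norml => /andP[h1 h2]; apply/andP; split; lra.
have Lst := L1_sub (Lw s) (Lw t).
rewrite distrC; apply: le_lt_trans (integral_norm_sub (LB s) (LB t)) _.
have VK r x : t - 1 <= r <= t + 1 -> `|V r x| <= K * N.
  move=> rt; apply: le_trans (norm_convolution_le x (Lw r) bk kK) _.
  by rewrite ler_wpM2l// wN.
set D := \int[mu]_x `|w s x - w t x|.
have hD : D < e / (C * (K * N + K * N) + 1) by exact: hd.
have D_ge0 : 0 <= D by exact: Rintegral_ge0.
have L1a := L1_scale (C * (K * N)) (L1_norm Lst).
have L1b := L1_scale (C * (K * D)) (L1_norm (Lw t)).
apply: (@le_lt_trans _ _ (\int[mu]_x (C * (K * N) * `|w s x - w t x| +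
    C * (K * D) * `|w t x|))).
  apply: integral_le; [exact/L1_norm/L1_sub|exact: L1_add|].
  move=> x; rewrite -mulrBl normrM.
  (* The first increment meets the uniform bound K N of V; in the second, V itself varies by at most
     K times the L^1 distance [D]. Both terms are thus multiples of [D]. *)
  have -> : w s x * V s x - w t x * V t x =
    (w s x - w t x) * V s x + w t x * (V s x - V t x) by ring.
  apply: (@le_trans _ _ ((K * N * `|w s x - w t x| + K * D * `|w t x|) * C)).
    apply: ler_pM => //; apply: le_trans (ler_normD _ _) _; rewrite !normrM.
    apply: lerD; rewrite mulrC ler_wpM2r//; first exact: VK.
    exact: convolution_curve_dist.
  by rewrite le_eqVlt; apply/orP; left; apply/eqP; ring.
rewrite integral_add// integral_scale; last exact: L1_norm.
rewrite integral_scale; last exact: L1_norm.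
rewrite -/D; have wtN := wN t tt.
move: hD; rewrite ltr_pdivlMr// => hD.
apply: le_lt_trans hD.
have h1 : C * (K * D) * \int[mu]_x `|w t x| <= C * (K * D) * N.
  by rewrite ler_wpM2l// mulr_ge0// mulr_ge0.
have h2 : 0 <= C * (K * D) * N by rewrite !mulr_ge0.
apply: (@le_trans _ _ (C * (K * N) * D + C * (K * D) * N)); first by rewrite lerD2l.
by rewrite mulrDr mulr1 mulrDr [leRHS](_ : _ = C * (K * N) * D + C * (K * D) * N + D) ?lerDl//; ring.
Qed.

(** The rate is continuous, so near [t] it stays within e of its value there, and [moment_rate_dist]
    transfers this to the increments. The neighbourhood is kept inside positive times, the only ones
    the weak formulation sees. *)
Lemma is_derive_moment psi C t : smooth psi -> (forall x, `|psi x| <= C) ->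
  (forall x, `|derive1 psi x| <= C) -> 0 < t -> isd (moment psi) t (moment_rate psi t).
Proof.
move=> sp pC dpC t0; have cb := continuous_moment_rate sp dpC.
apply: is_derive_dist => e e0; have [d d0 hd] := continuous_dist (cb t) e0.
have [d' [d'0 d'd d't]] := exists_below d0 t0.
exists d' => // s sd.
have rate r : t - d' <= r <= t + d' ->
    moment_rate psi t - e <= moment_rate psi r <= moment_rate psi t + e.
  move=> /andP[r1 r2].
  have rd : `|t - r| < d by apply: le_lt_trans d'd; rewrite ler_norml; apply/andP; split; lra.
  exact: dist_itv (hd r rd).
have T0 : 0 <= t - d' by rewrite subr_ge0 ltW.
move: sd; rewrite ltr_norml => /andP[sd1 sd2].
set L := moment_rate psi t in rate *.
have [st|st] := leP s t.
  have h1 : t - d' < s by lra.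
  have h2 : t < t + d' by rewrite ltrDl.
  have := rate_norm_le st (moment_rate_dist T0 sp pC dpC h1 st h2 rate).
  rewrite [`|s - t|]distrC [`|t - s|]ger0_norm ?subr_ge0//; apply: le_trans.
  by rewrite -normrN le_eqVlt; apply/orP; left; apply/eqP; congr `|_|; ring.
have h1 : t - d' < t by rewrite gtrBl.
have h2 : s < t + d' by lra.
have := rate_norm_le (ltW st) (moment_rate_dist T0 sp pC dpC h1 (ltW st) h2 rate).
by rewrite [`|s - t|]gtr0_norm ?subr_gt0.
Qed.

Lemma moment_lipschitz psi C c (T s1 s2 : R) : smooth psi ->
  (forall x, `|psi x| <= C) -> (forall x, `|derive1 psi x| <= C) ->
  0 < s1 -> 0 < s2 -> s1 < T -> s2 < T ->
  (forall t, 0 <= t <= T -> `|moment_rate psi t| <= c) ->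
  `|moment psi s2 - moment psi s1| <= c * `|s2 - s1|.
Proof.
move=> sp pC dpC + + + + bc.
wlog s12 : s1 s2 / s1 <= s2.
  move=> H h1 h2 h3 h4; have [h|/ltW h] := leP s1 s2; first exact: H.
  by rewrite distrC [`|s2 - s1|]distrC; exact: H.
move=> h1 _ _ h2.
have rate t : 0 <= t <= T -> - c <= moment_rate psi t <= c.
  by move=> tT; rewrite -ler_norml bc.
have := moment_rate_dist (lexx 0) sp pC dpC h1 s12 h2 rate.
by rewrite mulNr -ler_norml (ger0_norm (x := s2 - s1))// subr_ge0.
Qed.

End Rate.
End NonlocalSide.

(** * Renormalisation *)

Section Renormalisation.
Context {R : realType}.
Local Notation mu := (@lebesgue_measure R).
Local Notation isd f x df := (is_derive (x : R) (1 : R) (f : R -> R) (df : R)).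
Implicit Types (f g phi psi k q b V : R -> R) (u w : R -> R -> R) (lo hi M B : R).

Lemma lipschitz_on f (df : R -> R) lo hi C :
  (forall v, lo <= v <= hi -> isd f v (df v)) ->
  (forall v, lo <= v <= hi -> `|df v| <= C) ->
  forall v v', lo <= v <= hi -> lo <= v' <= hi -> `|f v - f v'| <= C * `|v - v'|.
Proof.
move=> fdf dfC; suff H v v' : lo <= v <= hi -> lo <= v' <= hi -> v' <= v ->
    `|f v - f v'| <= C * `|v - v'|.
  move=> v v' hv hv'; have [vv|/ltW vv] := leP v' v; first exact: H.
  by rewrite distrC [`|v - v'|]distrC; exact: H.
move=> /andP[lv vh] /andP[lv' vh'] vv.
have D x : x \in `[v', v] -> isd f x (df x).
  rewrite in_itv/= => /andP[h1 h2]; apply: fdf.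
  by rewrite (le_trans lv' h1) (le_trans h2 vh).
have D' x : x \in `]v', v[ -> isd f x (df x).
  by rewrite in_itv/= => /andP[h1 h2]; apply: D; rewrite in_itv/= !ltW.
have cf : {within `[v', v], continuous f}.
  apply: derivable_within_continuous => x xv.
  exact: is_derive_derivable (D x xv).
have [c cv ->] := MVT_segment vv D' cf.
rewrite normrM ler_wpM2r// dfC//.
by move: cv; rewrite in_itv/= => /andP[h1 h2]; rewrite (le_trans lv' h1) (le_trans h2 vh).
Qed.

(** Regularity is requested only on an interval containing 0 and the values of the solution, since
    the logarithmic entropy is singular to its left. The conditions b(0) = b'(0) = 0 give bounds
    linear in |v| for [b], [b1] and v b' - b, hence integrability on the whole line. *)
Record C2_on lo hi M B b b1 b2 : Prop := {
  C2_range0 : lo <= 0 <= hi;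
  C2_range : forall v, lo <= v <= hi -> `|v| <= M;
  C2_derive : forall v, lo <= v <= hi -> isd b v (b1 v);
  C2_derive2 : forall v, lo <= v <= hi -> isd b1 v (b2 v);
  C2_bound : forall v, lo <= v <= hi -> `|b2 v| <= B;
  C2_continuous : forall v, lo <= v <= hi -> {for v, continuous b2};
  C2_measurable : measurable_fun setT b;
  C2_measurable1 : measurable_fun setT b1;
  C2_at0 : b 0 = 0;
  C2_derive_at0 : b1 0 = 0 }.

(** * Estimates for a C^2 function and renormalisation at a fixed time *)

Section C2.
Context (lo hi M B : R) (b b1 b2 : R -> R) (H : C2_on lo hi M B b b1 b2).
Local Notation inr v := (lo <= v <= hi).

(** The Legendre transform of b at b'(v), for convex b. It has derivative v b''(v) and is the
    density multiplying V_x in the renormalised equation. *)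
Definition legendre (v : R) := v * b1 v - b v.

Lemma C2_B0 : 0 <= B.
Proof. exact: le_trans (C2_bound H (C2_range0 H)). Qed.

Lemma C2_M0 : 0 <= M.
Proof. exact: le_trans (C2_range H (C2_range0 H)). Qed.

Lemma C2_lipschitz1 v v' : inr v -> inr v' -> `|b1 v - b1 v'| <= B * `|v - v'|.
Proof. exact: lipschitz_on (C2_derive2 H) (C2_bound H) v v'. Qed.

Lemma C2_le1 v : inr v -> `|b1 v| <= B * `|v|.
Proof.
by move=> hv; have := C2_lipschitz1 hv (C2_range0 H); rewrite (C2_derive_at0 H) !subr0.
Qed.

Lemma C2_lipschitz v v' : inr v -> inr v' -> `|b v - b v'| <= B * M * `|v - v'|.
Proof.
apply: (lipschitz_on (C2_derive H)) => x hx; apply: le_trans (C2_le1 hx) _.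
by rewrite ler_wpM2l ?C2_B0// (C2_range H).
Qed.

Lemma C2_le v : inr v -> `|b v| <= B * M * `|v|.
Proof.
by move=> hv; have := C2_lipschitz hv (C2_range0 H); rewrite (C2_at0 H) !subr0.
Qed.

(** The Lipschitz bound is applied to b(x) - b'(v') x on the segment between the two points, where
    its derivative is at most B |v - v'|. *)
Lemma C2_taylor v v' : inr v -> inr v' ->
  `|b v - b v' - b1 v' * (v - v')| <= B * `|v - v'| * `|v - v'|.
Proof.
move=> hv hv'; pose l := Num.min v v'; pose r := Num.max v v'.
have lr x : l <= x <= r -> inr x.
  move=> /andP[h1 h2]; case/andP: hv => a1 a2; case/andP: hv' => a3 a4.
  have h3 : lo <= l by rewrite le_min a1.
  have h4 : r <= hi by rewrite ge_max a2.
  by rewrite (le_trans h3 h1) (le_trans h2 h4).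
have D x : l <= x <= r -> isd (fun x => b x - b1 v' * x) x (b1 x - b1 v').
  move=> hx; apply: is_derive_sub; first exact: (C2_derive H (lr _ hx)).
  by rewrite -[X in isd _ _ X]mulr1; apply: is_derive_scale; exact: is_derive_id.
have C x : l <= x <= r -> `|b1 x - b1 v'| <= B * `|v - v'|.
  move=> hx; apply: le_trans (C2_lipschitz1 (lr _ hx) hv') _.
  rewrite ler_wpM2l ?C2_B0//.
  move: hx; rewrite /l /r; case: (leP v v') => vv /andP[h1 h2].
    by rewrite !ler0_norm ?subr_le0// lerN2 lerB.
  by rewrite !ger0_norm ?subr_ge0 ?(ltW vv)// lerB.
have hl : l <= v <= r by rewrite ge_min lexx/= le_max lexx.
have hr : l <= v' <= r by rewrite ge_min lexx orbT/= le_max lexx orbT.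
have := lipschitz_on D C hl hr.
by rewrite (_ : b v - b1 v' * v - (b v' - b1 v' * v') = b v - b v' - b1 v' * (v - v')); last by ring.
Qed.

Lemma is_derive_legendre v : inr v -> isd legendre v (v * b2 v).
Proof.
move=> hv; rewrite (_ : v * b2 v = v * b2 v + b1 v * 1 - b1 v); last by ring.
exact: (is_derive_sub (is_derive_mul (is_derive_id v 1) (C2_derive2 H hv))
  (C2_derive H hv)).
Qed.

Lemma legendre_lipschitz v v' : inr v -> inr v' ->
  `|legendre v - legendre v'| <= M * B * `|v - v'|.
Proof.
apply: (lipschitz_on (df := fun v => v * b2 v)); first exact: is_derive_legendre.
by move=> x hx; rewrite normrM; apply: ler_pM => //; [exact: (C2_range H)|exact: (C2_bound H)].
Qed.

Lemma legendre_le v : inr v -> `|legendre v| <= M * B * `|v|.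
Proof.
move=> hv; have := legendre_lipschitz hv (C2_range0 H).
by rewrite {2}/legendre mul0r (C2_at0 H) !subr0.
Qed.

Lemma measurable_legendre : measurable_fun setT legendre.
Proof.
apply: measurable_funB; last exact: (C2_measurable H).
by apply: measurable_funM; [exact: measurable_id|exact: (C2_measurable1 H)].
Qed.

Lemma L1_comp_le phi f C : measurable_fun setT phi -> L1 mu f ->
  {ae mu, forall x, inr (f x)} -> (forall v, inr v -> `|phi v| <= C * `|v|) ->
  L1 mu (fun x => phi (f x)).
Proof.
move=> mphi Lf rf phiC.
have LC : L1 mu (fun x => C * `|f x|) by apply: L1_scale; exact: L1_norm.
apply: L1_ae_le LC; first exact: (measurableT_comp mphi (L1_measurable Lf)).
by apply: ae_imp rf => x; exact: phiC.
Qed.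

Lemma L1_C2_comp f : L1 mu f -> {ae mu, forall x, inr (f x)} -> L1 mu (fun x => b (f x)).
Proof. by move=> Lf rf; exact: L1_comp_le (C2_measurable H) Lf rf C2_le. Qed.

Lemma C2_integral_dist f g : L1 mu f -> {ae mu, forall x, inr (f x)} ->
  L1 mu g -> {ae mu, forall x, inr (g x)} ->
  `|\int[mu]_x b (f x) - \int[mu]_x b (g x)| <= B * M * \int[mu]_x `|f x - g x|.
Proof.
move=> Lf rf Lg rg; have LF := L1_C2_comp Lf rf; have LG := L1_C2_comp Lg rg.
apply: le_trans (integral_norm_sub LF LG) _; have LD := L1_norm (L1_sub Lf Lg).
rewrite -integral_scale//; apply: integral_ae_le; [exact/L1_norm/L1_sub|exact: L1_scale|].
by apply: (ae_imp2 _ rf rg) => x; exact: C2_lipschitz.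
Qed.

(** The commutator is the integral of f(y) (V(y) - V(x)) q(x - y), and |x - y| < d on the support of
    [q]. A Lipschitz velocity makes it small at every point, without any derivative of [q]. *)
Lemma commutator_le f V q l d x : L1 mu f -> {ae mu, forall x, inr (f x)} ->
  mollifier q -> (forall x, d <= `|x| -> q x = 0) -> 0 <= d ->
  measurable_fun setT V -> (exists K, forall x, `|V x| <= K) -> 0 <= l ->
  (forall x y, `|V x - V y| <= l * `|x - y|) ->
  `|convolution (fun y => f y * V y) q x - V x * convolution f q x| <= M * l * d.
Proof.
move=> Lf rf mq qd d0 mV [K VK] l0 Vl; have [bq q0 _ _] := mq.
have LfV : L1 mu (fun y => f y * V y) by exact: (L1_mul_bnd Lf mV VK).
have La := L1_conv_integrand x LfV bq.
have Lb := L1_scale (V x) (L1_conv_integrand x Lf bq).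
have Lq := bump_L1 (bump_reflect x bq).
rewrite -(integral_scale (V x)); last exact: L1_conv_integrand.
rewrite -integral_sub//; apply: le_trans (integral_norm_le (L1_sub La Lb)) _.
rewrite -[leRHS]mulr1 -(integral_mollifier_reflect x mq) -integral_scale//.
apply: integral_ae_le; [exact/L1_norm/L1_sub|exact: L1_scale|].
apply: ae_imp rf => y fy.
rewrite (_ : f y * V y * q (x - y) - V x * (f y * q (x - y)) =
  (f y * (V y - V x)) * q (x - y)); last by ring.
rewrite normrM [`|q _|]ger0_norm//; have [dxy|xyd] := leP d `|x - y|.
  by rewrite qd// !mulr0.
rewrite ler_wpM2r// normrM -mulrA; apply: ler_pM => //; first exact: (C2_range H).
by apply: le_trans (Vl _ _) _; rewrite distrC ler_wpM2l// ltW.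
Qed.

Section FixedTime.
Context (f V q : R -> R) (l d K : R).
Context (Lf : L1 mu f) (rf : {ae mu, forall x, inr (f x)}) (mq : mollifier q)
  (qd : forall x, d <= `|x| -> q x = 0) (d0 : 0 <= d) (sV : smooth V)
  (VK : forall x, `|V x| <= K) (Vl : forall x, `|derive1 V x| <= l).

Let bq : bump q. Proof. by case: mq. Qed.
Let fq := convolution f q.
Let fq' := convolution f (derive1 q).

Lemma mollified_range x : inr (fq x).
Proof.
apply/andP; split; first by apply: convolution_ge => //; apply: ae_imp rf => y /andP[].
by apply: convolution_le => //; apply: ae_imp rf => y /andP[].
Qed.

Lemma is_derive_mollified x : isd fq x (fq' x).
Proof. exact: is_derive_convolution. Qed.

Lemma continuous_mollified : continuous fq.
Proof. exact/smooth_continuous/smooth_convolution. Qed.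

Lemma continuous_mollified' : continuous fq'.
Proof. exact: (smooth_continuous (smooth_convolution Lf (bump_derive bq))). Qed.

Lemma L1_mollified : L1 mu fq.
Proof. exact: (young Lf bq).1. Qed.

Lemma L1_mollified' : L1 mu fq'.
Proof. exact: (young Lf (bump_derive bq)).1. Qed.

Lemma L1_of_le phi g C : continuous phi -> L1 mu g ->
  (forall x, `|phi x| <= C * `|g x|) -> L1 mu phi.
Proof.
move=> cphi Lg le; have LC : L1 mu (fun x => C * `|g x|) by apply: L1_scale; exact: L1_norm.
by apply: L1_le LC => //; exact: continuous_measurable.
Qed.

Let p x := b1 (fq x).
Let dp x := b2 (fq x) * fq' x.

Lemma is_derive_p x : isd p x (dp x).
Proof. exact: (is_derive_comp (C2_derive2 H (mollified_range x)) (is_derive_mollified x)). Qed.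

Lemma continuous_b2 : continuous (fun x => b2 (fq x)).
Proof.
move=> x; apply: (continuous_comp (f := fq) (g := b2)); first exact: continuous_mollified.
exact: (C2_continuous H (mollified_range x)).
Qed.

Lemma continuous_dp : continuous dp.
Proof.
by move=> x; apply: cvgM; [exact: continuous_b2|exact: continuous_mollified'].
Qed.

Lemma continuous_p : continuous p.
Proof. by move=> x; exact: is_derive_continuous (is_derive_p x). Qed.

Lemma L1_p : L1 mu p.
Proof.
apply: (L1_of_le (C := B) continuous_p L1_mollified) => x.
exact: C2_le1 (mollified_range x).
Qed.

Lemma dp_le x : `|dp x| <= B * `|fq' x|.
Proof. by rewrite normrM ler_wpM2r// (C2_bound H (mollified_range x)). Qed.

Lemma L1_dp : L1 mu dp.
Proof. exact: (L1_of_le (C := B) continuous_dp L1_mollified' dp_le). Qed.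

(** The test function b'(f_q) * q is smoothed once more so that duality can move the outer [q] onto
    the flux; this requires the derivative to sit on the inner factor. *)
Lemma derive1_test : derive1 (convolution p q) = convolution dp q.
Proof.
rewrite derive1_convolution//; last exact: L1_p.
exact: (convolution_derive_swap mq bq is_derive_p continuous_dp L1_p L1_dp).
Qed.

(** As [legendre] has derivative v b''(v), the two integrands add up to the derivative of V
    legendre(f_q), whose integral over the line vanishes. *)
Lemma integral_transport : \int[mu]_x (dp x * (V x * fq x)) =
  - \int[mu]_x (derive1 V x * legendre (fq x)).
Proof.
have cV := smooth_continuous sV; have cV' := smooth_continuous (smooth_derive1 sV).
have Dg x : isd (fun x => legendre (fq x)) x (fq x * b2 (fq x) * fq' x).
  exact: (is_derive_comp (is_derive_legendre (mollified_range x)) (is_derive_mollified x)).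
have cg : continuous (fun x => legendre (fq x)).
  by move=> x; exact: is_derive_continuous (Dg x).
have K0 : 0 <= K by exact: le_trans (VK 0).
have l0 : 0 <= l by exact: le_trans (Vl 0).
have gle x := legendre_le (mollified_range x).
have L1a : L1 mu (fun x => V x * legendre (fq x)).
  apply: (L1_of_le (C := K * (M * B)) _ L1_mollified).
    by move=> x; apply: cvgM; [exact: cV|exact: cg].
  by move=> x; rewrite normrM -mulrA; exact: ler_pM.
have L1b : L1 mu (fun x => derive1 V x * legendre (fq x)).
  apply: (L1_of_le (C := l * (M * B)) _ L1_mollified).
    by move=> x; apply: cvgM; [exact: cV'|exact: cg].
  by move=> x; rewrite normrM -mulrA; exact: ler_pM.
have cdp := continuous_dp.
have L1c : L1 mu (fun x => dp x * (V x * fq x)).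
  apply: (L1_of_le (C := K * M) _ L1_dp).
    move=> x; apply: cvgM; first exact: cdp.
    by apply: cvgM; [exact: cV|exact: continuous_mollified].
  move=> x; rewrite normrM mulrC ler_wpM2r// normrM; apply: ler_pM => //.
  exact: (C2_range H (mollified_range x)).
apply/eqP; rewrite -subr_eq0 opprK -integral_add//; apply/eqP.
apply: (@integral_derive_eq0 _ q (fun x => V x * legendre (fq x))) => //.
- move=> x; have := is_derive_mul (smooth_is_derive x sV) (Dg x).
  rewrite (_ : V x * (fq x * b2 (fq x) * fq' x) + legendre (fq x) * derive1 V x =
    dp x * (V x * fq x) + derive1 V x * legendre (fq x)); last by rewrite /dp; ring.
  by [].
- move=> x; apply: cvgD; apply: cvgM.
  + exact: cdp.
  + by apply: cvgM; [exact: cV|exact: continuous_mollified].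
  + exact: cV'.
  + exact: cg.
- exact: L1_add.
Qed.

(** Duality smooths the flux to (f V) * q. Replacing it by V f_q costs the commutator against
    b''(f_q) f_q', which is the first error term; the transport identity treats what remains, and
    returning from f_q to f in [legendre] costs the second. The factor [1] in front of [f x] matches
    the form of [integral_mollify]. *)
Lemma mollified_flux_le :
  `|\int[mu]_x (f x * V x * derive1 (convolution p q) x) +
    \int[mu]_x (derive1 V x * legendre (f x))| <=
  B * (M * l * d) * \int[mu]_x `|fq' x| +
  l * (M * B) * \int[mu]_x `|fq x - 1 * f x|.
Proof.
have l0 : 0 <= l by exact: le_trans (Vl 0).
have mV := smooth_measurable sV; have mV' := smooth_measurable (smooth_derive1 sV).
have LfV : L1 mu (fun x => f x * V x) := L1_mul_bnd Lf mV VK.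
have LV := lipschitz_derive sV Vl.
have comm x := commutator_le x Lf rf mq qd d0 mV (ex_intro _ K VK) l0 LV.
have cdp := continuous_dp.
have sfV := smooth_convolution LfV bq.
have L1a : L1 mu (fun x => dp x * convolution (fun y => f y * V y) q x).
  have [C hC] := bump_bounded bq.
  have C0 x := norm_convolution_le x LfV bq hC.
  exact: (L1_mul_bnd L1_dp (smooth_measurable sfV) C0).
have L1c : L1 mu (fun x => dp x * (V x * fq x)).
  apply: (L1_of_le (C := K * M) _ L1_dp).
    move=> x; apply: cvgM; first exact: cdp.
    by apply: cvgM; [exact: (smooth_continuous sV)|exact: continuous_mollified].
  move=> x; rewrite normrM mulrC ler_wpM2r// normrM; apply: ler_pM => //.
  exact: (C2_range H (mollified_range x)).
have qe : (fun z => q (- z)) = q by apply/funext => z; case: mq => _ _ -> _.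
have E1 : \int[mu]_x (f x * V x * derive1 (convolution p q) x) =
    \int[mu]_x (dp x * convolution (fun y => f y * V y) q x).
  rewrite derive1_test (convolution_dual LfV L1_dp bq).
  by rewrite qe.
have Lg : L1 mu (fun x => legendre (fq x)).
  apply: (L1_comp_le (C := M * B) measurable_legendre L1_mollified).
    by apply: ae_all; exact: mollified_range.
  exact: legendre_le.
have Lgf : L1 mu (fun x => legendre (f x)).
  exact: (L1_comp_le measurable_legendre Lf rf legendre_le).
have LVg : L1 mu (fun x => derive1 V x * legendre (fq x)).
  by under eq_fun do rewrite mulrC; exact: (L1_mul_bnd Lg mV' Vl).
have LVgf : L1 mu (fun x => derive1 V x * legendre (f x)).
  by under eq_fun do rewrite mulrC; exact: (L1_mul_bnd Lgf mV' Vl).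
have E2 := integral_transport.
rewrite E1 (_ : \int[mu]_x (dp x * convolution (fun y => f y * V y) q x) =
  \int[mu]_x (dp x * convolution (fun y => f y * V y) q x - dp x * (V x * fq x)) -
  \int[mu]_x (derive1 V x * legendre (fq x))); last first.
  by rewrite integral_sub// E2; ring.
rewrite -addrA [X in _ + X]addrC -integral_sub//.
apply: le_trans (ler_normD _ _) _; apply: lerD.
  apply: le_trans (integral_norm_le (L1_sub L1a L1c)) _.
  rewrite -integral_scale; last exact/L1_norm/L1_mollified'.
  apply: integral_le; first exact/L1_norm/L1_sub.
    by apply: L1_scale; apply: L1_norm; exact: L1_mollified'.
  move=> x; rewrite -mulrBr normrM -mulrA [leRHS]mulrA.
  rewrite (_ : B * (M * l * d) * _ = (B * `|fq' x|) * (M * l * d)); last by ring.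
  by apply: ler_pM => //; exact: dp_le.
apply: le_trans (integral_norm_le (L1_sub LVgf LVg)) _.
have Ld : L1 mu (fun x => fq x - 1 * f x).
  by apply: L1_sub; [exact: L1_mollified|exact: L1_scale].
rewrite -integral_scale; last exact: L1_norm.
apply: integral_ae_le; [exact/L1_norm/L1_sub|by apply: L1_scale; exact: L1_norm|].
apply: ae_imp rf => x fx; rewrite -mulrBr normrM -mulrA mul1r.
apply: ler_pM => //; rewrite distrC [`|fq x - _|]distrC distrC.
by have := legendre_lipschitz fx (mollified_range x); rewrite [`|f x - _|]distrC.
Qed.

End FixedTime.
End C2.
End Renormalisation.

(** * Time derivative of the entropy along a nonlocal solution *)

Section EntropyRate.
Context {R : realType}.
Local Notation mu := (@lebesgue_measure R).
Local Notation isd f x df := (is_derive (x : R) (1 : R) (f : R -> R) (df : R)).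
Implicit Types (f g phi psi q V : R -> R) (lo hi M B : R).

Lemma linear_error_le (g1 g2 g3 m x1 x1' x2 x2' D e : R) : g1 * x1 <= g1 * (x1' + m * D) ->
  g2 * x2 <= g2 * (x2' + 2 * D) -> g1 * x1' + g2 * x2' < e / 2 ->
  (g1 * m + g2 * 2 + g3) * D <= e / 2 -> g1 * x1 + g2 * x2 + g3 * D <= e.
Proof. lra. Qed.

Lemma rate_dist (f df : R -> R) (t d e L : R) :
  (forall x, `|t - x| < d -> `|df x - L| <= e) ->
  (forall x, `|t - x| < d -> isd f x (df x)) ->
  forall s, `|t - s| < d -> `|f s - f t - L * (s - t)| <= e * `|s - t|.
Proof.
move=> dfL fdf s sd.
have hx x : Num.min s t <= x <= Num.max s t -> `|t - x| < d.
  move: sd; rewrite !ltr_norml; case: (leP s t) => h /andP[h1 h2] /andP[h3 h4];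
    by apply/andP; split; lra.
have D x : Num.min s t <= x <= Num.max s t -> isd (fun x => f x - L * x) x (df x - L).
  move=> /hx xd; apply: is_derive_sub; first exact: fdf.
  by rewrite -[X in isd _ _ X]mulr1; apply: is_derive_scale; exact: is_derive_id.
have := lipschitz_on D (fun x hx' => dfL x (hx x hx')) (v := s) (v' := t).
rewrite !ge_min !le_max !lexx !orbT/= => /(_ isT isT); apply: le_trans.
by rewrite le_eqVlt; apply/orP; left; apply/eqP; congr `|_|; ring.
Qed.

Lemma dist_itv0 (t s T d : R) : `|t - s| < Num.min d (Num.min t (T - t)) ->
  [/\ `|t - s| < d, 0 < s & s < T].
Proof.
by rewrite !lt_min => /andP[-> /andP[]]; rewrite !ltr_norml => /andP[h1 h2] /andP[h3 h4];
  split => //; lra.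
Qed.

Lemma kernel_of_mass_mollifier rho : mollifier rho -> kernel_of_mass (1 : R) rho.
Proof.
move=> mrho; case: (mrho) => bk _ ke _; split => //; first by move=> x; rewrite ke.
by move=> e x e0; exact: integral_mollifier_reflect (mollifier_rescale e0 mrho).
Qed.

Lemma derive1_even (k : R -> R) x : smooth k -> (forall x : R, k (- x) = k x) ->
  derive1 k (- x) = - derive1 k x.
Proof.
move=> sk ke; have := derive1_reflect 0 x sk; rewrite sub0r.
rewrite (_ : (fun y => k (0 - y)) = k); first by move=> ->; rewrite opprK.
by apply/funext => y; rewrite sub0r ke.
Qed.

Lemma kernel_of_mass_derive rho : mollifier rho -> kernel_of_mass (0 : R) (derive1 rho).
Proof.
move=> mrho; case: (mrho) => bk _ ke _; have sk := bump_smooth bk; split.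
- exact: bump_derive.
- by move=> x; rewrite derive1_even// normrN.
- move=> e x e0; have bre := bump_rescale e0 bk.
  (* The function -e rho_e(x - y) is an antiderivative in y of the rescaled kernel, so the latter
     has zero integral. *)
  have bb := bump_scale (-1) (bump_scale e (bump_reflect x bre)).
  have [r br] : exists r : R, forall y, r <= `|y| -> -1 * (e * rescale rho e (x - y)) = 0.
    by case: bb.
  apply: (integral_derive_compact (f := fun y => -1 * (e * rescale rho e (x - y))) _ _ br).
    move=> y; rewrite (_ : rescale _ _ _ =
      -1 * (e * (- 1 * (e^-1 * (e^-1 * derive1 rho ((x - y) / e)))))); last first.
      by rewrite /rescale; field; rewrite gt_eqF.
    apply: is_derive_scale; apply: is_derive_scale.
    rewrite (_ : (fun y => _) = fun y => rescale rho e (-1 * y + x)); last first.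
      by apply/funext => z; congr rescale; ring.
    apply: is_derive_affine; apply: is_derive_scale.
    rewrite (_ : (fun y => _) = fun y => rho (e^-1 * y + 0)); last first.
      by apply/funext => z; congr rho; ring.
    apply: is_derive_affine.
    rewrite (_ : (x - y) / e = e^-1 * (-1 * y + x) + 0); last by ring.
    exact: smooth_is_derive.
  exact: smooth_continuous (bump_smooth (bump_reflect x (bump_rescale e0 (bump_derive bk)))).
Qed.

Lemma derive1_rescale (k : R -> R) e x : smooth k -> derive1 (rescale k e) x = e^-1 * rescale (derive1 k) e x.
Proof.
move=> sk; apply: is_derive_derive1; apply: is_derive_scale.
rewrite (_ : (fun y => _) = fun y => k (e^-1 * y + 0)); last first.
  by apply/funext => z; congr k; ring.
apply: is_derive_affine; rewrite (_ : x / e = e^-1 * x + 0); last by ring.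
exact: smooth_is_derive.
Qed.

Lemma convolution_scale f k c : L1 mu f -> bump k ->
  convolution f (fun x => c * k x) = fun x => c * convolution f k x.
Proof.
move=> Lf bk; apply/funext => x; rewrite -integral_scale; last exact: L1_conv_integrand.
by apply: eq_Rintegral => y _; ring.
Qed.

Context (k u0 : R -> R) (u : R -> R -> R) (rho : R -> R).
Context (bk : bump k) (nu : nonlocal_solution k u0 u) (mrho : mollifier rho).
Local Notation w := (extend u).
Local Notation V := (fun t => convolution (w t) k).
Let cw : L1_curve w := nonlocal_curve nu.
Let Lw t : L1 mu (w t) := nonlocal_L1 nu t.
Local Notation D s t := (\int[mu]_x `|w s x - w t x|).

Lemma curve_dist_ge0 s t : 0 <= D s t.
Proof. exact: Rintegral_ge0. Qed.

(** For fixed x the mollified solution is the moment against q(x - .), whose rate is bounded by the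
    sup of q' times the L^1 norm of the flux. Although w is merely continuous into L^1, its
    mollification is thus Lipschitz in time, uniformly in x. *)
Lemma mollified_lipschitz q T : mollifier q -> exists2 c : R, 0 <= c &
  forall s1 s2, 0 < s1 -> 0 < s2 -> s1 < T -> s2 < T -> forall x,
  `|convolution (w s2) q x - convolution (w s1) q x| <= c * `|s2 - s1|.
Proof.
move=> mq; have [bq _ _ _] := mq.
have [N [HF HQ]] := nonlocal_bounded 0 T cw bk.
have [C qC] := bump_bounded bq; have [C' qC'] := bump_bounded (bump_derive bq).
have C'0 : 0 <= C' by exact: le_trans (qC' 0).
have C0 : 0 <= C by exact: le_trans (qC 0).
exists (C' * `|N|); first by rewrite mulr_ge0.
move=> s1 s2 h1 h2 h3 h4 x.
have sq := bump_smooth (bump_reflect x bq).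
have dq y : derive1 (fun y => q (x - y)) y = - derive1 q (x - y).
  exact: (derive1_reflect x y (bump_smooth bq)).
have qC2 y : `|q (x - y)| <= Num.max C C' by rewrite le_max qC.
have dqC2 y : `|derive1 (fun y => q (x - y)) y| <= Num.max C C'.
  by rewrite dq normrN le_max qC' orbT.
apply: (moment_lipschitz bk nu mrho sq qC2 dqC2 h1 h2 h3 h4) => t tT.
case: HQ => _ /(_ t tT) [LQ QN].
have mdq := smooth_measurable (smooth_derive1 sq).
apply: le_trans (integral_norm_le (L1_mul_bnd LQ mdq dqC2)) _.
apply: (@le_trans _ _ (C' * \int[mu]_x `|w t x * V t x|)).
  rewrite -integral_scale; last exact: L1_norm.
  apply: integral_le.
  + exact: L1_norm (L1_mul_bnd LQ mdq dqC2).
  + by apply: L1_scale; exact: L1_norm.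
  + by move=> y; rewrite normrM mulrC ler_wpM2r// dq normrN.
by rewrite ler_wpM2l// (le_trans QN)// ler_norm.
Qed.

Context (T : R) (b b1 b2 : R -> R) (lo hi M B : R).
Context (H : C2_on lo hi M B b b1 b2).
Context (rw : forall t, t <= T -> {ae mu, forall x, lo <= w t x <= hi}).

(** The factor b'(w_q) is frozen at [t0], which leaves a moment with known derivative. The Taylor
    remainder is quadratic in the increment of w_q: one factor is O(|s - t0|) uniformly in x, the
    other tends to zero in L^1, so the whole is o(|s - t0|). *)
Lemma is_derive_mollified_entropy q t0 : mollifier q -> 0 < t0 -> t0 < T ->
  isd (fun t => \int[mu]_x b (convolution (w t) q x)) t0
    (moment_rate k u (convolution (fun x => b1 (convolution (w t0) q x)) q) t0).
Proof.
move=> mq t00 t0T; have [bq q0 qe qI] := mq.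
set p := fun x => b1 (convolution (w t0) q x); set P := convolution p q.
have rt0 := rw (ltW t0T).
have Lp : L1 mu p := L1_p H (Lw t0) rt0 mq.
have mp := L1_measurable Lp.
have sP : smooth P := smooth_convolution Lp bq.
have [C qC] := bump_bounded bq; have [C' qC'] := bump_bounded (bump_derive bq).
have PC x : `|P x| <= Num.max (C * \int[mu]_y `|p y|) (C' * \int[mu]_y `|p y|).
  by rewrite le_max norm_convolution_le.
have dPC x : `|derive1 P x| <= Num.max (C * \int[mu]_y `|p y|) (C' * \int[mu]_y `|p y|).
  by rewrite (derive1_convolution Lp bq) le_max (norm_convolution_le _ Lp (bump_derive bq) qC') orbT.
have DP := is_derive_moment bk nu mrho sP PC dPC t00.
have [c c0 hc] := mollified_lipschitz T mq.
have B0 := C2_B0 H.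
(* By duality with the even [q], the moment of [P] integrates [p] against the mollified solution, so
   subtracting it leaves b minus its linearisation at time [t0]. *)
suff DE : isd (fun t => \int[mu]_x b (convolution (w t) q x) - moment u P t) t0 0.
  rewrite (_ : (fun t => _) = fun t => (\int[mu]_x b (convolution (w t) q x) - moment u P t) +
    moment u P t); last by apply/funext => t; rewrite subrK.
  by rewrite -[X in isd _ _ X]add0r; exact: is_derive_add.
apply: is_derive_dist => e e0.
have e1 : 0 < e / (B * c + 1) by rewrite divr_gt0// ltr_wpDl// mulr_ge0.
have [_ _ cc _] := cw; have [d d0 hd] := cc t0 _ e1.
pose d' := Num.min d (Num.min t0 (T - t0)).
have d'0 : 0 < d' by rewrite !lt_min d0 t00 subr_gt0.
exists d' => // s /dist_itv0[sd s0 sT'].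
have rs := rw (ltW sT').
have Ls := (young (Lw s) bq).1; have Lt := (young (Lw t0) bq).1.
have ms := L1_measurable Ls.
have rgs := mollified_range (Lw s) rs mq; have rgt := mollified_range (Lw t0) rt0 mq.
have Lb r : r <= T -> L1 mu (fun x => b (convolution (w r) q x)).
  move=> rT; apply: (L1_C2_comp H (young (Lw r) bq).1).
  by apply: ae_all; exact: mollified_range (rw rT) mq.
have Lbs := Lb s (ltW sT'); have Lbt := Lb t0 (ltW t0T).
have EP r : moment u P r = \int[mu]_x (p x * convolution (w r) q x).
  rewrite (convolution_dual Lp (Lw r) bq).
  by rewrite (_ : (fun z => q (- z)) = q)//; apply/funext.
have [Cc hCc] : exists C, forall r x, `|convolution (w r) q x| <= C * \int[mu]_y `|w r y|.
  by exists C => r x; exact: norm_convolution_le.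
have LP r : L1 mu (fun x => p x * convolution (w r) q x).
  apply: (L1_mul_bnd Lp (smooth_measurable (smooth_convolution (Lw r) bq)) (hCc r)).
have Es : \int[mu]_x b (convolution (w s) q x) - moment u P s -
    (\int[mu]_x b (convolution (w t0) q x) - moment u P t0) - 0 * (s - t0) =
  \int[mu]_x ((b (convolution (w s) q x) - b (convolution (w t0) q x)) -
    (p x * convolution (w s) q x - p x * convolution (w t0) q x)).
  rewrite integral_sub; [|exact: L1_sub|exact: L1_sub].
  rewrite (integral_sub Lbs Lbt) (integral_sub (LP s) (LP t0)) !EP mul0r subr0.
  have ar (a1 a2 a3 a4 : R) : a1 - a2 - (a3 - a4) = a1 - a3 - (a2 - a4) by ring.
  exact: ar.
have LD := L1_sub (Lw s) (Lw t0).
have LDq := young LD bq.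
rewrite Es; apply: (@le_trans _ _ (B * (c * `|s - t0|) * D s t0)); last first.
  have := hd s sd; rewrite ltr_pdivlMr ?ltr_wpDl ?mulr_ge0// => h.
  rewrite -!mulrA [_ * D s t0]mulrC !mulrA ler_wpM2r//.
  apply: le_trans (ltW h); rewrite mulrDr mulr1 mulrC lerDl; exact: curve_dist_ge0.
apply: (@le_trans _ _ (B * (c * `|s - t0|) *
  \int[mu]_x `|convolution (fun y => w s y - w t0 y) q x|)); last first.
  rewrite ler_wpM2l ?mulr_ge0//; apply: le_trans LDq.2 _.
  rewrite (_ : \int[mu]_x `|q x| = 1) ?mulr1//.
  by rewrite -qI; apply: eq_Rintegral => x _; rewrite ger0_norm.
have LA := L1_sub (L1_sub Lbs Lbt) (L1_sub (LP s) (LP t0)).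
apply: le_trans (integral_norm_le LA) _.
rewrite -integral_scale; last exact/L1_norm/LDq.1.
apply: integral_le; [exact: L1_norm|by apply: L1_scale; exact/L1_norm/LDq.1|].
move=> x; rewrite convolution_sub// -mulrBr.
apply: le_trans (C2_taylor H (rgs x) (rgt x)) _.
by rewrite ler_wpM2r// ler_wpM2l// hc.
Qed.

Definition production t := - \int[mu]_x (derive1 (V t) x * legendre b b1 (w t x)).

Lemma convolution_derive_bounded T0 : exists2 l : R, 0 <= l &
  forall t, T0 <= t <= T -> forall x, `|derive1 (V t) x| <= l.
Proof.
have [l l0 hl] := curve_convolution_bounded T0 T cw (bump_derive bk).
by exists l => // t tT x; rewrite derive1_convolution// hl.
Qed.

Lemma L1_production t : t <= T -> L1 mu (fun x => derive1 (V t) x * legendre b b1 (w t x)).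
Proof.
move=> tT; have [l l0 hl] := convolution_derive_bounded t.
under eq_fun do rewrite mulrC.
have Lg := L1_comp_le (measurable_legendre H) (Lw t) (rw tT) (legendre_le H).
apply: (L1_mul_bnd Lg _ (hl t _)); last by rewrite lexx.
exact: (smooth_measurable (smooth_derive1 (smooth_convolution (Lw t) bk))).
Qed.

(** Both V_x, uniformly in x, and [legendre] of the solution, in L^1, are Lipschitz for the L^1
    distance of times; the production inherits the continuity of the curve. *)
Lemma production_dist T0 : exists2 C : R, 0 <= C & forall s t, T0 <= s <= T -> T0 <= t <= T ->
  `|production s - production t| <= C * D s t.
Proof.
have [l l0 hl] := convolution_derive_bounded T0.
have [N N0 wN] := curve_norm_bounded T0 T cw.
have [K kK] := bump_bounded (bump_derive bk); have K0 : 0 <= K by exact: le_trans (kK 0).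
have MB0 : 0 <= M * B by rewrite mulr_ge0 ?(C2_M0 H) ?(C2_B0 H).
exists (l * (M * B) + K * (M * B) * N) => [|s t hs ht].
  by rewrite addr_ge0// !mulr_ge0// ?(C2_M0 H) ?(C2_B0 H).
have sT : s <= T by case/andP: hs. have tT : t <= T by case/andP: ht.
have LD := L1_sub (Lw s) (Lw t).
rewrite /production opprK addrC distrC.
have Ls := L1_production sT; have Lt := L1_production tT.
apply: le_trans (integral_norm_sub Ls Lt) _.
apply: (@le_trans _ _ (\int[mu]_x (l * (M * B) * `|w s x - w t x| +
    K * (M * B) * D s t * `|w t x|))); last first.
  have LN := L1_norm (Lw t).
  rewrite integral_add; [|by apply: L1_scale; exact: L1_norm|exact: L1_scale].
  rewrite !integral_scale//; last exact: L1_norm.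
  rewrite mulrDl lerD2l -!mulrA [leRHS](_ : _ = K * (M * (B * (D s t * N)))); last by ring.
  rewrite !ler_wpM2l// ?(C2_M0 H) ?(C2_B0 H)//; first exact: curve_dist_ge0.
  exact: wN.
apply: integral_ae_le; first exact/L1_norm/L1_sub.
  by apply: L1_add; apply: L1_scale; exact: L1_norm.
apply: (ae_imp2 _ (rw sT) (rw tT)) => x xs xt.
rewrite (_ : derive1 (V s) x * _ - _ =
  derive1 (V s) x * (legendre b b1 (w s x) - legendre b b1 (w t x)) +
  (derive1 (V s) x - derive1 (V t) x) * legendre b b1 (w t x)); last by ring.
apply: le_trans (ler_normD _ _) _; rewrite !normrM; apply: lerD.
  rewrite -mulrA; apply: ler_pM => //; first exact: hl.
  exact: legendre_lipschitz H _ _ xs xt.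
rewrite [leRHS](_ : _ = (K * D s t) * (M * B * `|w t x|)); last by ring.
apply: ler_pM => //; last exact: legendre_le H _ xt.
by rewrite !derive1_convolution//; apply: convolution_curve_dist => //; exact: bump_derive.
Qed.

(** The renormalised equation. The mollified entropies are differentiable and their rates approach
    the production uniformly for times near [t0]; the resulting increment estimate passes to the
    limit in the mollification index. *)
Lemma is_derive_entropy t0 : 0 < t0 -> t0 < T ->
  isd (fun t => \int[mu]_x b (w t x)) t0 (production t0).
Proof.
move=> t00 t0T; have [brho _ _ _] := mrho; have srho := bump_smooth brho.
have [r /ltW r_ge0 hr] := bump_support brho.
have [l l0 hl] := convolution_derive_bounded 0.
have [K K0 hK] := curve_convolution_bounded 0 T cw bk.
have [C C0 hC] := production_dist 0.
have M0 := C2_M0 H; have B0 := C2_B0 H.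
pose e n : R := n.+1%:R^-1.
have e_gt0 n : 0 < e n by rewrite invr_gt0.
pose q n := rescale rho (e n).
have mq n : mollifier (q n) := mollifier_rescale (e_gt0 n) mrho.
have bq n : bump (q n) by case: (mq n).
have bdr := bump_derive brho.
pose E n t := \int[mu]_x b (convolution (w t) (q n) x).
pose L n t := moment_rate k u (convolution (fun x => b1 (convolution (w t) (q n) x)) (q n)) t.
have EL n t : 0 < t -> t < T -> isd (E n) t (L n t).
  exact: is_derive_mollified_entropy.
pose a1 n t := \int[mu]_x `|convolution (w t) (rescale (derive1 rho) (e n)) x - 0 * w t x|.
pose a2 n t := \int[mu]_x `|convolution (w t) (q n) x - 1 * w t x|.
(* Differentiating the rescaled mollifier produces the factor 1/e_n, which cancels the support width
   e_n r in the commutator; what is left is [a1], which tends to zero. *)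
have LG n t : 0 <= t <= T -> `|L n t - production t| <= B * M * l * r * a1 n t + l * (M * B) * a2 n t.
  move=> tT; have tT' : t <= T by case/andP: tT.
  have qd x : e n * r <= `|x| -> q n x = 0 by exact: rescale_support.
  have d0 : 0 <= e n * r by rewrite mulr_ge0// ltW.
  have sV := smooth_convolution (Lw t) bk.
  have := mollified_flux_le H (Lw t) (rw tT') (mq n) qd d0 sV (hK t tT) (hl t tT).
  rewrite -[X in `|_ + X|]opprK; move=> h; apply: le_trans h _.
  rewrite lerD2r (_ : \int[mu]_x _ = (e n)^-1 * a1 n t).
    rewrite le_eqVlt; apply/orP; left; apply/eqP; field.
    by rewrite gt_eqF.
  rewrite -integral_scale; last first.
    apply: L1_norm; apply: L1_sub; last exact/L1_scale/Lw.
    exact: (young (Lw t) (bump_rescale (e_gt0 n) bdr)).1.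
  apply: eq_Rintegral => x _; rewrite mul0r subr0.
  rewrite (_ : derive1 (q n) = fun x => (e n)^-1 * rescale (derive1 rho) (e n) x); last first.
    by apply/funext => y; rewrite derive1_rescale.
  rewrite (convolution_scale _ (Lw t) (bump_rescale (e_gt0 n) bdr)).
  by rewrite normrM gtr0_norm// invr_gt0.
pose N1 := \int[mu]_x `|derive1 rho x|.
(* These bounds transfer smallness of the errors at [t0] to all nearby times, so that one index [n]
   serves a whole neighbourhood. *)
have a1d n s t : a1 n s <= a1 n t + N1 * D s t.
  have := mollify_dist 0 (bump_rescale (e_gt0 n) bdr) (Lw s) (Lw t).
  by rewrite normr0 addr0 integral_norm_rescale.
have a2d n s t : a2 n s <= a2 n t + 2 * D s t.
  have := mollify_dist 1 (bq n) (Lw s) (Lw t).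
  rewrite normr1 (_ : \int[mu]_x `|q n x| = 1); first by rewrite (_ : 1 + 1 = 2).
  case: (mq n) => _ qn0 _ <-; apply: eq_Rintegral => x _; rewrite ger0_norm//.
have a1c t : a1 n t @[n --> \oo] --> 0.
  exact: integral_mollify (kernel_of_mass_derive mrho) (Lw t).
have a2c t : a2 n t @[n --> \oo] --> 0.
  exact: integral_mollify (kernel_of_mass_mollifier mrho) (Lw t).
pose c1 := B * M * l * r; pose c2 := l * (M * B).
have c10 : 0 <= c1 by rewrite !mulr_ge0.
have c20 : 0 <= c2 by rewrite !mulr_ge0.
have N10 : 0 <= N1 by exact: Rintegral_ge0.
pose c3 := c1 * N1 + c2 * 2 + C.
have c30 : 0 <= c3 by rewrite !addr_ge0// mulr_ge0.
apply: is_derive_dist => eps eps0.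
have ee : 0 < eps / 2 by rewrite divr_gt0.
have e1 : 0 < eps / 2 / (c3 + 1) by rewrite divr_gt0// ltr_wpDl.
have [_ _ cc _] := cw; have [d d0 hd] := cc t0 _ e1.
pose d' := Num.min d (Num.min t0 (T - t0)).
have d'0 : 0 < d' by rewrite !lt_min d0 t00 subr_gt0.
have hd' s : `|t0 - s| < d' -> [/\ 0 < s, s < T & c3 * D s t0 <= eps / 2].
  move=> /dist_itv0[sd s0 sT]; split => //.
  have := hd s sd; rewrite ltr_pdivlMr ?ltr_wpDl// => h; apply: le_trans (ltW h).
  by rewrite mulrDr mulr1 mulrC lerDl; exact: curve_dist_ge0.
exists d' => // s sd.
have anc : (c1 * a1 n t0 + c2 * a2 n t0) @[n --> \oo] --> 0.
  rewrite (_ : 0 = c1 * 0 + c2 * 0); last by rewrite !mulr0 addr0.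
  by apply: cvgD; apply: cvgMl_tmp.
have Lnear : \forall n \near \oo, forall x, `|t0 - x| < d' -> `|L n x - production t0| <= eps.
  have := cvg0_norm_lt anc ee; apply: filterS => n /= hn x xd.
  have [x0 xT xe] := hd' x xd.
  have xT' : 0 <= x <= T by rewrite !ltW.
  have t0T' : 0 <= t0 <= T by rewrite !ltW.
  apply: le_trans (_ : `|L n x - production x| + `|production x - production t0| <= _).
    by rewrite (le_trans _ (ler_normD _ _))// addrA subrK.
  apply: le_trans (lerD (LG n x xT') (hC x t0 xT' t0T')) _.
  have h1 : c1 * a1 n x <= c1 * (a1 n t0 + N1 * D x t0) by rewrite ler_wpM2l.
  have h2 : c2 * a2 n x <= c2 * (a2 n t0 + 2 * D x t0) by rewrite ler_wpM2l.
  have h3 := le_lt_trans (ler_norm _) hn.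
  exact: linear_error_le h1 h2 h3 xe.
have [s0 sT _] := hd' s sd.
have Enear : \forall n \near \oo, `|E n s - E n t0 - production t0 * (s - t0)| <= eps * `|s - t0|.
  apply: filterS Lnear => n hn.
  have DE x : `|t0 - x| < d' -> isd (E n) x (L n x) by move=> /hd'[x0 xT _]; exact: EL.
  exact: (rate_dist hn DE sd).
have Ec x : 0 < x -> x < T -> E n x @[n --> \oo] --> \int[mu]_y b (w x y).
  move=> x0 xT; have rx := rw (ltW xT).
  apply: (cvg_dist_le0 (v := fun n => B * M * a2 n x)); last first.
    by rewrite -[X in _ --> X](mulr0 (B * M)); apply: cvgMl_tmp.
  apply: nearW => n; rewrite /E /a2; under [in leRHS]eq_Rintegral do rewrite mul1r.
  apply: (C2_integral_dist H (young (Lw x) (bq n)).1 _ (Lw x) rx).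
  by apply: ae_all; exact: (mollified_range (Lw x) rx (mq n)).
have c : `|E n s - E n t0 - production t0 * (s - t0)| @[n --> \oo] -->
    `|\int[mu]_y b (w s y) - \int[mu]_y b (w t0 y) - production t0 * (s - t0)|.
  apply: cvg_norm; apply: cvgB; last exact: cvg_cst.
  by apply: cvgB; exact: Ec.
by rewrite -(cvg_lim _ c)//; apply: limr_le => //; exact: cvgP c.
Qed.

End EntropyRate.

(** * Positivity *)

Section Positivity.
Context {R : realType}.
Local Notation mu := (@lebesgue_measure R).
Local Notation isd f x df := (is_derive (x : R) (1 : R) (f : R -> R) (df : R)).
Implicit Types (f g phi psi q V : R -> R) (lo hi M B : R).

Lemma growth_le f (df : R -> R) (t C : R) : 0 < t -> (forall x, 0 < x < t -> isd f x (df x)) ->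
  (forall x, 0 <= x <= t -> {for x, continuous f}) ->
  (forall x, 0 < x < t -> df x <= C) -> f t - f 0 <= C * t.
Proof.
move=> t0 fdf cf dfC.
have D x : x \in `]0, t[ -> isd f x (df x) by rewrite in_itv/=; exact: fdf.
have c : {within `[0, t], continuous f}.
  apply: continuous_in_subspaceT => x; rewrite inE/= in_itv/=; exact: cf.
have [x + ->] := MVT t0 D c; rewrite in_itv/= subr0 => xt.
by rewrite ler_wpM2r// ?dfC// ltW.
Qed.

Definition negpart (v : R) := Num.max (- v) 0.

(** A quadratic remainder with constant 1, valid across the kink at 0: the squared negative part is
    differentiable everywhere. *)
Lemma negpart_sqr_dist (s t : R) :
  `|negpart s * negpart s - negpart t * negpart t - (-2 * negpart t) * (s - t)| <=
  `|s - t| * `|s - t|.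
Proof.
rewrite -[leRHS]normrM (ger0_norm (sqr_ge0 (s - t))) ler_norml /negpart.
have h1 := sqr_ge0 s; have h2 := sqr_ge0 t; have h3 := sqr_ge0 (s - t).
case: (leP (- s) 0) => s0; case: (leP (- t) 0) => t0.
- by apply/andP; split; nra.
- have h4 : 0 <= s * - t by clear -s0 t0; nra.
  by apply/andP; split; nra.
- have h4 : 0 <= - s * t by clear -s0 t0; nra.
  by apply/andP; split; nra.
- by apply/andP; split; nra.
Qed.

Lemma is_derive_negpart_sqr (v : R) :
  isd (fun v => negpart v * negpart v) v (-2 * negpart v).
Proof.
apply: is_derive_dist => e e0; exists e => // s se.
apply: le_trans (negpart_sqr_dist s v) _.
by rewrite ler_wpM2r// distrC ltW.
Qed.

(** The cube of the negative part, written as a product whose factors have known derivatives. The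
    square would not do, as [C2_on] requires a continuous second derivative. *)
Definition negcube (v : R) := (-1 * v) * (negpart v * negpart v).

Lemma negcubeE v : negcube v = negpart v * (negpart v * negpart v).
Proof.
by rewrite /negcube mulN1r /negpart; case: (leP (- v) 0) => // _; rewrite mulr0 !mul0r mulr0.
Qed.

Lemma negpart_ge0 v : 0 <= negpart v.
Proof. by rewrite le_max lexx orbT. Qed.

Lemma negcube_ge0 v : 0 <= negcube v.
Proof. by rewrite negcubeE !mulr_ge0// negpart_ge0. Qed.

Lemma negcube_eq0 v : negcube v = 0 -> 0 <= v.
Proof.
rewrite negcubeE => /eqP; rewrite !mulf_eq0 !orbb /negpart; case: (leP (- v) 0) => h.
  by move=> _; rewrite -oppr_le0.
by rewrite oppr_eq0 => /eqP v0; rewrite v0 oppr0 ltxx in h.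
Qed.

Lemma is_derive_negcube (v : R) : isd negcube v (-3 * (negpart v * negpart v)).
Proof.
have h := is_derive_mul (is_derive_scale (-1) (is_derive_id (v : R) (1 : R)))
  (is_derive_negpart_sqr v).
rewrite (_ : -3 * _ = -1 * id v * (-2 * negpart v) + negpart v * negpart v * (-1 * 1)) //.
rewrite /= mulN1r /negpart; case: (leP (- v) 0) => _; ring.
Qed.

Lemma is_derive_negcube' (v : R) :
  isd (fun v => -3 * (negpart v * negpart v)) v (6 * negpart v).
Proof.
rewrite (_ : 6 * _ = -3 * (-2 * negpart v)); last by ring.
by apply: is_derive_scale; exact: is_derive_negpart_sqr.
Qed.

Lemma negpart_dist (s t : R) : `|negpart s - negpart t| <= `|s - t|.
Proof.
rewrite /negpart; case: (leP (- s) 0) => s0; case: (leP (- t) 0) => t0.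
- by rewrite subrr normr0.
- rewrite ler_norml; have := ler_norm (s - t); lra.
- rewrite ler_norml; have := ler_norm (t - s); rewrite distrC; lra.
- by rewrite -opprD normrN.
Qed.

Lemma continuous_negpart : continuous negpart.
Proof.
move=> v; apply/cvgrPdist_lt => e e0; near=> s.
apply: le_lt_trans (negpart_dist _ _) _.
near: s; exact: cvgr_dist_lt.
Unshelve. all: by end_near. Qed.

Lemma C2_on_negcube M : 0 <= M ->
  C2_on (- M) M M (6 * M) negcube (fun v => -3 * (negpart v * negpart v))
    (fun v => 6 * negpart v).
Proof.
move=> M0; split.
- by rewrite oppr_le0 M0.
- by move=> v; rewrite ler_norml.
- by move=> v _; exact: is_derive_negcube.
- by move=> v _; exact: is_derive_negcube'.
- move=> v; rewrite -ler_norml => vM; rewrite normrM ger0_norm// ler_wpM2l//.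
  rewrite ger0_norm ?negpart_ge0// /negpart ge_max M0 andbT.
  by rewrite (le_trans _ vM)// -normrN ler_norm.
- by move=> v _; apply: cvgMl_tmp; exact: continuous_negpart.
- apply: continuous_measurable => v; exact: is_derive_continuous (is_derive_negcube v).
- apply: continuous_measurable => v; exact: is_derive_continuous (is_derive_negcube' v).
- by rewrite /negcube mulr0 mul0r.
- by rewrite /negpart oppr0 maxxx !mulr0.
Qed.

(** Euler's relation for a function homogeneous of degree three. It makes the production a multiple
    of the entropy density itself, so that Gronwall closes. *)
Lemma legendre_negcube v :
  legendre negcube (fun v => -3 * (negpart v * negpart v)) v = 2 * negcube v.
Proof. rewrite /legendre /negcube; ring. Qed.

Context (k u0 : R -> R) (u : R -> R -> R) (rho : R -> R).
Context (bk : bump k) (nu : nonlocal_solution k u0 u) (mrho : mollifier rho).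
Local Notation w := (extend u).
Local Notation V := (fun t => convolution (w t) k).
Let cw : L1_curve w := nonlocal_curve nu.
Let Lw t : L1 mu (w t) := nonlocal_L1 nu t.

Section Continuity.
Context (T : R) (b b1 b2 : R -> R) (lo hi M B : R).
Context (H : C2_on lo hi M B b b1 b2).
Context (rw : forall t, t <= T -> {ae mu, forall x, lo <= w t x <= hi}).

Lemma L1_entropy_integrand t : t <= T -> L1 mu (fun x => b (w t x)).
Proof. by move=> tT; exact: (L1_C2_comp H (Lw t) (rw tT)). Qed.

Lemma entropy_dist s t : s <= T -> t <= T ->
  `|\int[mu]_x b (w s x) - \int[mu]_x b (w t x)| <= B * M * \int[mu]_x `|w s x - w t x|.
Proof.
by move=> sT tT; exact: (C2_integral_dist H (Lw s) (rw sT) (Lw t) (rw tT)).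
Qed.

Lemma continuous_entropy_integral t : t < T -> {for t, continuous (fun t => \int[mu]_x b (w t x))}.
Proof.
move=> tT; have [_ _ cc _] := cw; apply/cvgrPdist_lt => e e0.
have BM0 : 0 <= B * M by rewrite mulr_ge0 ?(C2_B0 H) ?(C2_M0 H).
have e1 : 0 < e / (B * M + 1) by rewrite divr_gt0// ltr_wpDl.
have [d d0 hd] := cc t _ e1.
have md : 0 < Num.min d (T - t) by rewrite lt_min d0 subr_gt0.
exists (Num.min d (T - t)); first exact: md.
move=> s /=; rewrite /ball_ /= lt_min => /andP[sd sT].
have sT' : s <= T.
  by move: sT; rewrite distrC => /ltW /(le_trans (ler_norm _)); rewrite lerD2r.
rewrite distrC; apply: le_lt_trans (entropy_dist sT' (ltW tT)) _.
have := hd s sd; rewrite ltr_pdivlMr ?ltr_wpDl// => h; apply: le_lt_trans h.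
by rewrite mulrDr mulr1 mulrC lerDl; exact: Rintegral_ge0.
Qed.

End Continuity.

Lemma initial_curve : {ae mu, forall x, w 0 x = u0 x}.
Proof. by case: nu => _ + _; rewrite /initial_datum extendE. Qed.

(** Gronwall for the integral of [negcube], which is zero initially and grows at rate at most 2 l,
    where l bounds |V_x|. *)
Lemma nonlocal_nonneg t : (forall x, 0 <= u0 x) -> 0 <= t -> {ae mu, forall x, 0 <= w t x}.
Proof.
move=> u00; rewrite le_eqVlt => /orP[/eqP <-|t0].
  by apply: ae_imp initial_curve => x ->.
pose T := t + 1; have tT : t < T by rewrite ltrDl.
have [_ _ _ /(_ T)[M0 wM0]] := cw; pose M := Num.max M0 0.
have M_ge0 : 0 <= M by rewrite le_max lexx orbT.
have rw s : s <= T -> {ae mu, forall x, - M <= w s x <= M}.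
  by move=> /wM0; apply: ae_imp => x xM; rewrite -ler_norml le_max xM.
have H := C2_on_negcube M_ge0.
pose E s := \int[mu]_x negcube (w s x).
have DE s : 0 < s -> s < T -> isd E s _ := fun s0 sT => is_derive_entropy bk nu mrho H rw s0 sT.
have [l l0 hl] := convolution_derive_bounded bk nu T 0.
(* The integrating factor makes the derivative nonpositive, so [F] stays below [F 0 = 0]. *)
pose F s := E s * expR (- (2 * l) * s).
have Dexp (s : R) : isd (fun s => expR (- (2 * l) * s)) s (expR (- (2 * l) * s) * (- (2 * l))).
  apply: (is_derive_comp (f := expR) (is_derive_expR _)).
  by rewrite -[X in isd _ _ X]mulr1; apply: is_derive_scale; exact: is_derive_id.
have prod_le s : 0 < s -> s < T -> production k u
   negcube (fun v => -3 * (negpart v * negpart v)) s <= (2 * l) * E s.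
  move=> s0 sT; have sT' : s <= T by exact: ltW.
  have Lb := L1_entropy_integrand H rw sT'.
  apply: le_trans (ler_norm _) _; rewrite normrN.
  have Lp := L1_production bk nu H rw sT'.
  apply: le_trans (integral_norm_le Lp) _.
  rewrite -integral_scale//; apply: integral_le; [exact: L1_norm|exact: L1_scale|].
  move=> x; rewrite legendre_negcube normrM [2 * l]mulrC -mulrA.
  rewrite (ger0_norm (mulr_ge0 (ler0n R 2) (negcube_ge0 _))).
  apply: ler_wpM2r; first exact: (mulr_ge0 (ler0n R 2) (negcube_ge0 _)).
  by apply: hl; rewrite !ltW.
have FD s : 0 < s < t -> isd F s (E s * (expR (- (2 * l) * s) * (- (2 * l))) +
    expR (- (2 * l) * s) * production k u negcube (fun v => -3 * (negpart v * negpart v)) s).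
  move=> /andP[s0 st]; exact: (is_derive_mul (DE s s0 (lt_trans st tT)) (Dexp s)).
have Fc s : 0 <= s <= t -> {for s, continuous F}.
  move=> /andP[_ st]; apply: cvgM; first exact: (continuous_entropy_integral H rw (le_lt_trans st tT)).
  exact: is_derive_continuous (Dexp s).
have FC s : 0 < s < t -> E s * (expR (- (2 * l) * s) * (- (2 * l))) +
    expR (- (2 * l) * s) * production k u negcube (fun v => -3 * (negpart v * negpart v)) s <= 0.
  move=> /andP[s0 st]; have := prod_le s s0 (lt_trans st tT).
  set p := production _ _ _ _ _ => h.
  rewrite (_ : _ + _ = expR (- (2 * l) * s) * (p - 2 * l * E s)); last by ring.
  by rewrite mulr_ge0_le0 ?expR_ge0// subr_le0.
have Lb0 := L1_entropy_integrand H rw (ltW (lt_trans t0 tT)).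
have E0 : E 0 = 0.
  transitivity (\int[mu]_x (0 : R)); last by rewrite /Rintegral integral0.
  apply: integral_ae_eq0; [exact: Lb0|exact: L1_cst0|].
  apply: ae_imp initial_curve => x ->; rewrite negcubeE /negpart.
  by rewrite max_r ?mul0r// oppr_le0.
have := growth_le t0 FD Fc FC; rewrite mul0r /F E0 mul0r subr0.
rewrite pmulr_lle0 ?expR_gt0// => Et.
have Lbt := L1_entropy_integrand H rw (ltW tT).
have b0 : {ae mu, forall x, 0 <= negcube (w t x)} by apply: ae_all => x; exact: negcube_ge0.
have := integral_ge0_eq0 Lbt b0 Et; by apply: ae_imp => x; exact: negcube_eq0.
Qed.

End Positivity.

(** * The logarithmic entropy *)

Section UniformSmallness.
Context {R : realType}.
Local Notation mu := (@lebesgue_measure R).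
Local Notation isd f x df := (is_derive (x : R) (1 : R) (f : R -> R) (df : R)).
Implicit Types (f g : R -> R) (w : R -> R -> R).

(* Dini-type argument: the integrals depend on t in an equicontinuous way, so that
   pointwise convergence is uniform on the compact interval. *)
Lemma curve_uniform_small w (phi : nat -> R -> R) (T e : R) : L1_curve w ->
  (forall t, 0 <= t <= T -> {ae mu, forall x, 0 <= w t x}) ->
  (forall n, measurable_fun setT (phi n)) -> (forall n, phi n 0 = 0) ->
  (forall n v v', 0 <= v -> 0 <= v' -> `|phi n v - phi n v'| <= `|v - v'|) ->
  (forall v, 0 <= v -> phi n v @[n --> \oo] --> 0) -> 0 < e ->
  \forall n \near \oo, forall t, 0 <= t <= T -> \int[mu]_x `|phi n (w t x)| <= e.
Proof.
move=> cw w0 mphi phi0 phil phic e0; case: (cw) => _ Lw cc _.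
have e2 : 0 < e / 2 by rewrite divr_gt0.
have phi_le n v : 0 <= v -> `|phi n v| <= `|v|.
  by move=> v0; have := phil n v 0 v0 (lexx 0); rewrite phi0 !subr0.
have Lphi n t : 0 <= t <= T -> L1 mu (fun x => phi n (w t x)).
  move=> tT; apply: L1_ae_le (L1_norm (Lw t)).
    exact: measurableT_comp (mphi n) (L1_measurable (Lw t)).
  by apply: ae_imp (w0 t tT) => x; exact: phi_le.
have dist n s t : 0 <= s <= T -> 0 <= t <= T ->
    \int[mu]_x `|phi n (w s x)| <= \int[mu]_x `|phi n (w t x)| + \int[mu]_x `|w s x - w t x|.
  move=> sT tT; have LD := L1_norm (L1_sub (Lw s) (Lw t)).
  have Ls := L1_norm (Lphi n s sT); have Lt := L1_norm (Lphi n t tT).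
  rewrite -integral_add//; apply: integral_ae_le => //; first exact: L1_add.
  apply: (ae_imp2 _ (w0 s sT) (w0 t tT)) => x xs xt; rewrite addrC -lerBlDr.
  by apply: le_trans (lerB_dist _ _) _; exact: phil.
have cvg t : 0 <= t <= T -> \int[mu]_x `|phi n (w t x)| @[n --> \oo] --> 0.
  move=> tT; have -> : (0 : R) = \int[mu]_x (0 : R) by rewrite /Rintegral integral0.
  have m n : measurable_fun setT (fun x => `|phi n (w t x)|).
    exact: L1_measurable (L1_norm (Lphi n t tT)).
  have m0 : measurable_fun setT (fun _ : R => 0 : R) by exact: measurable_cst.
  have le n : {ae mu, forall x, `| `|phi n (w t x)| | <= `|w t x|}.
    by apply: ae_imp (w0 t tT) => x x0; rewrite normr_id; exact: phi_le.
  have c : {ae mu, forall x, `|phi n (w t x)| @[n --> \oo] --> (0 : R)}.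
    by apply: ae_imp (w0 t tT) => x x0; rewrite -(normr0 R); apply: cvg_norm; exact: phic.
  have [|||||_ d] := @integral_dct _ _ _ mu (fun n x => `|phi n (w t x)|) (fun=> 0)
    (fun x => `|w t x|) => //.
  exact/L1_norm/Lw.
have K := (compact_near_coveringP (`[0, T] : set R)).1 (@segment_compact R 0 T).
suff : \forall n \near \oo, `[0, T] `<=` (fun t => 0 <= t <= T -> \int[mu]_x `|phi n (w t x)| <= e).
  by apply: filterS => n h t tT; apply: h => //; rewrite /= in_itv.
apply: K => t; rewrite /= in_itv/= => tT.
have [d d0 hd] := cc t _ e2.
have cn := cvg0_norm_lt (cvg t tT) e2.
exists ([set s | `|t - s| < d], [set n | `|\int[mu]_x `|phi n (w t x)| | < e / 2]).
  by split => //; exists d.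
move=> [s n] /= [sd nt] sT; apply: le_trans (dist n s t sT tT) _.
rewrite (splitr e); apply: lerD; last exact: ltW (hd s sd).
by apply: le_trans (ler_norm _) _; exact: ltW.
Qed.

End UniformSmallness.

Section Entropy.
Context {R : realType}.
Local Notation mu := (@lebesgue_measure R).
Local Notation isd f x df := (is_derive (x : R) (1 : R) (f : R -> R) (df : R)).
Implicit Types (f g : R -> R) (a v M : R).

Definition logratio a v := ln (v + a) - ln a.
(** A regularisation of v ln v with second derivative 1 / (v + a). The terms containing ln a and the
    final -v normalise the value and the slope at 0 to zero, as [C2_on] demands. *)
Definition logentropy a v := (v + a) * logratio a v - v.

Lemma is_derive_ln_shift a v : 0 < a -> 0 <= v -> isd (fun v => ln (v + a)) v (v + a)^-1.
Proof.
move=> a0 v0; have Dl : isd (@ln R) (v + a) (v + a)^-1.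
  by apply: is_derive1_ln; rewrite ltr_wpDl.
have Da : isd (fun v => v + a) v 1.
  have := is_derive_add (is_derive_id (v : R) (1 : R)) (is_derive_cst (a : R) (v : R) (1 : R)).
  by rewrite addr0.
by have := is_derive_comp (g := fun v => v + a) Dl Da; rewrite mulr1.
Qed.

Lemma is_derive_logratio a v : 0 < a -> 0 <= v -> isd (logratio a) v (v + a)^-1.
Proof.
move=> a0 v0; rewrite -[(v + a)^-1]subr0.
by apply: is_derive_sub; exact: is_derive_ln_shift.
Qed.

Lemma is_derive_logentropy a v : 0 < a -> 0 <= v -> isd (logentropy a) v (logratio a v).
Proof.
move=> a0 v0.
have Da : isd (fun v => v + a) v (1 + 0) by apply: is_derive_add.
have := is_derive_sub (is_derive_mul Da (is_derive_logratio a0 v0)) (is_derive_id v 1).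
rewrite mulfV ?gt_eqF ?ltr_wpDl// (_ : 1 + logratio a v * (1 + 0) - 1 = logratio a v)//; ring.
Qed.

Lemma measurable_logratio a : measurable_fun setT (logratio a).
Proof.
apply: measurable_funB; last exact: measurable_cst.
apply: (measurableT_comp (@measurable_ln R)).
by apply: measurable_funD; [exact: measurable_id|exact: measurable_cst].
Qed.

Lemma measurable_logentropy a : measurable_fun setT (logentropy a).
Proof.
apply: measurable_funB; last exact: measurable_id.
apply: measurable_funM; last exact: measurable_logratio.
by apply: measurable_funD; [exact: measurable_id|exact: measurable_cst].
Qed.

Lemma logratio0 a : logratio a 0 = 0.
Proof. by rewrite /logratio add0r subrr. Qed.

Lemma C2_on_logentropy a M : 0 < a -> 0 <= M ->
  C2_on 0 M M a^-1 (logentropy a) (logratio a) (fun v => (v + a)^-1).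
Proof.
move=> a0 M0; split.
- by rewrite lexx M0.
- by move=> v /andP[v0 vM]; rewrite ger0_norm.
- by move=> v /andP[v0 _]; exact: is_derive_logentropy.
- by move=> v /andP[v0 _]; exact: is_derive_logratio.
- move=> v /andP[v0 _]; have va : 0 < v + a by rewrite ltr_wpDl.
  by rewrite ger0_norm ?invr_ge0 ?(ltW va)// lef_pV2 ?posrE// lerDr.
- move=> v /andP[v0 _]; apply: cvgV; first by rewrite gt_eqF// ltr_wpDl.
  by apply: cvgD; [exact: cvg_id|exact: cvg_cst].
- exact: measurable_logentropy.
- exact: measurable_logratio.
- by rewrite /logentropy logratio0 mulr0 subr0.
- exact: logratio0.
Qed.

Lemma legendre_logentropy a v :
  legendre (logentropy a) (logratio a) v = v - a * logratio a v.
Proof. by rewrite /legendre /logentropy; ring. Qed.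

(** The derivative a / (v + a) is at most 1 for every [a]. This bound, uniform in the parameter, is
    what [curve_uniform_small] needs. *)
Lemma logratio_dist a v v' : 0 < a -> 0 <= v -> 0 <= v' ->
  `|a * logratio a v - a * logratio a v'| <= `|v - v'|.
Proof.
move=> a0 v0 v'0; pose M := Num.max v v'.
have D x : 0 <= x <= M -> isd (fun v => a * logratio a v) x (a * (x + a)^-1).
  by move=> /andP[x0 _]; apply: is_derive_scale; exact: is_derive_logratio.
have C x : 0 <= x <= M -> `|a * (x + a)^-1| <= 1.
  move=> /andP[x0 _]; have xa : 0 < x + a by rewrite ltr_wpDl.
  by rewrite ger0_norm ?ler_pdivrMr ?mul1r ?lerDr// divr_ge0// ltW.
have := lipschitz_on D C (v := v) (v' := v').
by rewrite v0 v'0 !le_max !lexx orbT mul1r => /(_ isT isT).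
Qed.

Lemma logratio_ge0 a v : 0 < a -> 0 <= v -> 0 <= logratio a v.
Proof.
by move=> a0 v0; rewrite subr_ge0 ler_ln ?posrE ?ltr_wpDl// lerDr.
Qed.

(** From ln y <= y - 1 with y the square root of (v + a)/a: the left-hand side is 2 a ln y and a y
    is the square root on the right. The bound vanishes as a tends to 0. *)
Lemma logratio_le_sqrt a v : 0 < a -> 0 <= v ->
  a * logratio a v <= 2 * Num.sqrt (a * (v + a)).
Proof.
move=> a0 v0; have va : 0 < v + a by rewrite ltr_wpDl.
pose y := Num.sqrt ((v + a) / a).
have y0 : 0 < y by rewrite sqrtr_gt0 divr_gt0.
have yy : y * y = (v + a) / a by rewrite -expr2 sqr_sqrtr// ltW// divr_gt0.
have -> : logratio a v = ln (y * y) by rewrite yy ln_div ?posrE.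
have -> : Num.sqrt (a * (v + a)) = a * y.
  rewrite (_ : a * (v + a) = a ^+ 2 * ((v + a) / a)); last by field; rewrite gt_eqF.
  by rewrite sqrtrM ?sqr_ge0// sqrtr_sqr gtr0_norm.
rewrite lnM ?posrE// -mulr2n -[ln y *+ 2]mulr_natl mulrCA !ler_pM2l//.
have := @le_ln1Dx R (y - 1); rewrite [1 + _]addrC subrK => h; apply: le_trans (h _) _; lra.
Qed.

Lemma cvg_logratio v : 0 <= v -> n.+1%:R^-1 * logratio n.+1%:R^-1 v @[n --> \oo] --> (0 : R).
Proof.
move=> v0; have e0 n : 0 < n.+1%:R^-1 :> R by rewrite invr_gt0.
apply: (cvg_dist_le0 (v := fun n => 2 * Num.sqrt (n.+1%:R^-1 * (v + n.+1%:R^-1)))).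
  apply: nearW => n; rewrite subr0 ger0_norm ?logratio_le_sqrt//.
  by rewrite mulr_ge0 ?logratio_ge0// ltW.
have ch : n.+1%:R^-1 @[n --> \oo] --> (0 : R) by exact: cvg_harmonic.
have c : n.+1%:R^-1 * (v + n.+1%:R^-1) @[n --> \oo] --> 0 * (v + 0).
  by apply: cvgM => //; apply: cvgD => //; exact: cvg_cst.
rewrite mul0r in c; rewrite -(mulr0 2) -[X in _ * X](sqrtr0 R).
by apply: cvgMl_tmp; apply: (continuous_cvg _ (@sqrt_continuous R 0)).
Qed.

Context (k u0 : R -> R) (u : R -> R -> R) (rho : R -> R).
Context (bk : bump k) (ke : forall x, k (- x) = k x).
Context (nu : nonlocal_solution k u0 u) (mrho : mollifier rho).
Context (u00 : forall x, 0 <= u0 x).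
Local Notation w := (extend u).
Local Notation V := (fun t => convolution (w t) k).
Let cw : L1_curve w := nonlocal_curve nu.
Let Lw t : L1 mu (w t) := nonlocal_L1 nu t.

Lemma curve_nonneg t : {ae mu, forall x, 0 <= w t x}.
Proof.
have [t0|/ltW t0] := leP 0 t; first exact: nonlocal_nonneg bk nu mrho t u00 t0.
by rewrite /extend max_r// -(extendE u (lexx 0)); exact: nonlocal_nonneg bk nu mrho 0 u00 _.
Qed.

Lemma curve_range T : exists2 M, 0 <= M &
  forall t, t <= T -> {ae mu, forall x, 0 <= w t x <= M}.
Proof.
have [_ _ _ /(_ T)[M0 wM0]] := cw; exists (Num.max M0 0); first by rewrite le_max lexx orbT.
move=> t /wM0; apply: (ae_imp2 _ (curve_nonneg t)) => x x0 xM.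
by rewrite x0 le_max (le_trans (ler_norm _) xM).
Qed.

(* The velocity gradient is the convolution with the odd kernel k'. *)
Lemma integral_velocity_gradient t : \int[mu]_x (derive1 (V t) x * w t x) = 0.
Proof.
have bdk := bump_derive bk; have sk := bump_smooth bk.
under eq_Rintegral do rewrite (derive1_convolution (Lw t) bk) mulrC.
have := convolution_dual (Lw t) (Lw t) bdk.
rewrite (_ : (fun z => derive1 k (- z)) = fun z => -1 * derive1 k z); last first.
  by apply/funext => z; rewrite derive1_even// mulN1r.
rewrite (convolution_scale _ (Lw t) bdk).
under [X in _ = X -> _]eq_Rintegral do rewrite mulrCA.
rewrite integral_scale; last first.
  have [C hC] := bump_bounded bdk.
  exact: (L1_mul_bnd (Lw t) (smooth_measurable (smooth_convolution (Lw t) bdk))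
    (fun x => norm_convolution_le x (Lw t) bdk hC)).
by rewrite mulN1r => /eqP; rewrite -subr_eq0 opprK -mulr2n mulrn_eq0/= => /eqP.
Qed.

Lemma L1_logratio a t : 0 < a -> L1 mu (fun x => a * logratio a (w t x)).
Proof.
move=> a0; apply: (L1_ae_le _ _ (L1_norm (Lw t))).
  apply: measurable_funM; first exact: measurable_cst.
  exact: measurableT_comp (measurable_logratio a) (L1_measurable (Lw t)).
apply: ae_imp (curve_nonneg t) => x x0.
by have := logratio_dist a0 x0 (lexx 0); rewrite logratio0 mulr0 !subr0.
Qed.

(** Of the density v - a ln((v + a)/a), the first term is annihilated by the odd kernel; only the
    second can decrease the entropy. *)
Lemma logentropy_production_ge T l a t h M : 0 < a -> 0 <= t < T -> 0 <= M ->
  (forall s, s <= T -> {ae mu, forall x, 0 <= w s x <= M}) ->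
  (forall x, `|derive1 (V t) x| <= l) ->
  \int[mu]_x `|a * logratio a (w t x)| <= h ->
  - (l * h) <= production k u (logentropy a) (logratio a) t.
Proof.
move=> a0 /andP[t0 tT] M0 rw hl hh.
have l0 : 0 <= l by exact: le_trans (hl 0).
have LL := L1_logratio t a0.
have mV : measurable_fun setT (derive1 (V t)).
  exact: (smooth_measurable (smooth_derive1 (smooth_convolution (Lw t) bk))).
have La : L1 mu (fun x => derive1 (V t) x * w t x).
  by under eq_fun do rewrite mulrC; exact: (L1_mul_bnd (Lw t) mV hl).
have Lb : L1 mu (fun x => derive1 (V t) x * (a * logratio a (w t x))).
  by under eq_fun do rewrite mulrC; exact: (L1_mul_bnd LL mV hl).
rewrite /production; under eq_Rintegral do rewrite legendre_logentropy mulrBr.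
rewrite integral_sub// integral_velocity_gradient sub0r opprK.
rewrite lerNl; apply: le_trans (ler_norm _) _; rewrite normrN.
apply: le_trans (integral_norm_le Lb) _.
apply: (@le_trans _ _ (l * \int[mu]_x `|a * logratio a (w t x)|)).
  rewrite -integral_scale; last exact: L1_norm.
  apply: integral_le; [exact: L1_norm|by apply: L1_scale; exact: L1_norm|].
  by move=> x; rewrite normrM ler_wpM2r.
by rewrite ler_wpM2l.
Qed.

End Entropy.

(** * From the logarithmic entropy to a lower bound on powers *)

Section PowerBound.
Context {R : realType}.
Local Notation mu := (@lebesgue_measure R).
Local Notation I f := (\int[mu]_x f x).
Local Notation isd f x df := (is_derive (x : R) (1 : R) (f : R -> R) (df : R)).
Local Notation box := (\1_(`]-1, 0[ : set R) : R -> R).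
Implicit Types (f g : R -> R) (a v M d : R).

Lemma ln_shift_le a v M : 0 < a -> 0 <= v <= M -> `|ln (v + a)| <= a^-1 * M + `|ln a|.
Proof.
move=> a0 /andP[v0 vM]; have := logratio_dist a0 v0 (lexx 0).
rewrite logratio0 mulr0 !subr0 normrM (gtr0_norm a0) (ger0_norm v0) => h.
have {}h : `|logratio a v| <= a^-1 * M.
  by rewrite mulrC ler_pdivlMr// mulrC (le_trans h).
rewrite -[ln (v + a)](subrK (ln a)); apply: le_trans (ler_normD _ _) _.
by rewrite lerD2r.
Qed.

Lemma powR_ge_ln d v : 0 < v -> 1 + d * ln v <= v `^ d.
Proof. by move=> v0; rewrite /powR gt_eqF// expR_ge1Dx. Qed.

Lemma mul_powR d v : 0 < d -> 0 <= v -> v * v `^ d = v `^ (1 + d).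
Proof.
by move=> d0 v0; rewrite powRD ?powRr1// gt_eqF// addr_gt0.
Qed.

Lemma continuous_powR_shift d v : 0 < v ->
  (v + n.+1%:R^-1) `^ d @[n --> \oo] --> v `^ d.
Proof.
move=> v0; have c : v + n.+1%:R^-1 @[n --> \oo] --> v.
  by rewrite -[X in _ --> X]addr0; apply: cvgD; [exact: cvg_cst|exact: cvg_harmonic].
have E x : 0 < x -> x `^ d = expR (d * ln x) by move=> x0; rewrite /powR gt_eqF.
rewrite E//; under eq_fun do rewrite E ?addr_gt0//.
apply: (continuous_cvg _ (@continuous_expR R _)); apply: cvgMl_tmp.
exact: (continuous_cvg _ (continuous_ln v0)).
Qed.

Context (k : R -> R) (u : R -> R -> R) (rho : R -> R).
Context (bk : bump k) (ke : forall x, k (- x) = k x).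
Context (nu : nonlocal_solution k box u) (mrho : mollifier rho).
Local Notation w := (extend u).
Let cw : L1_curve w := nonlocal_curve nu.
Let Lw t : L1 mu (w t) := nonlocal_L1 nu t.

Let box_ge0 x : 0 <= box x. Proof. by rewrite indicE. Qed.

Let w_ge0 t : {ae mu, forall x, 0 <= w t x} := curve_nonneg bk nu mrho box_ge0 t.

Lemma box_mass t : 0 <= t -> I (w t) = 1.
Proof.
move=> t0; rewrite (mass_initial bk nu mrho t0) -integral_box.
by apply: integral_ae_eq0; [exact: Lw|exact: box_L1|exact: initial_curve nu].
Qed.

Lemma logentropy_initial a : L1 mu (fun x => logentropy a (w 0 x)) ->
  \int[mu]_x logentropy a (w 0 x) = logentropy a 1.
Proof.
move=> La; have Lb := @box_L1 R.
transitivity (\int[mu]_x (logentropy a 1 * box x)); last first.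
  by rewrite integral_scale// integral_box mulr1.
apply: integral_ae_eq0; [exact: La|exact/L1_scale/box_L1|].
apply: ae_imp (initial_curve nu) => x ->; rewrite indicE.
case: (_ \in _); first by rewrite mulr1.
by rewrite mulr0 /logentropy logratio0 mulr0 subr0.
Qed.

Lemma L1_mul_ln a t : 0 < a -> L1 mu (fun x => w t x * ln (w t x + a)).
Proof.
move=> a0; have [M M0 rw] := curve_range bk nu mrho box_ge0 t.
have LC := L1_scale (a^-1 * M + `|ln a|) (L1_norm (Lw t)).
apply: (L1_ae_le _ _ LC); have mw := L1_measurable (Lw t).
  apply: measurable_funM => //; apply: (measurableT_comp (@measurable_ln R)).
  by apply: measurable_funD => //; exact: measurable_cst.
apply: ae_imp (rw t (lexx t)) => x xM; rewrite normrM mulrC ler_wpM2r//.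
exact: ln_shift_le.
Qed.

(** The entropy is run with a parameter c < a so small that its possible loss is below e, and then w
    ln(w + c) <= w ln(w + a). Keeping [a > 0] in the statement makes the logarithm bounded on the
    range of the solution. *)
Lemma integral_ln_ge0 a t : 0 < a -> 0 < t -> 0 <= \int[mu]_x (w t x * ln (w t x + a)).
Proof.
move=> a0 t0; pose T := t + 1; have tT : t < T by rewrite ltrDl.
have [M M0 rw] := curve_range bk nu mrho box_ge0 T.
have [l l0 hl] := convolution_derive_bounded bk nu T 0.
apply/ler_addgt0Pr => e e0.
(* Chosen so that the loss [l * e' * t] of entropy plus the residual [e'] at time [t] amounts to
   [e]. *)
pose e' := e / (l * t + 1).
have D0 : 0 < l * t + 1 by rewrite ltr_wpDl// mulr_ge0// ltW.
have e'0 : 0 < e' by rewrite divr_gt0.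
have en0 n : 0 < n.+1%:R^-1 :> R by rewrite invr_gt0.
have small : \forall n \near \oo, forall s, 0 <= s <= T ->
    \int[mu]_x `|n.+1%:R^-1 * logratio n.+1%:R^-1 (w s x)| <= e'.
  apply: (curve_uniform_small (phi := fun n v => n.+1%:R^-1 * logratio n.+1%:R^-1 v) cw) => //.
  - by move=> n; apply: measurable_funM; [exact: measurable_cst|exact: measurable_logratio].
  - by move=> n; rewrite logratio0 mulr0.
  - by move=> n v v' v0 v'0; exact: logratio_dist.
  - exact: cvg_logratio.
have ch : n.+1%:R^-1 @[n --> \oo] --> (0 : R) by exact: cvg_harmonic.
have [N _ /(_ N (leqnn N)) [hs ha]] := filterI small (cvg0_norm_lt ch a0).
move: hs ha; set c := N.+1%:R^-1 => hs; rewrite /= ger0_norm ?(ltW (en0 N))// => ca.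
have c0 : 0 < c by exact: en0.
have c1 : c <= 1 by rewrite /c invf_le1// ler1n.
have H := C2_on_logentropy c0 M0.
have LE s : s <= T -> L1 mu (fun x => logentropy c (w s x)).
  by move=> sT; exact: (L1_entropy_integrand nu H rw sT).
pose E s := \int[mu]_x logentropy c (w s x).
have DE s : 0 < s < t -> isd (fun s => - 1 * E s) s
    (- 1 * production k u (logentropy c) (logratio c) s).
  move=> /andP[s0 st]; apply: is_derive_scale.
  exact: (is_derive_entropy bk nu mrho H rw s0 (lt_trans st tT)).
have Ec s : 0 <= s <= t -> {for s, continuous (fun s => - 1 * E s)}.
  move=> /andP[s0 st]; apply: cvgMl_tmp.
  exact: (continuous_entropy_integral nu H rw (le_lt_trans st tT)).
have Ep s : 0 < s < t -> - 1 * production k u (logentropy c) (logratio c) s <= l * e'.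
  move=> /andP[s0 st]; rewrite mulN1r lerNl.
  have sT : s < T := lt_trans st tT.
  have s0T : 0 <= s <= T by rewrite !ltW.
  apply: (logentropy_production_ge bk ke nu mrho box_ge0 c0 _ M0 rw (hl s s0T) (hs s s0T)).
  by rewrite sT ltW.
have := growth_le t0 DE Ec Ep; rewrite !mulN1r opprK /E.
rewrite logentropy_initial; last exact: LE (ltW (lt_trans t0 tT)).
have LL := L1_logratio bk nu mrho box_ge0 t c0.
have Lln := L1_mul_ln t c0.
(* With mass one, -ln c - 1 splits off. The initial value contains the same two terms, so the
   divergent ln c cancels up to -c ln c, which is nonnegative because c <= 1. *)
rewrite (_ : \int[mu]_x logentropy c (w t x) =
    \int[mu]_x (w t x * ln (w t x + c)) - ln c + \int[mu]_x (c * logratio c (w t x)) - 1).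
  have hL : \int[mu]_x (c * logratio c (w t x)) <= e'.
    apply: le_trans (ler_norm _) _; apply: le_trans (integral_norm_le LL) _.
    by apply: hs; rewrite !ltW.
  have mono : \int[mu]_x (w t x * ln (w t x + c)) <= \int[mu]_x (w t x * ln (w t x + a)).
    apply: integral_ae_le => //; first exact: L1_mul_ln.
    apply: ae_imp (w_ge0 t) => x x0; rewrite ler_wpM2l// ler_ln ?posrE ?ltr_wpDl//.
    by rewrite lerD2l ltW.
  have lc : ln c <= 0 by exact: ln_le0.
  have l1c : 0 <= ln (1 + c) by rewrite ln_ge0// lerDl ltW.
  have e'E : l * e' * t + e' = e by rewrite /e'; field; rewrite gt_eqF.
  have h1 : 0 <= (1 + c) * ln (1 + c) by rewrite mulr_ge0// addr_ge0// ltW.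
  have h2 : c * ln c <= 0 by rewrite mulr_ge0_le0// ltW.
  move: hL mono e'E h1 h2; rewrite /logentropy /logratio.
  set x1 := \int[mu]_x _; set x2 := \int[mu]_x _; set x3 := \int[mu]_x _.
  set x4 := ln c; set x5 := ln _; set x6 := l * _ * _.
  clear; move=> *; lra.
have Lt := Lw t; have Lct := L1_scale (ln c) Lt.
transitivity (\int[mu]_x (w t x * ln (w t x + c)) - \int[mu]_x (ln c * w t x) +
    \int[mu]_x (c * logratio c (w t x)) - I (w t)); last first.
  by rewrite integral_scale// box_mass ?mulr1// ltW.
rewrite -integral_sub// -integral_add//; last exact: L1_sub.
rewrite -integral_sub//; last by apply: L1_add => //; exact: L1_sub.
by apply: eq_Rintegral => x _; rewrite /logentropy /logratio; ring.
Qed.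

Lemma L1_mul_powR a d t : 0 <= a -> 0 < d -> L1 mu (fun x => w t x * (w t x + a) `^ d).
Proof.
move=> a0 d0; have [M M0 rw] := curve_range bk nu mrho box_ge0 t.
have LC := L1_scale ((M + a) `^ d) (L1_norm (Lw t)).
apply: (L1_ae_le _ _ LC); have mw := L1_measurable (Lw t).
  apply: measurable_funM => //; apply: (measurableT_comp (@measurable_powR R d)).
  by apply: measurable_funD => //; exact: measurable_cst.
apply: ae_imp (rw t (lexx t)) => x /andP[x0 xM]; rewrite normrM mulrC ler_wpM2r//.
rewrite ger0_norm ?powR_ge0// ge0_ler_powR ?nnegrE ?addr_ge0// ?lerD2r// ltW//.
Qed.

(** The inequality exp x >= 1 + x, multiplied by the solution and integrated, gives the mass 1 plus
    [d] times a nonnegative integral. *)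
Lemma integral_mul_powR_ge1 a d t : 0 < a -> 0 < d -> 0 < t ->
  1 <= \int[mu]_x (w t x * (w t x + a) `^ d).
Proof.
move=> a0 d0 t0; rewrite -(box_mass (ltW t0)).
have Ll := L1_mul_ln t a0.
apply: (@le_trans _ _ (\int[mu]_x (w t x + d * (w t x * ln (w t x + a))))).
  rewrite integral_add//; last exact: L1_scale.
  by rewrite integral_scale// lerDl mulr_ge0 ?integral_ln_ge0// ltW.
apply: integral_ae_le.
- by apply: L1_add; [exact: Lw|exact: L1_scale].
- by apply: L1_mul_powR => //; exact: ltW.
- apply: ae_imp (w_ge0 t) => x x0.
  rewrite (_ : _ + _ = w t x * (1 + d * ln (w t x + a))); last by ring.
  by rewrite ler_wpM2l// powR_ge_ln// ltr_wpDl.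
Qed.

(** The shift tends to zero under a majorant (M + 1)^d |w|. Where w = 0 the factor w settles the
    limit, so continuity of the power is needed at positive values only. The bound 1 is the same for
    every kernel, hence for every epsilon. *)
Lemma integral_powR_ge1 d t : 0 < d -> 0 < t ->
  L1 mu (fun x => `|w t x| `^ (1 + d)) /\ 1 <= \int[mu]_x `|w t x| `^ (1 + d).
Proof.
move=> d0 t0; have [M M0 rw] := curve_range bk nu mrho box_ge0 t.
have mw := L1_measurable (Lw t).
have mf : measurable_fun setT (fun x => `|w t x| `^ (1 + d)).
  apply: (measurableT_comp (@measurable_powR R (1 + d))).
  exact: measurableT_comp.
have Lg := L1_scale ((M + 1) `^ d) (L1_norm (Lw t)).
have en0 n : 0 < n.+1%:R^-1 :> R by rewrite invr_gt0.
have en1 n : n.+1%:R^-1 <= 1 :> R by rewrite invf_le1// ler1n.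
have Lf n : L1 mu (fun x => w t x * (w t x + n.+1%:R^-1) `^ d).
  by apply: L1_mul_powR => //; exact: ltW.
have [|||L c] := @integral_dct _ _ _ mu (fun n x => w t x * (w t x + n.+1%:R^-1) `^ d)
   (fun x => `|w t x| `^ (1 + d)) (fun x => (M + 1) `^ d * `|w t x|) _ mf Lg.
- by move=> n; exact: L1_measurable (Lf n).
- move=> n; apply: ae_imp (rw t (lexx t)) => x /andP[x0 xM]; rewrite normrM mulrC ler_wpM2r//.
  rewrite ger0_norm ?powR_ge0// ge0_ler_powR ?nnegrE ?addr_ge0// ?(ltW (en0 n))//; first exact: ltW.
  by rewrite lerD.
- apply: ae_imp (w_ge0 t) => x x0; rewrite ger0_norm// -mul_powR//.
  move: x0; rewrite le_eqVlt => /orP[/eqP <-|x0].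
    by under eq_fun do rewrite mul0r; rewrite mul0r; exact: cvg_cst.
  by apply: cvgMl_tmp; exact: continuous_powR_shift.
split => //; rewrite -(cvg_lim _ c)//; apply: limr_ge; first exact: cvgP c.
by apply: nearW => n; exact: integral_mul_powR_ge1.
Qed.

End PowerBound.

(** * Non-convergence *)

Section LpNorm.
Context {R : realType}.
Local Notation mu := (@lebesgue_measure R).
Implicit Types (f g : R -> R) (p v d : R).

Lemma Lnorm_powR f p : 0 < p -> L1 mu (fun x => `|f x| `^ p) ->
  ('N[mu]_p%:E[EFin \o f] `^ p)%E = (\int[mu]_x `|f x| `^ p)%:E.
Proof.
move=> p0 L; rewrite poweR_Lnorm ?gt_eqF// /Rintegral fineK.
  by apply: eq_integral => x _; rewrite -poweR_EFin.
exact: (integrable_fin_num measurableT L).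
Qed.

Lemma Lnorm_ge1 f p : 0 < p -> L1 mu (fun x => `|f x| `^ p) ->
  (1 <= 'N[mu]_p%:E[EFin \o f])%E = (1 <= \int[mu]_x `|f x| `^ p).
Proof.
move=> p0 L; have E := Lnorm_powR p0 L; rewrite -lee_fin -E.
have N0 := Lnorm_ge0 mu p%:E (EFin \o f).
have ipos (x : \bar R) : (0 <= x)%E -> x \in `[0%E, (+oo : \bar R)%E].
  by move=> x0; rewrite in_itv/= x0 leey.
apply/idP/idP => H.
  by rewrite -(poweR1r p); apply: gt0_ler_poweR => //; [exact: ltW|exact: ipos..].
have -> : 'N[mu]_p%:E[EFin \o f]%E = (('N[mu]_p%:E[EFin \o f] `^ p) `^ p^-1)%E.
  by rewrite -poweRrM mulfV ?gt_eqF// poweRe1.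
rewrite -[leLHS](poweR1r p^-1).
by apply: gt0_ler_poweR => //; [rewrite invr_ge0 ltW|exact: ipos..|apply: ipos; exact: poweR_ge0].
Qed.

(** Minkowski's inequality for f_n = (f_n - f) + f, whose first term has vanishing norm. *)
Lemma Lnorm_limit_ge1 (f_ : nat -> R -> R) f p : 1 <= p ->
  (forall n, measurable_fun setT (f_ n)) -> measurable_fun setT f ->
  (forall n, (1 <= 'N[mu]_p%:E[EFin \o f_ n])%E) ->
  ('N[mu]_p%:E[EFin \o (f_ n \- f)%R])%E @[n --> \oo] --> 0%E ->
  (1 <= 'N[mu]_p%:E[EFin \o f])%E.
Proof.
move=> p1 mf_ mf N1 c.
have {}c : ('N[mu]_p%:E[EFin \o (f_ n \- f)%R] + 'N[mu]_p%:E[EFin \o f])%E @[n --> \oo] -->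
    (0 + 'N[mu]_p%:E[EFin \o f])%E.
  by apply: cvgeD => //; exact: cvg_cst.
rewrite -[leRHS]add0e -(cvg_lim _ c)//; apply: lime_ge; first exact: cvgP c.
apply: nearW => n; apply: le_trans (N1 n) _.
have := minkowski_EFin mu (measurable_funB (mf_ n) mf) mf p1.
by rewrite (_ : ((f_ n \- f) \+ f)%R = f_ n)//; apply/funext => x /=; rewrite subrK.
Qed.

Lemma powR_le_id v d : 0 < d -> 0 <= v <= 1 -> `|v| `^ (1 + d) <= v.
Proof.
move=> d0 /andP[]; rewrite le_eqVlt => /orP[/eqP <- _|v0 v1].
  by rewrite normr0 powR0// gt_eqF// addr_gt0.
by rewrite gtr0_norm// ge1r_powR ?v0// lerDl ltW.
Qed.

Lemma powR_eq_id v d : 0 < d -> 0 <= v -> `|v| `^ (1 + d) = v -> v = 0 \/ v = 1.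
Proof.
move=> d0; rewrite le_eqVlt => /orP[/eqP <- _|v0]; first by left.
rewrite gtr0_norm// -mul_powR ?ltW// => /(congr1 (fun x => v^-1 * x)).
rewrite mulrA mulVf ?gt_eqF// mul1r => /(congr1 (@ln R)).
rewrite ln_powR ln1 => /eqP; rewrite mulf_eq0 gt_eqF//= ln_eq0// => /eqP ->.
by right.
Qed.

(** On [0, 1] the difference v - v^(1+d) is nonnegative with zeros only at 0 and 1, and the
    hypotheses force its integral to be nonpositive. *)
Lemma integral_powR_eq01 f d : 0 < d -> L1 mu f -> {ae mu, forall x, 0 <= f x <= 1} ->
  \int[mu]_x f x <= 1 -> (1 <= 'N[mu]_(1 + d)%:E[EFin \o f])%E ->
  {ae mu, forall x, f x = 0 \/ f x = 1}.
Proof.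
move=> d0 Lf f01 If; have p0 : 0 < 1 + d by rewrite addr_gt0.
have mf := L1_measurable Lf.
have Lp : L1 mu (fun x => `|f x| `^ (1 + d)).
  apply: (L1_ae_le _ _ Lf).
    by apply: (measurableT_comp (@measurable_powR R (1 + d))); exact: measurableT_comp.
  by apply: ae_imp f01 => x fx; rewrite ger0_norm ?powR_ge0// powR_le_id.
rewrite Lnorm_ge1// => Ip.
have D0 : {ae mu, forall x, 0 <= f x - `|f x| `^ (1 + d)}.
  by apply: ae_imp f01 => x fx; rewrite subr_ge0 powR_le_id.
have := integral_ge0_eq0 (L1_sub Lf Lp) D0.
rewrite integral_sub// subr_le0 => /(_ (le_trans If Ip)) E.
apply: (ae_imp2 _ f01 E) => x /andP[x0 _] /eqP; rewrite subr_eq0 => /eqP h.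
exact: powR_eq_id d0 x0 (esym h).
Qed.

Lemma mollifier_kernel (eta : R -> R) : convolution_kernel eta ->
  (forall x, eta (- x) = eta x) -> mollifier eta.
Proof. by move=> [se e1 e0 eI] ee; split => //; split => //; exists 1. Qed.

End LpNorm.

Theorem mainTheorem6 (R : realType) (eta : R -> R)
    (u : R -> R -> R) (ueps : R -> R -> R -> R) :
  convolution_kernel eta ->
  (forall x, eta (- x) = eta x) ->
  entropy_solution (fun v => v ^+ 2) \1_`]-1, 0[ u ->
  (forall e, 0 < e <= 1 ->
    nonlocal_solution (rescale eta e) \1_`]-1, 0[ (ueps e)) ->
  forall delta t : R, 0 < delta -> 0 < t ->
  ~ exists eps : nat -> R,
      [/\ forall k, 0 < eps k <= 1,
          eps k @[k --> \oo] --> 0 &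
          ('N[@lebesgue_measure R]_(1 + delta)%:E[
             EFin \o (ueps (eps k) t \- u t)%R])%E @[k --> \oo] --> 0%E].
Proof.
move=> keta eeta su sueps delta t d0 t0 [eps [eps01 _ c]].
(* The kernel [eta] itself is taken as the auxiliary mollifier [rho] of the preceding sections; its
   rescalings are the interaction kernels. *)
have meta := mollifier_kernel keta eeta; have [_ eta1 _ _] := keta.
have p0 : 0 < 1 + delta by rewrite addr_gt0.
have p1 : 1 <= 1 + delta by rewrite lerDl ltW.
have [u01 Iu] := entropy_solution_range meta su (ltW t0).
apply: (entropy_solution_not_binary meta eta1 su t0).
have cu : L1_curve (extend u) by case: su => s _ _; exact: solution_curve.
have [_ /(_ t) Lu _ _] := cu.
apply: (integral_powR_eq01 d0 Lu u01 Iu).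
have ce k : L1 (@lebesgue_measure R) (ueps (eps k) t).
  have := nonlocal_L1 (sueps _ (eps01 k)) t; by rewrite extendE// ltW.
apply: (Lnorm_limit_ge1 p1 (fun k => L1_measurable (ce k)) (L1_measurable Lu)); last first.
  by rewrite extendE// ltW.
move=> k; have /andP[ek0 _] := eps01 k.
have mk := mollifier_rescale ek0 meta; have [bk _ ke _] := mk.
have [Lp Ip] := integral_powR_ge1 bk ke (sueps _ (eps01 k)) meta d0 t0.
by rewrite -(extendE (ueps (eps k)) (ltW t0)) (Lnorm_ge1 p0 Lp).
Qed.
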